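(* For $i=1,2$ let $\boldsymbol{k}_i$ be a linearly surjective differential field, $\Gamma_i$ an ordered abelian group, and $c_i:\Gamma_i\to \boldsymbol{k}_i$ an additive map, and let $K_{i,c_i}=\boldsymbol{k}_i((t^{\Gamma_i}))_{c_i}$ be the corresponding Hahn valued differential field. If the $2$-sorted structures $(\boldsymbol{k}_1,\Gamma_1;c_1)$ and $(\boldsymbol{k}_2,\Gamma_2;c_2)$ are elementarily equivalent, then $K_{1,c_1}$ and $K_{2,c_2}$ are elementarily equivalent as valued differential fields. (That is, for $\boldsymbol{k}$ linearly surjective, $\mathrm{Th}(K_c)$ is completely determined by $\mathrm{Th}(\boldsymbol{k},\Gamma;c)$.)
   Context: All differential fields have characteristic $0$ and a single distinguished derivation. A differential field $\boldsymbol{k}$ with derivation $\partial$ is linearly surjective if for every nonzero linear differential operator $A=a_0+a_1\partial+\dots+a_n\partial^n$ over $\boldsymbol{k}$ we have $A(\boldsymbol{k})=\boldsymbol{k}$. Given a differential field $\boldsymbol{k}$ with derivation $\partial$, an ordered abelian group $\Gamma$, and an additive map $c:\Gamma\to\boldsymbol{k}$, let $K=\boldsymbol{k}((t^\Gamma))$ be the Hahn field with its usual valuation, and let $K_c=\boldsymbol{k}((t^\Gamma))_c$ be the valued differential field $K$ with derivation $\partial_c\big(\sum_\gamma a_\gamma t^\gamma\big)=\sum_\gamma\big(\partial(a_\gamma)+c(\gamma)a_\gamma\big)t^\gamma$. $(\boldsymbol{k},\Gamma;c)$ is the $2$-sorted structure consisting of the differential field $\boldsymbol{k}$, the ordered abelian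 group $\Gamma$, and the map $c:\Gamma\to\boldsymbol{k}$. $\mathrm{Th}(K_c)$ is the first-order theory of $K_c$ as a valued differential field (in the language of rings with a symbol for the derivation and a symbol for the valuation, e.g. a predicate for the valuation ring). *)

(* Defs.v *)
From HB Require Import structures.
From mathcomp Require Import all_boot all_order all_algebra.
From mathcomp Require Import all_classical.

Set Implicit Arguments.
Unset Strict Implicit.
Unset Printing Implicit Defensive.

Import Order.TTheory GRing.Theory.
Local Open Scope classical_set_scope.
Local Open Scope ring_scope.

(** * Many-sorted first-order logic with equality *)

Record language := Language {
  sort : Type;
  fsym : Type;
  farity : fsym -> nat;
  farg : forall f, 'I_(farity f) -> sort;
  fres : fsym -> sort;
  rsym : Type;
  rarity : rsym -> nat;
  rarg : forall r, 'I_(rarity r) -> sort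
}.

Record structure (L : language) := Structure {
  carrier :> sort L -> Type;
  fint : forall f : fsym L, (forall i, carrier (farg (f := f) i)) ->
    carrier (fres f);
  rint : forall r : rsym L, (forall i, carrier (rarg (r := r) i)) -> Prop
}.

(* Well-sorted de Bruijn syntax: a context is the list of the sorts of the
   variables in scope, the most recently bound one first. *)
Inductive var (S : Type) : seq S -> S -> Type :=
| VZ s G : var (s :: G) s
| VS s s' G : var G s -> var (s' :: G) s.

Inductive term (L : language) (G : seq (sort L)) : sort L -> Type :=
| TVar s : var G s -> term G s
| TApp (f : fsym L) : (forall i, term G (farg (f := f) i)) -> term G (fres f).

(* Classically {=, R, False, ->, forall} generates all of first-order logic. *)
Inductive formula (L : language) : seq (sort L) -> Type :=
| FEq G s : term G s -> term G s -> formula G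
| FRel G (r : rsym L) : (forall i, term G (rarg (r := r) i)) -> formula G
| FFalse G : formula G
| FImp G : formula G -> formula G -> formula G
| FAll G s : formula (s :: G) -> formula G.

Definition sentence (L : language) := @formula L [::].

Definition env (L : language) (M : structure L) (G : seq (sort L)) :=
  forall s, var G s -> M s.

Definition env_nil (L : language) (M : structure L) : env M [::] :=
  fun s v => match v in var G s return (if G is [::] then M s else unit) with
             | VZ _ _ => tt
             | VS _ _ _ _ => tt
             end.

Definition env_cons (L : language) (M : structure L) (s : sort L)
    (G : seq (sort L)) (x : M s) (e : env M G) : env M (s :: G) :=
  fun s' v =>
    match v in var G' s'
      return (if G' is s0 :: G0 then M s0 -> env M G0 -> M s' else unit) with
    | VZ _ _ => fun x _ => x
    | VS _ _ _ v' => fun _ e => e _ v'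
    end x e.

Fixpoint eval (L : language) (M : structure L) (G : seq (sort L))
    (e : env M G) (s : sort L) (t : term G s) : M s :=
  match t with
  | TVar _ v => e _ v
  | TApp f a => fint (fun i => eval e (a i))
  end.

Fixpoint holds (L : language) (M : structure L) (G : seq (sort L))
    (phi : formula G) : env M G -> Prop :=
  match phi with
  | FEq _ _ t u => fun e => eval e t = eval e u
  | FRel _ _ a => fun e => rint (fun i => eval e (a i))
  | FFalse _ => fun _ => False
  | FImp _ p q => fun e => holds p e -> holds q e
  | FAll _ s p => fun e => forall x : M s, holds p (env_cons x e)
  end.

Definition models (L : language) (M : structure L) (phi : sentence L) :=
  holds phi (@env_nil L M).

Definition elementarily_equivalent (L : language) (M N : structure L) :=
  forall phi : sentence L, models M phi <-> models N phi.

(** * Differential fields of characteristic 0 and ordered abelian groups *)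

HB.mixin Record Field_isDifferential K of GRing.Field K := {
  der : K -> K;
  derD : {morph der : x y / x + y};
  derM : forall x y, der (x * y) = der x * y + x * der y;
  diff_pchar0 : [pchar K] =i pred0
}.

#[short(type="diffFieldType")]
HB.structure Definition DiffField :=
  {K of GRing.Field K & Field_isDifferential K}.

HB.mixin Record POrderedZmodule_isOrderedAbGroup G of Num.POrderedZmodule G := {
  oag_le_total : total (<=%R : rel G);
  oag_leD2l : forall z x y : G, x <= y -> z + x <= z + y
}.

(* Totality is a field rather than inherited from [Order.Total]: Hierarchy
   Builder cannot insert that join below the existing [Num.RealDomain]. *)
#[short(type="orderedAbGroupType")]
HB.structure Definition OrderedAbGroup :=
  {G of Num.POrderedZmodule G & POrderedZmodule_isOrderedAbGroup G}.

(* The tuple a is the operator a_0 + a_1 der + ... + a_n der^n. *)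
Definition linearly_surjective (k : diffFieldType) :=
  forall (n : nat) (a : 'I_n.+1 -> k), (exists i, a i != 0) ->
    forall b : k, exists y : k, \sum_(i < n.+1) a i * iter i der y = b.

(** * The Hahn field k((t^G)) with the derivation twisted by c *)

Definition is_least (G : orderedAbGroupType) (A : set G) (x : G) :=
  A x /\ forall y, A y -> x <= y.

Definition well_ordered (G : orderedAbGroupType) (A : set G) :=
  forall B : set G, B `<=` A -> B !=set0 -> exists x, is_least B x.

Definition hsupp (k : diffFieldType) (G : orderedAbGroupType) (f : G -> k) :
  set G := [set g | f g != 0].

Record hahn (k : diffFieldType) (G : orderedAbGroupType) := Hahn {
  hcoef :> G -> k;
  hahn_wo : well_ordered (hsupp hcoef)
}.
Arguments hahn_wo {k G} h _ _ _.

Section WellOrdered.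
Variable G : orderedAbGroupType.
Implicit Types (A B C : set G).

Lemma oag_comparable (x y : G) : x >=< y.
Proof. exact: oag_le_total. Qed.

Lemma oag_leNgt (x y : G) : (x <= y) = ~~ (y < x).
Proof. exact/comparable_leNgt/oag_comparable. Qed.

Lemma oag_leD2lE (z x y : G) : (z + x <= z + y) = (x <= y).
Proof.
apply/idP/idP; last exact: oag_leD2l.
by move=> /(oag_leD2l (- z)); rewrite !addKr.
Qed.

Lemma well_ordered_sub A B : A `<=` B -> well_ordered B -> well_ordered A.
Proof. by move=> AB wB C CA; apply: wB; apply: subset_trans AB. Qed.
Arguments well_ordered_sub {A B} _ _ _ _ _.

Lemma well_orderedU A B :
  well_ordered A -> well_ordered B -> well_ordered (A `|` B).
Proof.
move=> wA wB C CAB [c Cc].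
have [[a [[Ca Aa] amin]]|nA] := pselect (exists x, is_least (C `&` A) x).
  have [[b [[Cb Bb] bmin]]|nB] := pselect (exists x, is_least (C `&` B) x).
    have /orP[ab|ba] := oag_le_total a b; [exists a|exists b]; split=> // x Cx.
    - have [Ax|Bx] := CAB x Cx; first exact: amin.
      by apply: le_trans ab _; apply: bmin.
    - have [Ax|Bx] := CAB x Cx; last exact: bmin.
      by apply: le_trans ba _; apply: amin.
  exists a; split=> // x Cx; have [Ax|Bx] := CAB x Cx; first exact: amin.
  by exfalso; apply: nB; apply: wB; [move=> y [] | exists x].
have CB : C `<=` B.
  move=> x Cx; have [Ax|//] := CAB x Cx.
  by exfalso; apply: nA; apply: wA; [move=> y [] | exists x].
by apply: wB => //; exists c.
Qed.
Arguments well_orderedU {A B} _ _ _ _ _.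

Lemma well_orderedD A B : well_ordered A -> well_ordered B ->
  well_ordered [set g | exists a b, [/\ A a, B b & g = a + b]].
Proof.
move=> wA wB C CAB [c Cc]; apply: contrapT => nC.
pose T := [set b | B b /\ exists a, [/\ A a, C (a + b) &
  forall a' b', A a' -> B b' -> C (a' + b') -> a' + b' < a + b -> a <= a']].
have [a [b [Aa Bb cab]]] := CAB c Cc.
have [a0 [[Aa0 [b0 [Bb0 Cab0]]] a0min]] :
    exists x, is_least [set a | A a /\ exists b, B b /\ C (a + b)] x.
  by apply: wA => [x []//|]; exists a; split=> //; exists b; rewrite -cab.
have [b1 [[Bb1 [a1 [Aa1 Cab1 a1min]]] b1min]] : exists x, is_least T x.
  apply: wB => [x []//|]; exists b0; split=> //; exists a0; split=> //.
  by move=> a' b' Aa' Bb' Cab' _; apply: a0min; split=> //; exists b'.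
have [d Cd dlt] : exists2 d, C d & d < a1 + b1.
  apply: contrapT => nd; apply: nC; exists (a1 + b1); split=> // y Cy.
  by rewrite oag_leNgt; apply/negP => ylt; apply: nd; exists y.
have [p [q [Ap Bq dpq]]] := CAB d Cd; rewrite {d}dpq in Cd dlt.
have [a2 [[Aa2 [b2 [Bb2 Cab2 lt2]]] a2min]] : exists x, is_least
    [set a | A a /\ exists b, [/\ B b, C (a + b) & a + b < a1 + b1]] x.
  by apply: wA => [x []//|]; exists p; split=> //; exists q.
have a12 : a1 <= a2 by apply: a1min lt2.
have b12 : b1 <= b2.
  apply: b1min; split=> //; exists a2; split=> // a' b' Aa' Bb' Cab' lt'.
  by apply: a2min; split=> //; exists b'; split=> //; apply: lt_trans lt2.
have: a1 + b1 <= a2 + b2.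
  apply: (@le_trans _ _ (a1 + b2)); first by rewrite oag_leD2lE.
  by rewrite ![_ + b2]addrC oag_leD2lE.
by rewrite oag_leNgt lt2.
Qed.
Arguments well_orderedD {A B} _ _ _ _ _.

(* Hence the finitely supported sum in [hahn_mul] never takes its junk value. *)
Lemma well_ordered_finite_fiber A B (g : G) : well_ordered A -> well_ordered B ->
  finite_set [set a | A a /\ B (g - a)].
Proof.
move=> wA wB; set S := [set a | _].
have Smax C : C `<=` S -> C !=set0 -> exists2 x, C x & forall y, C y -> y <= x.
  move=> CS [c Cc].
  have [b [[Bb Cb] bmin]] : exists x, is_least [set b | B b /\ C (g - b)] x.
    apply: wB => [x []//|]; exists (g - c); split; first by case: (CS c Cc).
    by rewrite opprB addrC subrK.
  exists (g - b) => // y Cy; have /bmin : B (g - y) /\ C (g - (g - y)).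
    by split; [case: (CS y Cy) | rewrite opprB addrC subrK].
  by rewrite -(oag_leD2lE (y - b)) subrK addrC addrA subrK addrC.
have Sfin x : S x -> finite_set [set y | S y /\ y <= x].
  move=> Sx; apply: contrapT => nfx.
  have [z [[Sz nfz] zmin]] : exists z, is_least
      [set z | S z /\ ~ finite_set [set y | S y /\ y <= z]] z.
    by apply: wA => [w [[]]//|]; exists x.
  have [[y [Sy yz]]|ne] := pselect ([set y | S y /\ y < z] !=set0).
    have [w [Sw wz] wmax] : exists2 w, [set y | S y /\ y < z] w &
        forall y, [set y | S y /\ y < z] y -> y <= w.
      by apply: Smax => [v []//|]; exists y.
    have finw : finite_set [set y | S y /\ y <= w].
      apply: contrapT => nfw.
      by have := zmin w (conj Sw nfw); rewrite oag_leNgt wz.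
    apply: nfz; apply: (@sub_finite_set _ _ ([set y | S y /\ y <= w] `|` [set z])).
      move=> v [Sv]; rewrite le_eqVlt => /orP[/eqP ->|vz]; [by right|left].
      by split=> //; apply: wmax.
    by rewrite finite_setU; split.
  apply: nfz; apply: (@sub_finite_set _ _ [set z]) => // v [Sv].
  rewrite le_eqVlt => /orP[/eqP -> //|vz].
  by exfalso; apply: ne; exists v.
have [[x Sx]|ne] := pselect (S !=set0).
  have [w Sw wmax] := Smax S (fun _ h => h) (ex_intro _ x Sx).
  apply: sub_finite_set (Sfin w Sw) => y Sy.
  by split=> //; apply: wmax.
by apply: (@sub_finite_set _ _ set0) => // y Sy; apply: ne; exists y.
Qed.

End WellOrdered.

Section HahnOperations.
Variables (k : diffFieldType) (G : orderedAbGroupType).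
Implicit Type f : hahn k G.

Fact hahn_monomial_subproof (x : k) (g : G) :
  well_ordered (hsupp (fun h => if h == g then x else 0)).
Proof.
move=> B BA [b Bb]; have Bg y : B y -> y = g.
  by move=> /BA; rewrite /hsupp /=; case: (y =P g) => // _; rewrite eqxx.
by exists b; split=> // y By; rewrite (Bg _ Bb) (Bg _ By).
Qed.
Definition hahn_monomial (x : k) (g : G) : hahn k G :=
  Hahn (@hahn_monomial_subproof x g).

Definition hahn_zero : hahn k G := hahn_monomial 0 0.
Definition hahn_one : hahn k G := hahn_monomial 1 0.

Fact hahn_opp_subproof f : well_ordered (hsupp (fun g => - f g)).
Proof.
by apply: (well_ordered_sub _ (hahn_wo f)) => g; rewrite /hsupp /= oppr_eq0.
Qed.
Definition hahn_opp f : hahn k G := Hahn (@hahn_opp_subproof f).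

Fact hahn_add_subproof f1 f2 : well_ordered (hsupp (fun g => f1 g + f2 g)).
Proof.
apply: (well_ordered_sub _ (well_orderedU (hahn_wo f1) (hahn_wo f2))) => g.
rewrite /hsupp /=; have [->|nz _] := eqVneq (f1 g) 0; last by left.
by rewrite add0r; right.
Qed.
Definition hahn_add f1 f2 : hahn k G := Hahn (@hahn_add_subproof f1 f2).

Fact hahn_mul_subproof f1 f2 :
  well_ordered (hsupp (fun g => \sum_(a \in [set: G]) f1 a * f2 (g - a))).
Proof.
apply: (well_ordered_sub _ (well_orderedD (hahn_wo f1) (hahn_wo f2))) => g nz.
apply: contrapT => nab; move/eqP: nz; apply; apply: fsbig1 => a _.
have [->|nz1] := eqVneq (f1 a) 0; first by rewrite mul0r.
have [->|nz2] := eqVneq (f2 (g - a)) 0; first by rewrite mulr0.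
by exfalso; apply: nab; exists a, (g - a); split=> //; rewrite addrC subrK.
Qed.
Definition hahn_mul f1 f2 : hahn k G := Hahn (@hahn_mul_subproof f1 f2).

Lemma der0 : der (0 : k) = 0.
Proof. by apply: (addrI (der (0 : k))); rewrite -derD !addr0. Qed.

Fact hahn_der_subproof (c : {additive G -> k}) f :
  well_ordered (hsupp (fun g => der (f g) + c g * f g)).
Proof.
apply: (well_ordered_sub _ (hahn_wo f)) => g; rewrite /hsupp /=; apply: contra_neq.
by move=> ->; rewrite der0 mulr0 addr0.
Qed.
Definition hahn_der (c : {additive G -> k}) f : hahn k G :=
  Hahn (@hahn_der_subproof c f).

(* The least element of the support; [None] stands for the value +oo at 0. *)
Definition hahn_val f : option G :=
  xget None [set v | exists2 g, v = Some g & is_least (hsupp f) g].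

Definition hahn_valring f : Prop :=
  if hahn_val f is Some g then 0 <= g else True.

End HahnOperations.

(** * The 2-sorted language of (k, G; c) *)

Inductive kgc_sort := KField | KGroup.
Inductive kgc_fsym :=
  | KZero | KOne | KOpp | KAdd | KMul | KDer | GZero | GOpp | GAdd | CMap.
Inductive kgc_rsym := GLe.

Definition kgc_language : language := {|
  sort := kgc_sort;
  fsym := kgc_fsym;
  farity f := match f with
    | KZero | KOne | GZero => 0
    | KOpp | KDer | GOpp | CMap => 1
    | KAdd | KMul | GAdd => 2
    end%N;
  farg f _ := match f with
    | KZero | KOne | KOpp | KAdd | KMul | KDer => KField
    | GZero | GOpp | GAdd | CMap => KGroup
    end;
  fres f := match f with
    | KZero | KOne | KOpp | KAdd | KMul | KDer | CMap => KField
    | GZero | GOpp | GAdd => KGroup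
    end;
  rsym := kgc_rsym;
  rarity _ := 2%N;
  rarg _ _ := KGroup
|}.

Definition kgc_structure (k : diffFieldType) (G : orderedAbGroupType)
    (c : {additive G -> k}) : structure kgc_language :=
  let M (s : sort kgc_language) : Type :=
    match s with KField => k | KGroup => G end in
  @Structure kgc_language M
    (fun f => match f return
         (forall i, M (farg (l := kgc_language) (f := f) i)) ->
         M (fres (l := kgc_language) f) with
       | KZero => fun _ => 0 : k
       | KOne => fun _ => 1 : k
       | KOpp => fun a => - (a ord0 : k)
       | KAdd => fun a => (a ord0 : k) + (a ord_max : k)
       | KMul => fun a => (a ord0 : k) * (a ord_max : k)
       | KDer => fun a => der (a ord0 : k)
       | GZero => fun _ => 0 : G
       | GOpp => fun a => - (a ord0 : G)
       | GAdd => fun a => (a ord0 : G) + (a ord_max : G)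
       | CMap => fun a => c (a ord0 : G)
       end)
    (fun r a => ((a ord0 : G) <= (a ord_max : G))).

(** * The language of valued differential fields *)

Inductive vdf_fsym := VZero | VOne | VOpp | VAdd | VMul | VDer.
Inductive vdf_rsym := VRing.

Definition vdf_language : language := {|
  sort := unit;
  fsym := vdf_fsym;
  farity f := match f with
    | VZero | VOne => 0
    | VOpp | VDer => 1
    | VAdd | VMul => 2
    end%N;
  farg _ _ := tt;
  fres _ := tt;
  rsym := vdf_rsym;
  rarity _ := 1%N;
  rarg _ _ := tt
|}.

Definition hahn_structure (k : diffFieldType) (G : orderedAbGroupType)
    (c : {additive G -> k}) : structure vdf_language :=
  @Structure vdf_language (fun _ => hahn k G)
    (fun f => match f return
         ('I_(farity (l := vdf_language) f) -> hahn k G) -> hahn k G with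
       | VZero => fun _ => hahn_zero k G
       | VOne => fun _ => hahn_one k G
       | VOpp => fun a => hahn_opp (a ord0)
       | VAdd => fun a => hahn_add (a ord0) (a ord_max)
       | VMul => fun a => hahn_mul (a ord0) (a ord_max)
       | VDer => fun a => hahn_der c (a ord0)
       end)
    (fun r a => hahn_valring (a ord0)).

(* Main.v *)
(* Over a nonprincipal ultrafilter on nat, both the Hahn fields and the structures
   (k, Gamma; c) have countably saturated ultrapowers, so it suffices to play a
   back-and-forth game between the ultrapowers A and B of the two Hahn fields.  A
   position consists of a countable elementary relation between the ultrapowers of
   (k_i, Gamma_i; c_i) and a countable differential subring Phi of A * B, both
   components of whose elements vanish or have related leading terms.

   To add x in A to the domain, first extend the elementary relation so that its
   domain contains all leading terms of a suitable countable subring E of A with x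
   in E, close Phi under the new monomials, and extend it maximally inside E.  If
   every differential polynomial P over Phi has constant leading term on some ball
   around x with centre in Phi, then any y in the corresponding balls of B matches
   x.  Otherwise take a minimal P without this property.  Its partial derivatives
   do have it, so that near x the polynomial P is dominated by its linear part; by
   spherical completeness and linear surjectivity of k, Newton steps then yield a
   zero of P in A and one in B.  Adjoining this pair of zeros to Phi contradicts
   maximality: by pseudo-division by P, minimality controls all leading terms. *)

From HB Require Import structures.
From mathcomp Require Import finmap.
From mathcomp Require Import all_boot all_order all_algebra.
From mathcomp Require Import all_classical.
From mathcomp Require Import mpoly.
Require Import Defs.

Set Implicit Arguments.
Unset Strict Implicit.
Unset Printing Implicit Defensive.

Import Order.TTheory GRing.Theory.
Local Open Scope classical_set_scope.
Local Open Scope ring_scope.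

(** * Ultrapowers over a nonprincipal ultrafilter on nat *)

(** The derivation acts coefficient by coefficient and never lowers the valuation, so an element and
    all its derivatives satisfy the same valuation bounds. Differential polynomials can thus be
    handled as ordinary polynomials in several variables with one common radius. On a monomial of
    exponent d the derivation acts as der + c(d). This is why linear surjectivity is applied to
    operators twisted by c(d), and why each new exponent must bring c(d) into the related part of k.

    Spherical completeness speaks of arbitrary nests of balls, which is out of reach of Los's
    theorem; only its consequence for zeros of single polynomials is carried to the ultrapowers. The
    zero found near x need not be x. It is therefore played against the maximality of Phi inside E,
    not against x itself, and this forces E to be closed under zeros in prescribed balls. As E is
    countable and the first projection is injective on Phi, an extension obtained from Zorn's lemma
    is still countable, and saturation applies again at the next move. *)

Fact ultrafilter_subproof :
  exists U : set_system nat, UltraFilter U /\ forall n, U [set m | (n <= m)%N].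
Proof.
have [U [UU FU]] := ultraFilterLemma eventually_filter.
by exists U; split=> // n; apply: FU; exists n.
Qed.

Definition ufilter : set_system nat := projT1 (cid ultrafilter_subproof).

Definition ae (P : nat -> Prop) : Prop := ufilter P.

#[local] Instance ufilter_ultra : UltraFilter ufilter.
Proof. exact: (projT2 (cid ultrafilter_subproof)).1. Qed.

Lemma ae_ge n : ae (fun m => (n <= m)%N).
Proof. exact: (projT2 (cid ultrafilter_subproof)).2. Qed.

Lemma aeS (P Q : nat -> Prop) : (forall n, P n -> Q n) -> ae P -> ae Q.
Proof. by move=> PQ; apply: filterS. Qed.

Lemma aeT (P : nat -> Prop) : (forall n, P n) -> ae P.
Proof. by move=> PT; apply: (@aeS (fun m => (0 <= m)%N)) (ae_ge 0) => n _. Qed.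

Lemma aeI (P Q : nat -> Prop) : ae P -> ae Q -> ae (fun n => P n /\ Q n).
Proof. exact: filterI. Qed.

Lemma aeS2 (P Q S : nat -> Prop) :
  (forall n, P n -> Q n -> S n) -> ae P -> ae Q -> ae S.
Proof. by move=> PQS aP aQ; apply: aeS (aeI aP aQ) => n []; apply: PQS. Qed.

Lemma ae_const (P : Prop) : ae (fun _ => P) -> P.
Proof.
move=> aP; apply: contrapT => nP; apply: (@filter_not_empty _ ufilter).
by apply: (@aeS (fun _ => P)) aP => n /nP.
Qed.

Lemma aeN (P : nat -> Prop) : ae (fun n => ~ P n) <-> ~ ae P.
Proof.
split=> [nP aP|]; first by apply: (@ae_const False); apply: aeS2 nP aP.
by move=> naP; have [//|] := in_ultra_setVsetC P ufilter_ultra.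
Qed.

Lemma ae_imp (P Q : nat -> Prop) : ae (fun n => P n -> Q n) <-> (ae P -> ae Q).
Proof.
split=> [PQ aP|PQ]; first by apply: aeS2 PQ aP => n; apply.
have [/PQ|/aeN] := pselect (ae P); first exact: aeS.
by apply: aeS => n nP /nP.
Qed.

Lemma ae_or (P Q : nat -> Prop) : ae (fun n => P n \/ Q n) -> ae P \/ ae Q.
Proof.
move=> PQ; have [|/aeN nP] := pselect (ae P); [by left | right].
by apply: aeS2 PQ nP => n [].
Qed.

Lemma ae_all_in (T : eqType) (s : seq T) (P : T -> nat -> Prop) :
  (forall x, x \in s -> ae (P x)) -> ae (fun n => forall x, x \in s -> P x n).
Proof.
elim: s => [_|x s IHs Ps]; first exact: aeT.
have := IHs (fun y ys => Ps y (mem_behead (s := x :: s) ys)).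
apply: aeS2 (Ps x (mem_head x s)) => n Px Psn y.
by rewrite inE => /predU1P[->|/Psn].
Qed.

(** An element is its equivalence class, as a set of sequences. With proof irrelevance, almost
    everywhere equal sequences have equal classes in the sense of Leibniz. *)
Record ult (X : Type) := Ult {
  ucls : set (nat -> X);
  ucls_ex : exists f, ucls = [set g | ae (fun n => f n = g n)]
}.

HB.instance Definition _ (X : Type) := gen_eqMixin (ult X).
HB.instance Definition _ (X : Type) := gen_choiceMixin (ult X).

Definition cl (T : Type) (f : nat -> T) : ult T := Ult (ex_intro _ f erefl).

Lemma ucls_inj (T : Type) : injective (@ucls T).
Proof.
case=> S p [S' q] /= E; case: S' / E q => q.
by rewrite (Prop_irrelevance p q).
Qed.

Lemma cl_eqP (T : Type) (f g : nat -> T) : cl f = cl g <-> ae (fun n => f n = g n).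
Proof.
split=> [[E]|].
  have : [set h | ae (fun n => f n = h n)] g by rewrite E; apply: aeT.
  by [].
move=> fg; apply: ucls_inj; apply/seteqP; split=> h /=; apply: aeS2 fg => n; last by move=> ->.
by move=> <- <-.
Qed.

Lemma cl_surj (T : Type) (x : ult T) : exists f, x = cl f.
Proof.
by have [f fE] := ucls_ex x; exists f; apply: ucls_inj.
Qed.

Definition rep (T : Type) (x : ult T) : nat -> T := projT1 (cid (cl_surj x)).

Lemma repK (T : Type) (x : ult T) : cl (rep x) = x.
Proof. by rewrite /rep; case: cid. Qed.

Lemma rep_cl (T : Type) (f : nat -> T) : ae (fun n => rep (cl f) n = f n).
Proof. by apply/cl_eqP; rewrite repK. Qed.

HB.lock Definition umap (X Y : Type) (h : X -> Y) (x : ult X) : ult Y :=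
  cl (fun n => h (rep x n)).

HB.lock Definition umap2 (X Y Z : Type) (h : X -> Y -> Z) (x : ult X)
  (y : ult Y) : ult Z := cl (fun n => h (rep x n) (rep y n)).

Section UltrapowerType.
Variables X Y Z : Type.

Lemma umapE (h : X -> Y) f : umap h (cl f) = cl (fun n => h (f n)).
Proof. by rewrite umap.unlock; apply/cl_eqP; apply: aeS (rep_cl f) => n ->. Qed.

Lemma umap2E (h : X -> Y -> Z) f g : umap2 h (cl f) (cl g) = cl (fun n => h (f n) (g n)).
Proof.
rewrite umap2.unlock; apply/cl_eqP.
by apply: aeS2 (rep_cl f) (rep_cl g) => n -> ->.
Qed.

Definition urel2 (r : X -> Y -> Prop) (x : ult X) (y : ult Y) : Prop :=
  ae (fun n => r (rep x n) (rep y n)).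

Lemma urel2E r f g : urel2 r (cl f) (cl g) <-> ae (fun n => r (f n) (g n)).
Proof.
by split; apply: aeS2 (aeI (rep_cl f) (rep_cl g)) => n [-> ->].
Qed.

(* Diagonalisation: in coordinate n, satisfy as many of the first n conditions
   as possible. *)
Lemma ult_saturated (A : nat -> nat -> X -> Prop) :
  (forall J, exists f : nat -> X, forall j, (j < J)%N -> ae (fun n => A j n (f n))) ->
  exists f : nat -> X, forall j, ae (fun n => A j n (f n)).
Proof.
move=> /choice[F FP].
(* The bound [J <= n] makes the maximum over [J] exist; it costs nothing, since it holds for almost
   all [n]. *)
pose B J n := (J <= n)%N && `[< forall j, (j < J)%N -> A j n (F J n) >].
have Bae J : ae (fun n => (J <= n)%N /\ forall j, (j < J)%N -> A j n (F J n)).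
  apply: aeI (ae_ge J) _.
  apply: (@aeS (fun n => forall j, j \in iota 0 J -> A j n (F J n))).
    by move=> n An j jJ; apply: An; rewrite mem_iota.
  by apply: ae_all_in => j; rewrite mem_iota => /andP[_ jJ]; apply: FP.
have B0 n : exists J, B J n by exists 0%N; apply/andP; split=> //; apply/asboolP.
have Bn n J : B J n -> (J <= n)%N by case/andP.
pose J n := ex_maxn (B0 n) (Bn n).
exists (fun n => F (J n) n) => j; apply: aeS (Bae j.+1) => n [jn Aj].
rewrite /J; case: ex_maxnP => m /andP[_ /asboolP Am] mmax.
by apply: Am; apply: mmax; apply/andP; split=> //; apply/asboolP.
Qed.

End UltrapowerType.

Section UltraZmodule.
Variable V : zmodType.

Definition uopp : ult V -> ult V := umap -%R.
Definition uadd : ult V -> ult V -> ult V := umap2 +%R.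
Definition uzero : ult V := cl (fun=> 0).

Fact uaddA : associative uadd.
Proof.
move=> x y z; rewrite -[x]repK -[y]repK -[z]repK.
by rewrite /uadd !umap2E; congr cl; apply/funext => n; rewrite addrA.
Qed.

Fact uaddC : commutative uadd.
Proof.
move=> x y; rewrite -[x]repK -[y]repK.
by rewrite /uadd !umap2E; congr cl; apply/funext => n; rewrite addrC.
Qed.

Fact uadd0 : left_id uzero uadd.
Proof.
move=> x; rewrite -[x]repK.
by rewrite /uadd umap2E; congr cl; apply/funext => n; rewrite add0r.
Qed.

Fact uaddN : left_inverse uzero uopp uadd.
Proof.
move=> x; rewrite -[x]repK /uadd /uopp umapE umap2E.
by congr cl; apply/funext => n; rewrite addNr.
Qed.

HB.instance Definition _ := GRing.isZmodule.Build (ult V) uaddA uaddC uadd0 uaddN.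

Lemma cl0 : cl (fun=> 0 : V) = 0.
Proof. by []. Qed.

Lemma clD (f g : nat -> V) : cl f + cl g = cl (fun n => f n + g n).
Proof. exact: umap2E. Qed.

Lemma clN (f : nat -> V) : - cl f = cl (fun n => - f n).
Proof. exact: umapE. Qed.

Lemma clB (f g : nat -> V) : cl f - cl g = cl (fun n => f n - g n).
Proof. by rewrite clN clD. Qed.

Lemma cl_sum (I : Type) (s : seq I) (F : I -> nat -> V) :
  \sum_(i <- s) cl (F i) = cl (fun n => \sum_(i <- s) F i n).
Proof.
elim: s => [|i s IHs].
  by rewrite big_nil -cl0; congr cl; apply/funext => n; rewrite big_nil.
by rewrite big_cons IHs clD; congr cl; apply/funext => n; rewrite big_cons.
Qed.

Lemma clMn (f : nat -> V) m : cl f *+ m = cl (fun n => f n *+ m).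
Proof.
elim: m => [|m IHm]; first by [].
by rewrite mulrS IHm clD; congr cl; apply/funext => n; rewrite mulrS.
Qed.

End UltraZmodule.

Section UltraRing.
Variable R : comNzRingType.

Definition umul : ult R -> ult R -> ult R := umap2 *%R.
Definition uone : ult R := cl (fun=> 1).

Fact umulA : associative umul.
Proof.
move=> x y z; rewrite -[x]repK -[y]repK -[z]repK.
by rewrite /umul !umap2E; congr cl; apply/funext => n; rewrite mulrA.
Qed.

Fact umulC : commutative umul.
Proof.
move=> x y; rewrite -[x]repK -[y]repK.
by rewrite /umul !umap2E; congr cl; apply/funext => n; rewrite mulrC.
Qed.

Fact umul1 : left_id uone umul.
Proof.
move=> x; rewrite -[x]repK.
by rewrite /umul umap2E; congr cl; apply/funext => n; rewrite mul1r.
Qed.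

Fact umulDl : left_distributive umul +%R.
Proof.
move=> x y z; rewrite -[x]repK -[y]repK -[z]repK.
by rewrite /umul clD !umap2E clD; congr cl; apply/funext => n; rewrite mulrDl.
Qed.

Fact uone_neq0 : uone != 0.
Proof.
apply/eqP => /cl_eqP E.
by apply: (@ae_const False); apply: aeS E => n /eqP; rewrite oner_eq0.
Qed.

HB.instance Definition _ := GRing.Zmodule_isComNzRing.Build (ult R)
  umulA umulC umul1 umulDl uone_neq0.

Lemma cl1 : cl (fun=> 1 : R) = 1.
Proof. by []. Qed.

Lemma clM (f g : nat -> R) : cl f * cl g = cl (fun n => f n * g n).
Proof. exact: umap2E. Qed.

Lemma clX (f : nat -> R) m : cl f ^+ m = cl (fun n => f n ^+ m).
Proof.
elim: m => [|m IHm]; first by [].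
by rewrite exprS IHm clM; congr cl; apply/funext => n; rewrite exprS.
Qed.

Lemma cl_prod (I : Type) (s : seq I) (F : I -> nat -> R) :
  \prod_(i <- s) cl (F i) = cl (fun n => \prod_(i <- s) F i n).
Proof.
elim: s => [|i s IHs].
  by rewrite big_nil -cl1; congr cl; apply/funext => n; rewrite big_nil.
by rewrite big_cons IHs clM; congr cl; apply/funext => n; rewrite big_cons.
Qed.

End UltraRing.

Section UltraField.
Variable k : diffFieldType.

Definition uinv : ult k -> ult k := umap GRing.inv.

Fact uinvM : forall x : ult k, x != 0 -> uinv x * x = 1.
Proof.
move=> x; have [f ->] := cl_surj x => f0; rewrite /uinv umapE clM; apply/cl_eqP.
suff : ae (fun n => ~ f n = 0) by apply: aeS => n /eqP fn; rewrite mulVf.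
by apply/aeN => fn; case/eqP: f0; apply/cl_eqP.
Qed.

Fact uinv0 : uinv 0 = 0.
Proof. by rewrite -cl0 /uinv umapE; congr cl; apply/funext => n; rewrite invr0. Qed.

HB.instance Definition _ := GRing.ComNzRing_isField.Build (ult k) uinvM uinv0.

Definition uder : ult k -> ult k := umap der.

Lemma cl_der (f : nat -> k) : uder (cl f) = cl (fun n => der (f n)).
Proof. exact: umapE. Qed.

Fact uderD : {morph uder : x y / x + y}.
Proof.
move=> x y; rewrite -[x]repK -[y]repK clD !cl_der clD.
by congr cl; apply/funext => n; rewrite derD.
Qed.

Fact uderM (x y : ult k) : uder (x * y) = uder x * y + x * uder y.
Proof.
rewrite -[x]repK -[y]repK clM !cl_der !clM clD.
by congr cl; apply/funext => n; rewrite derM.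
Qed.

Fact ult_pchar0 : [pchar (ult k)] =i pred0.
Proof.
move=> p; apply/negP => /andP[pp]; rewrite -cl1 clMn => /eqP /cl_eqP E.
apply: (@ae_const False); apply: aeS E => n /eqP E.
by have := @diff_pchar0 k p; rewrite inE pp /= E.
Qed.

HB.instance Definition _ :=
  Field_isDifferential.Build (ult k) uderD uderM ult_pchar0.

End UltraField.

Section UltraGroup.
Variable G : orderedAbGroupType.

Definition ule (x y : ult G) : bool := `[< urel2 (fun a b => a <= b) x y >].
Definition ult_lt (x y : ult G) : bool := (y != x) && ule x y.

Lemma cl_le (f g : nat -> G) : ule (cl f) (cl g) <-> ae (fun n => f n <= g n).
Proof.
split=> [/asboolP|] le; first by apply/(urel2E (fun a b : G => a <= b)).
by apply/asboolP/(urel2E (fun a b : G => a <= b)).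
Qed.

Fact ule_refl : reflexive ule.
Proof. by move=> x; rewrite -[x]repK; apply/cl_le; apply: aeT. Qed.

Fact ule_anti : antisymmetric ule.
Proof.
move=> x y; rewrite -[x]repK -[y]repK => /andP[/cl_le fg /cl_le gf]; apply/cl_eqP.
by apply: aeS2 fg gf => n fg gf; apply/eqP; rewrite eq_le fg.
Qed.

Fact ule_trans : transitive ule.
Proof.
move=> y x z; rewrite -[y]repK -[x]repK -[z]repK => /cl_le fg /cl_le gh.
by apply/cl_le; apply: aeS2 fg gh => n; apply: le_trans.
Qed.

HB.instance Definition _ := Order.isPOrder.Build ring_display (ult G)
  (fun _ _ => erefl : ult_lt _ _ = _) ule_refl ule_anti ule_trans.

Fact ule_total : total (<=%R : rel (ult G)).
Proof.
move=> x y; rewrite -[x]repK -[y]repK; apply/orP.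
have : ae (fun n => rep x n <= rep y n \/ rep y n <= rep x n).
  by apply: aeT => n; apply/orP; apply: oag_le_total.
by case/ae_or => /cl_le; [left | right].
Qed.

Fact uleD2l (z x y : ult G) : x <= y -> z + x <= z + y.
Proof.
rewrite -[z]repK -[x]repK -[y]repK => /cl_le fg.
by rewrite !clD; apply/cl_le; apply: aeS fg => n; apply: oag_leD2l.
Qed.

HB.instance Definition _ :=
  POrderedZmodule_isOrderedAbGroup.Build (ult G) ule_total uleD2l.

Lemma cl_leP (f g : nat -> G) : cl f <= cl g <-> ae (fun n => f n <= g n).
Proof. exact: cl_le. Qed.

Lemma cl_ltP (f g : nat -> G) : cl f < cl g <-> ae (fun n => f n < g n).
Proof.
have NE a b : (cl a < cl b) = ~~ (cl b <= cl a) by rewrite oag_leNgt negbK.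
rewrite NE; split.
  move=> /negP nle; suff : ae (fun n => ~ g n <= f n).
    by apply: aeS => n; rewrite oag_leNgt => /negP; rewrite negbK.
  by apply/aeN => /cl_leP.
move=> lt; apply/negP => /cl_leP le; apply: (@ae_const False).
by apply: aeS2 lt le => n lt; rewrite oag_leNgt lt.
Qed.

End UltraGroup.

Section UltraAdditive.
Variables (k : diffFieldType) (G : orderedAbGroupType) (c : {additive G -> k}).

Definition umapc : ult G -> ult k := umap c.

Lemma cl_c (f : nat -> G) : umapc (cl f) = cl (fun n => c (f n)).
Proof. exact: umapE. Qed.

Fact umapc_additive : zmod_morphism umapc.
Proof.
move=> x y; rewrite -[x]repK -[y]repK clB !cl_c clB.
by congr cl; apply/funext => n; rewrite raddfB.
Qed.

HB.instance Definition _ :=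
  GRing.isZmodMorphism.Build (ult G) (ult k) umapc umapc_additive.

End UltraAdditive.

(** * Countable sets *)

Lemma choice_dep (I : Type) (T : I -> Type) (P : forall i, T i -> Prop) :
  (forall i, exists x, P i x) -> exists f : forall i, T i, forall i, P i (f i).
Proof.
by move=> PT; exists (fun i => projT1 (cid (PT i))) => i; case: cid.
Qed.

(** The coding function is total but injective only on [A], so that [A] may be a subset of an
    uncountable type. *)
Definition cset (T : Type) (A : set T) :=
  exists f : T -> nat, forall x y, A x -> A y -> f x = f y -> x = y.

Lemma cset_sub (T : Type) (A B : set T) : A `<=` B -> cset B -> cset A.
Proof. by move=> AB [f fI]; exists f => x y /AB Bx /AB By; apply: fI. Qed.

Lemma cset_preim (T U : Type) (h : T -> U) (A : set T) (B : set U) :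
  (forall x, A x -> B (h x)) -> (forall x y, A x -> A y -> h x = h y -> x = y) ->
  cset B -> cset A.
Proof.
move=> AB hI [f fI]; exists (f \o h) => x y Ax Ay.
by move=> /(fI _ _ (AB _ Ax) (AB _ Ay)); apply: hI.
Qed.

Lemma cset_image (T U : Type) (h : T -> U) (A : set T) : cset A -> cset (h @` A).
Proof.
case=> f fI.
have /choice[g gP] : forall y, exists n, (h @` A) y ->
    exists x, [/\ A x, h x = y & f x = n].
  move=> y; have [[x Ax xy]|nAy] := pselect ((h @` A) y); last by exists 0%N.
  by exists (f x) => _; exists x.
exists g => y z /gP[x [Ax <- fx]] /gP[x' [Ax' <- fx']] E.
by congr h; apply: fI => //; rewrite fx fx'.
Qed.

Lemma cset_countType (T : countType) (A : set T) : cset A.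
Proof. by exists pickle => x y _ _; apply: (pcan_inj pickleK). Qed.

Lemma csetX (T U : Type) (A : set T) (B : set U) :
  cset A -> cset B -> cset [set x : T * U | A x.1 /\ B x.2].
Proof.
move=> [f fI] [g gI]; exists (fun x => pickle (f x.1, g x.2)).
move=> [x y] [x' y'] /= [Ax By] [Ax' By'] /(pcan_inj pickleK)[fx gy].
by congr pair; [apply: fI | apply: gI].
Qed.

Lemma cset_sig (I : Type) (T : I -> Type) (A : set I) (B : forall i, set (T i)) :
  cset A -> (forall i, cset (B i)) ->
  cset [set x : {i & T i} | A (projT1 x) /\ B _ (projT2 x)].
Proof.
move=> [f fI] /choice_dep[g gI].
exists (fun x => pickle (f (projT1 x), g _ (projT2 x))).
move=> [i x] [j y] /= [Ai Bx] [Aj By] /(pcan_inj pickleK)[fij].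
have ij := fI _ _ Ai Aj fij; case: j / ij {Aj fij} y By => y By gxy.
by rewrite (gI i x y).
Qed.

Lemma cset_bigcup (T : Type) (A : nat -> set T) :
  (forall i, cset (A i)) -> cset (\bigcup_i A i).
Proof.
move=> cA; have := cset_sig (cset_countType (setT : set nat)) cA.
move=> /(cset_image (fun x : {i : nat & T} => projT2 x)); apply: cset_sub.
by move=> x [i _ Aix]; exists (existT _ i x).
Qed.

Lemma csetU (T : Type) (A B : set T) : cset A -> cset B -> cset (A `|` B).
Proof.
move=> cA cB; apply: (@cset_sub _ _ (\bigcup_i (if i == 0%N then A else B))).
  by move=> x [Ax|Bx]; [exists 0%N | exists 1%N].
by apply: cset_bigcup => i; case: ifP.
Qed.

Lemma cset1 (T : Type) (x : T) : cset [set x].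
Proof. by exists (fun=> 0%N) => y z -> ->. Qed.

Lemma cset_fun (n : nat) (T : 'I_n -> Type) (A : forall i, set (T i)) :
  (forall i, cset (A i)) -> cset [set f : forall i, T i | forall i, A i (f i)].
Proof.
move=> /choice_dep[g gI].
exists (fun f => pickle [ffun i => g i (f i)]) => f f' Af Af'.
move=> /(pcan_inj pickleK) /ffunP E; apply: functional_extensionality_dep => i.
by apply: gI => //; have := E i; rewrite !ffunE.
Qed.

Lemma cset_seq (T : Type) : cset [set: T] -> cset [set: seq T].
Proof.
case=> f fI; exists (fun s => pickle (map f s)) => s s' _ _.
by move=> /(pcan_inj pickleK); apply: inj_map => x y; apply: fI.
Qed.

Lemma cset_enum (T : Type) (A : set T) : cset A ->
  exists g : nat -> option T, (forall n x, g n = Some x -> A x) /\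
    forall x, A x -> exists n, g n = Some x.
Proof.
case=> f fI; have /choice[g gP] : forall n, exists o : option T,
    (forall x, A x -> f x = n -> o = Some x) /\ forall x, o = Some x -> A x.
  move=> n; have [[x Ax <-]|nx] := pselect (exists2 x, A x & f x = n).
    exists (Some x); split=> [y Ay /fI -> //|y [<-] //].
  by exists None; split=> // x Ax fx; case: nx; exists x.
exists g; split=> [n x|x Ax]; first exact: (gP n).2.
by exists (f x); apply: (gP (f x)).1.
Qed.

(** * First-order logic: renaming, counting formulas, Los's theorem *)

Lemma existT_inj (I : Type) (T : I -> Type) (i : I) (x y : T i) :
  existT T i x = existT T i y -> x = y.
Proof.
by move=> E; have := projT2_eq E; rewrite (Prop_irrelevance (projT1_eq E) erefl).
Qed.

(** Case analysis of a variable in a nonempty context. The predicate is abstracted inside the match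
    because the index [s :: G] is not a variable. *)
Definition var_inv (S : Type) (s : S) (G : seq S)
    (P : forall s', var (s :: G) s' -> Type) (P0 : P s (VZ s G))
    (PS : forall s' (v : var G s'), P s' (VS s v)) s' (v : var (s :: G) s') : P s' v :=
  match v in var G0 s0 return
    match G0 return var G0 s0 -> Type with
    | [::] => fun=> unit
    | s1 :: G1 => fun v => forall P : forall s', var (s1 :: G1) s' -> Type,
       P s1 (VZ s1 G1) -> (forall s' (v : var G1 s'), P s' (VS s1 v)) -> P s0 v
    end v with
  | VZ _ _ => fun _ P0 _ => P0
  | VS _ _ _ v => fun _ _ PS => PS _ v
  end P P0 PS.

Definition var_nil (S T : Type) (s : S) (v : var [::] s) : T :=
  match v in var G s0 return if G is [::] then T else unit with
  | VZ _ _ => tt | VS _ _ _ _ => tt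
  end.

Section Semantics.
Variable L : language.

Lemma env_ext (M : structure L) G (e e' : env M G) :
  (forall s v, e s v = e' s v) -> e = e'.
Proof.
by move=> E; do 2![apply: functional_extensionality_dep => ?]; apply: E.
Qed.

Definition rename (G G' : seq (sort L)) := forall s, var G s -> var G' s.

Fixpoint tren G G' (r : rename G G') s (t : term G s) : term G' s :=
  match t with
  | TVar _ v => TVar (r _ v)
  | TApp f a => TApp (fun i => tren r (a i))
  end.

Definition rlift G G' (s : sort L) (r : rename G G') : rename (s :: G) (s :: G') :=
  var_inv (P := fun s' _ => var (s :: G') s') (VZ s G') (fun s' v => VS s (r s' v)).

Fixpoint fren G (p : formula G) : forall G', rename G G' -> formula G' :=
  match p with
  | FEq _ _ t u => fun _ r => FEq (tren r t) (tren r u)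
  | FRel _ f a => fun _ r => FRel (fun i => tren r (a i))
  | FFalse _ => fun G' _ => FFalse G'
  | FImp _ p q => fun _ r => FImp (fren p r) (fren q r)
  | FAll _ s p => fun _ r => FAll (fren p (@rlift _ _ s r))
  end.

Variable M : structure L.

Definition eren G G' (r : rename G G') (e : env M G') : env M G :=
  fun s v => e s (r s v).

Lemma eval_tren G G' (r : rename G G') (e : env M G') s (t : term G s) :
  eval e (tren r t) = eval (eren r e) t.
Proof.
elim: t => //= f a IH; congr fint.
by apply: functional_extensionality_dep => i; apply: IH.
Qed.

Lemma holds_fren G (p : formula G) G' (r : rename G G') (e : env M G') :
  holds (fren p r) e <-> holds p (eren r e).
Proof.
elim: G / p G' r e => //= [G s t u|G f a|G p IHp q IHq|G s p IHp] G' r e.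
- by rewrite !eval_tren.
- have -> // : (fun i => eval e (tren r (a i))) = (fun i => eval (eren r e) (a i)).
  by apply: functional_extensionality_dep => i; rewrite eval_tren.
- by rewrite IHp IHq.
- have E x : eren (@rlift _ _ s r) (env_cons x e) = env_cons x (eren r e).
    by apply: env_ext; apply: var_inv.
  by split=> H x; have := H x; rewrite IHp E.
Qed.

Definition fex (G : seq (sort L)) s (p : formula (s :: G)) : formula G :=
  FImp (FAll (FImp p (FFalse _))) (FFalse _).

Lemma holds_fex (G : seq (sort L)) s (p : formula (s :: G)) (e : env M G) :
  holds (fex p) e <-> exists x, holds p (env_cons x e).
Proof.
split=> /= [H|[x px] H]; last exact: H px.
by apply: contrapT => nx; apply: H => x px; apply: nx; exists x.
Qed.

Definition fand (G : seq (sort L)) (p q : formula G) : formula G :=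
  FImp (FImp p (FImp q (FFalse _))) (FFalse _).

Lemma holds_fand (G : seq (sort L)) (p q : formula G) (e : env M G) :
  holds (fand p q) e <-> holds p e /\ holds q e.
Proof.
split=> /= [H|[px qx] H]; last exact: H.
by split; apply: contrapT => nx; apply: H.
Qed.

End Semantics.

(** * Countability of the sets of terms and formulas *)

Section CountFormulas.
Variable L : language.
Hypotheses (cS : cset [set: sort L]) (cF : cset [set: fsym L])
  (cR : cset [set: rsym L]).

Lemma cset_var G : cset [set: {s : sort L & var G s}].
Proof.
elim: G => [|s G IHG].
  by exists (fun=> 0%N) => -[s v]; have := var_nil False v.
apply: (@cset_sub _ _ ([set existT _ s (VZ s G)] `|`
    (fun x : {s : sort L & var G s} => existT _ _ (VS s (projT2 x))) @` setT)).
  move=> [s' v] _; move: s' v; apply: var_inv => [|s' v]; first by left.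
  by right; exists (existT _ s' v).
by apply: csetU; [apply: cset1 | apply: cset_image].
Qed.

Fixpoint tdepth G (s : sort L) (t : term G s) : nat :=
  match t with
  | TVar _ _ => 0
  | TApp f a => (\max_(i < farity f) tdepth (a i)).+1
  end.

(** Terms are exhausted by those of bounded depth, and each depth adds countably many because
    function symbols have finitely many arguments. *)
Lemma cset_term G : cset [set: {s : sort L & term G s}].
Proof.
pose A d := [set x : {s : sort L & term G s} | (tdepth (projT2 x) <= d)%N].
apply: (@cset_sub _ _ (\bigcup_d A d)).
  by move=> [s t] _; exists (tdepth t) => //=; rewrite /A /=.
have cV : cset ((fun x : {s : sort L & var G s} =>
    existT (term G) _ (TVar (projT2 x))) @` setT).
  exact: cset_image (cset_var G).
apply: cset_bigcup; elim=> [|d IHd].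
  by apply: cset_sub cV => -[s [s' v|//]] _; exists (existT _ s' v).
pose B f := [set a : forall i, term G (farg (f := f) i) |
  forall i, (tdepth (a i) <= d)%N].
have cB f : cset (B f).
  apply: (@cset_fun _ _ (fun i => [set t | (tdepth t <= d)%N])) => i.
  apply: (@cset_preim _ _ (fun t => existT (term G) _ t)) IHd => [t //|].
  by move=> t t' _ _; apply: existT_inj.
apply: cset_sub (csetU cV (cset_image (fun x : {f : fsym L &
  forall i, term G (farg (f := f) i)} => existT (term G) _ (TApp (projT2 x)))
  (cset_sig cF cB))).
move=> [s [s' v|f a]]; rewrite /A /= => dt; first by left; exists (existT _ s' v).
right; exists (existT _ f a) => //; split=> //= i.
rewrite -ltnS; apply: leq_trans dt; rewrite ltnS.
by apply: (leq_bigmax (F := fun i => tdepth (a i))).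
Qed.

Lemma cset_term_sort G s : cset [set: term (L := L) G s].
Proof.
apply: (@cset_preim _ _ (fun t => existT (term G) _ t)) (cset_term G) => //.
by move=> t t' _ _; apply: existT_inj.
Qed.

Fixpoint fdepth G (p : formula (L := L) G) : nat :=
  match p with
  | FImp _ p q => (maxn (fdepth p) (fdepth q)).+1
  | FAll _ _ p => (fdepth p).+1
  | _ => 0
  end.

(** The induction on the depth treats all contexts at once, as quantifiers enlarge the context. *)
Lemma cset_formula G : cset [set: formula (L := L) G].
Proof.
pose A d G := [set p : formula (L := L) G | (fdepth p <= d)%N].
have cE H : cset ((fun x : {s : sort L & (term H s * term H s)%type} =>
    FEq (projT2 x).1 (projT2 x).2) @` setT).
  apply: cset_image; apply: (@cset_sub _ _ _ _ (cset_sig cS (fun s =>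
    csetX (cset_term_sort H s) (cset_term_sort H s)))) => x _; split=> //.
have cRel H : cset ((fun x : {f : rsym L & forall i, term H (rarg (r := f) i)} =>
    FRel (projT2 x)) @` setT).
  apply: cset_image; apply: (@cset_sub _ _ _ _ (cset_sig cR (fun f =>
    cset_fun (fun i => cset_term_sort H (rarg (r := f) i))))) => x _; split=> //.
have cA d : forall H, cset (A d H).
  elim: d => [|d IHd] H.
    apply: cset_sub (csetU (cE H) (csetU (cRel H) (cset1 (FFalse H)))).
    move=> p; rewrite /A /=; case: p => {H} //= [H s t u|H f a|H] _.
    - by left; exists (existT _ s (t, u)).
    - by right; left; exists (existT _ f a).
    - by right; right.
  have cI := cset_image (fun x => FImp x.1 x.2) (csetX (IHd H) (IHd H)).
  have cAl := cset_image (fun x : {s : sort L & formula (s :: H)} =>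
    FAll (projT2 x)) (cset_sig cS (fun s => IHd (s :: H))).
  apply: cset_sub (csetU (cE H) (csetU (cRel H) (csetU (cset1 (FFalse H))
    (csetU cI cAl)))).
  move=> p; rewrite /A /=; case: p {cI cAl} => {H} /= [H s t u|H f a|H|H p q|H s p] pd.
  - by left; exists (existT _ s (t, u)).
  - by right; left; exists (existT _ f a).
  - by right; right; left.
  - right; right; right; left; exists (p, q) => //=.
    by move: pd; rewrite ltnS geq_max => /andP[].
  - by right; right; right; right; exists (existT _ s p).
apply: cset_sub (cset_bigcup (fun d => cA d G)) => p _.
by exists (fdepth p) => //; rewrite /A /=.
Qed.

End CountFormulas.
(** * Ultrapowers of structures and extension of elementary relations *)

(** Ultrapowers are characterised by their class map [q] rather than built, so that Los's theorem
    applies to structures on carriers that already have their algebraic operations. *)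
Record is_ultrapower (L : language) (M N : structure L)
    (q : forall s, (nat -> M s) -> N s) : Prop := IsUltrapower {
  iu_surj : forall s (x : N s), exists f, x = q s f;
  iu_eq : forall s (f g : nat -> M s), q s f = q s g <-> ae (fun n => f n = g n);
  iu_fint : forall f (a : forall i, nat -> M (farg (f := f) i)),
    fint (fun i => q _ (a i)) = q _ (fun n => fint (fun i => a i n));
  iu_rint : forall r (a : forall i, nat -> M (rarg (r := r) i)),
    rint (fun i => q _ (a i)) <-> ae (fun n => rint (fun i => a i n))
}.

Section Los.
Variables (L : language) (M N : structure L) (q : forall s, (nat -> M s) -> N s).
Hypothesis Nq : is_ultrapower q.

Definition qenv G (e : nat -> env M G) : env N G :=
  fun s v => q (fun n => e n s v).

Lemma qenv_surj G (e : env N G) : exists e0, e = qenv e0.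
Proof.
have /choice_dep[f fP] : forall s : sort L, exists f : N s -> nat -> M s,
    forall x, x = q (f x).
  by move=> s; have [f fP] := choice (iu_surj Nq (s := s)); exists f.
by exists (fun n s v => f s (e s v) n); apply: env_ext => s v; apply: fP.
Qed.

Lemma eval_qenv G (e : nat -> env M G) s (t : term G s) :
  eval (qenv e) t = q (fun n => eval (e n) t).
Proof.
elim: t => //= f a IH; rewrite -(iu_fint Nq); congr fint.
by apply: functional_extensionality_dep => i; apply: IH.
Qed.

Lemma los G (p : formula G) (e : nat -> env M G) :
  holds p (qenv e) <-> ae (fun n => holds p (e n)).
Proof.
elim: G / p e => /= [G s t u|G r a|G|G p IHp p' IHp'|G s p IHp] e.
- by rewrite !eval_qenv; apply: iu_eq Nq _ _ _.
- have -> : (fun i => eval (qenv e) (a i)) = (fun i => q (fun n => eval (e n) (a i))).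
    by apply: functional_extensionality_dep => i; rewrite eval_qenv.
  exact: iu_rint.
- by split=> // /ae_const.
- by rewrite ae_imp IHp IHp'.
have E f : env_cons (q f) (qenv e) = qenv (fun n => env_cons (f n) (e n)).
  by apply: env_ext; apply: var_inv.
split=> [H|H x]; last first.
  have [f ->] := iu_surj Nq x; rewrite E; apply/IHp.
  by apply: aeS H => n; apply.
apply: contrapT => /aeN nH.
(* Sorts may be empty; then the universal formula holds trivially and no counterexamples can be
   chosen. *)
have [inh|ninh] := pselect (inhabited (M s)); last first.
  apply: (@ae_const False); apply: aeS nH => n nH; apply: nH => x.
  by case: ninh.
have [x0] := inh.
have /choice[f fP] : forall n, exists x, ~ (forall x, holds p (env_cons x (e n))) ->
    ~ holds p (env_cons x (e n)).
  move=> n; have [[x nx]|nx] := pselect (exists x, ~ holds p (env_cons x (e n))).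
    by exists x.
  exists x0 => nall; exfalso; apply: nall => x.
  by apply: contrapT => npx; apply: nx; exists x.
have := H (q f); rewrite E => /IHp Hf.
by apply: (@ae_const False); apply: aeS2 Hf nH => n pf /fP.
Qed.

End Los.

Lemma ultrapower_equiv (L : language) (M N : structure L) q :
  @is_ultrapower L M N q -> elementarily_equivalent M N.
Proof.
move=> Nq p; rewrite /models.
have -> : @env_nil L N = qenv q (fun=> @env_nil L M).
  by apply: env_ext => s v; have := var_nil False v.
by rewrite (los Nq); split=> [Mp|/ae_const //]; apply: aeT.
Qed.

(** * Extension of countable elementary relations into an ultrapower *)

Section ElementaryRelations.
Variable L : language.
Hypotheses (cS : cset [set: sort L]) (cF : cset [set: fsym L])
  (cR : cset [set: rsym L]).
Variables M N : structure L.

Definition env_rel (R : forall s, M s -> N s -> Prop) G (e : env M G) (e' : env N G) :=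
  forall s v, R s (e s v) (e' s v).

(** Equations are among the formulas, so such a relation is in each sort a partial bijection. As a
    relation it can be reversed and enlarged without tracking domains. *)
Definition elem_rel (R : forall s, M s -> N s -> Prop) :=
  forall G (p : formula G) e e', env_rel R e e' -> holds p e <-> holds p e'.

Definition cset_rel (R : forall s, M s -> N s -> Prop) :=
  cset [set x : {s : sort L & (M s * N s)%type} | R _ (projT2 x).1 (projT2 x).2].

(** An inductive family avoids transporting the new pair along equalities of sorts. *)
Inductive add1 (R : forall s, M s -> N s -> Prop) (s : sort L) (a : M s) (b : N s) :
    forall s', M s' -> N s' -> Prop :=
  | Add1Old s' x y : R s' x y -> add1 R a b x y
  | Add1New : add1 R a b a b.

Lemma cset_add1 R s (a : M s) (b : N s) : cset_rel R -> cset_rel (add1 R a b).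
Proof.
move=> cRR; apply: cset_sub (csetU cRR (cset1 (existT _ s (a, b)))).
by move=> [s' [x y]] /= []; [left | right].
Qed.

Lemma cset_env R G : cset_rel R ->
  cset [set x : env M G * env N G | env_rel R x.1 x.2].
Proof.
move=> cRR; elim: G => [|s G IHG].
  exists (fun=> 0%N) => -[e1 e1'] [e2 e2'] _ _ _.
  by congr pair; apply: env_ext => s v; have := var_nil False v.
apply: (cset_preim (h := fun x => ((existT (fun s => (M s * N s)%type) s
    (x.1 s (VZ s G), x.2 s (VZ s G))),
    (fun s' v => x.1 s' (VS s v), fun s' v => x.2 s' (VS s v))))
    _ _ (csetX cRR IHG)).
- by move=> [e e'] /= r; split=> [|s' v]; apply: r.
move=> [e1 e1'] [e2 e2'] _ _ /= H.
have H0 := existT_inj (congr1 fst H).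
have /= E := congr1 fst H0; have /= E' := congr1 snd H0.
have /= F := congr1 (fst \o snd) H; have /= F' := congr1 (snd \o snd) H.
congr pair; apply: env_ext; apply: var_inv => //= s' v.
- by have := congr1 (fun h => h s' v) F.
- by have := congr1 (fun h => h s' v) F'.
Qed.

Definition catl (G G' : seq (sort L)) : rename G (G ++ G').
Proof.
elim: G => [s v|s G IHG]; first exact: var_nil v.
exact: (var_inv (P := fun s' _ => var ((s :: G) ++ G') s')
  (VZ s (G ++ G')) (fun s' v => VS s (IHG s' v))).
Defined.

Fixpoint catr (G G' : seq (sort L)) : rename G' (G ++ G') :=
  match G with [::] => fun _ v => v | s :: G0 => fun _ v => VS s (catr G0 v) end.

Fixpoint ecat (K : structure L) (G G' : seq (sort L)) :
    env K G -> env K G' -> env K (G ++ G') :=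
  match G return env K G -> env K G' -> env K (G ++ G') with
  | [::] => fun _ e' => e'
  | s :: G0 => fun e e' =>
      env_cons (e s (VZ s G0)) (ecat (fun s' v => e s' (VS s v)) e')
  end.

Lemma ecatl (K : structure L) G G' (e : env K G) (e' : env K G') :
  eren (@catl G G') (ecat e e') = e.
Proof.
elim: G e => [|s G IHG] e; first by apply: env_ext => s v; have := var_nil False v.
apply: env_ext; apply: var_inv => //= s' v.
by have := congr1 (fun h => h s' v) (IHG (fun s' v => e s' (VS s v))).
Qed.

Lemma ecatr (K : structure L) G G' (e : env K G) (e' : env K G') :
  eren (@catr G G') (ecat e e') = e'.
Proof. by elim: G e => [|s G IHG] e //; apply: IHG. Qed.

Lemma env_rel_cons R s (x : M s) (y : N s) G (e : env M G) (e' : env N G) :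
  R s x y -> env_rel R e e' -> env_rel R (env_cons x e) (env_cons y e').
Proof. by move=> Rxy ee'; rewrite /env_rel; apply: var_inv. Qed.

Lemma env_rel_cat R G G' (e1 : env M G) (e2 : env N G) (e1' : env M G')
    (e2' : env N G') :
  env_rel R e1 e2 -> env_rel R e1' e2' -> env_rel R (ecat e1 e1') (ecat e2 e2').
Proof.
elim: G e1 e2 => [|s G IHG] e1 e2 //= R1 R1'.
by apply: env_rel_cons => //; apply: IHG => // s' v; apply: R1.
Qed.

(** The new pair may occur at several variables. Renaming merges these into one, so that a formula
    over the enlarged relation becomes a formula in one variable with parameters from [R]. *)
Lemma env_rel_add1 R s (a : M s) (b : N s) G (e : env M G) (e' : env N G) :
  env_rel (add1 R a b) e e' ->
  exists G' (e0 : env M G') (e0' : env N G') (r : rename G (s :: G')),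
  [/\ env_rel R e0 e0', e = eren r (env_cons a e0) & e' = eren r (env_cons b e0')].
Proof.
elim: G e e' => [|s1 G IHG] e e' ee'.
  exists [::], e, e', (fun s v => var_nil _ v).
  split; [by move=> s' v; have := var_nil False v | |];
    by apply: env_ext => s' v; have := var_nil False v.
have [|G' [e0 [e0' [r [R0 E E']]]]] :=
  IHG (fun s' v => e s' (VS s1 v)) (fun s' v => e' s' (VS s1 v)).
  by move=> s' v; apply: ee'.
have Ev s' v : e s' (VS s1 v) = env_cons a e0 (r s' v).
  exact: (congr1 (fun h => h s' v) E).
have Ev' s' v : e' s' (VS s1 v) = env_cons b e0' (r s' v).
  exact: (congr1 (fun h => h s' v) E').
move: (ee' s1 (VZ s1 G)).
move Ex : (e s1 (VZ s1 G)) => x; move Ey : (e' s1 (VZ s1 G)) => y {ee' E E'} xy.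
case: s1 x y / xy e e' Ev Ev' Ex Ey => [s1 x y Rxy|] e e' Ev Ev' Ex Ey.
- pose skip : rename (s :: G') (s :: s1 :: G') :=
    var_inv (P := fun s' _ => var (s :: s1 :: G') s') (VZ s (s1 :: G'))
      (fun s' v => VS s (VS s1 v)).
  have sE (K : structure L) z w (f : env K G') s' (v : var (s :: G') s') :
      env_cons z (env_cons w f) (skip s' v) = env_cons z f v.
    by move: s' v; apply: var_inv.
  exists (s1 :: G'), (env_cons x e0), (env_cons y e0').
  exists (var_inv (P := fun s' _ => var (s :: s1 :: G') s') (VS s (VZ s1 G'))
      (fun s' v => skip s' (r s' v))).
  split; first exact: env_rel_cons.
  + apply: env_ext; apply: var_inv => [|s' v]; first by rewrite Ex.
    by rewrite Ev /eren /= sE.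
  + apply: env_ext; apply: var_inv => [|s' v]; first by rewrite Ey.
    by rewrite Ev' /eren /= sE.
- exists G', e0, e0', (var_inv (P := fun s' _ => var (s :: G') s') (VZ s G') r).
  split=> //; apply: env_ext; apply: var_inv => [|s' v] //.
Qed.

Variables (M0 : structure L) (q : forall s, (nat -> M0 s) -> N s).
Hypothesis Nq : is_ultrapower q.

(** The element [b] realises the type of [a] over [R]. There are countably many formulas with
    parameters, and any finite conjunction of them is satisfiable in [N], because its existential
    closure holds in [M]. *)
Lemma elem_extend1 R : elem_rel R -> cset_rel R -> forall s (a : M s),
  exists b : N s, elem_rel (add1 R a b).
Proof.
move=> eR cRR s a.
suff [b bP] : exists b : N s, forall G (p : formula (s :: G)) e e',
    env_rel R e e' -> holds p (env_cons a e) -> holds p (env_cons b e').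
  exists b => G p e e' /env_rel_add1[G' [e0 [e0' [r [R0 -> ->]]]]].
  rewrite -!holds_fren; split; first exact: bP.
  (* The converse implication is the preservation of the negated formula. *)
  move=> hb; apply: contrapT => na.
  exact: (bP _ (FImp (fren p r) (FFalse _)) _ _ R0).
pose T := {G : seq (sort L) & (formula (s :: G) * (env M G * env N G))%type}.
pose A := [set x : T | env_rel R (projT2 x).2.1 (projT2 x).2.2 /\
  holds (projT2 x).1 (env_cons a (projT2 x).2.1)].
have [|g [gA Ag]] := @cset_enum _ A.
  have := cset_sig (cset_seq cS) (fun G =>
    csetX (cset_formula cS cF cR (s :: G)) (cset_env G cRR)).
  by apply: cset_sub => x [].
have /choice_dep[sel selP] : forall t : T, exists e : nat -> env M0 _,
    (projT2 t).2.2 = qenv q e.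
  by move=> t; apply: (qenv_surj Nq).
pose C j n (y : M0 s) := if g j is Some t then
  holds (projT2 t).1 (env_cons y (sel t n)) else True.
have consE (f : nat -> M0 s) t :
    env_cons (q f) (projT2 t).2.2 = qenv q (fun n => env_cons (f n) (sel t n)).
  by rewrite selP; apply: env_ext; apply: var_inv.
have Cae f j : (if g j is Some t then
    holds (projT2 t).1 (env_cons (q f) (projT2 t).2.2) else True) <->
    ae (fun n => C j n (f n)).
  rewrite /C; case: (g j) => [t|]; last by split=> // _; apply: aeT.
  by rewrite consE (los Nq).
have [J|f fP] := @ult_saturated _ C; last first.
  exists (q f) => G p e e' ee' pa.
  have [j gj] := Ag (existT _ G (p, (e, e'))) (conj ee' pa).
  by have := (Cae f j).2 (fP j); rewrite gj.
suff [b bP] : exists b : N s, forall j, (j < J)%N -> if g j is Some t then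
    holds (projT2 t).1 (env_cons b (projT2 t).2.2) else True.
  have [f fE] := iu_surj Nq b; exists f => j /bP.
  by rewrite fE => /Cae.
suff [G [p [e [e' [ee' pa pP]]]]] : exists G (p : formula (s :: G)) e e',
    [/\ env_rel R e e', holds p (env_cons a e) & forall b, holds p (env_cons b e') ->
    forall j, (j < J)%N -> if g j is Some t then
    holds (projT2 t).1 (env_cons b (projT2 t).2.2) else True].
  have : holds (fex p) e' by rewrite -(eR _ _ _ _ ee') holds_fex; exists a.
  by rewrite holds_fex => -[b /pP]; exists b.
elim: J => [|J [G [p [e [e' [ee' pa pP]]]]]].
  exists [::], (FImp (FFalse _) (FFalse _)).
  exists (fun s' v => var_nil _ v), (fun s' v => var_nil _ v).
  by split=> // s' v; have := var_nil False v.
case gJ : (g J) => [[G' [p' [e0 e0']]]|]; last first.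
  exists G, p, e, e'; split=> // b pb j; rewrite ltnS leq_eqVlt.
  by case/predU1P => [->|/(pP b pb) //]; rewrite gJ.
have [/= ee0 pa0] := gA _ _ gJ.
(* Each condition has its own parameters, so the conjunction lives over the concatenated contexts,
   with the distinguished variable shared. *)
exists (G ++ G'), (fand (fren p (rlift (@catl G G'))) (fren p' (rlift (@catr G G')))).
have liftE (K : structure L) G1 G2 (r : rename G1 G2) (f : env K G2) x :
    eren (@rlift _ _ _ s r) (env_cons x f) = env_cons x (eren r f).
  by apply: env_ext; apply: var_inv.
exists (ecat e e0), (ecat e' e0'); split; first exact: env_rel_cat.
  by rewrite holds_fand !holds_fren !liftE ecatl ecatr.
move=> b; rewrite holds_fand !holds_fren !liftE ecatl ecatr => -[pb pb0] j.
by rewrite ltnS leq_eqVlt => /predU1P[->|/(pP b pb) //]; rewrite gJ.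
Qed.

Lemma elem_extend R (D : set {s : sort L & M s}) :
  elem_rel R -> cset_rel R -> cset D ->
  exists R', [/\ elem_rel R', cset_rel R', (forall s x y, R s x y -> R' s x y) &
    forall s x, D (existT _ s x) -> exists y, R' s x y].
Proof.
move=> eR cRR /cset_enum[g [_ gD]].
pose T := {R : forall s, M s -> N s -> Prop | elem_rel R /\ cset_rel R}.
have /choice[step stepP] : forall t : nat * T, exists t' : T,
    (forall s x y, sval t.2 s x y -> sval t' s x y) /\
    (forall s x, g t.1 = Some (existT _ s x) -> exists y, sval t' s x y).
  move=> [n [Q [eQ cQ]]] /=; case: (g n) => [[s x]|]; last first.
    by exists (exist (fun R => elem_rel R /\ cset_rel R) Q (conj eQ cQ)).
  have [b eb] := elem_extend1 eQ cQ x.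
  exists (exist (fun R => elem_rel R /\ cset_rel R) _ (conj eb (cset_add1 x b cQ))).
  split=> [s' x' y'|s' x'] /=.
    exact: Add1Old.
  move=> gn; suff H z : existT _ s x = z -> exists y, add1 Q x b (projT2 z) y.
    by apply: (H (existT _ s' x')); case: gn.
  by move=> <-; exists b; apply: Add1New.
pose fix st n : T := if n is m.+1 then step (m, st m)
    else exist (fun R => elem_rel R /\ cset_rel R) R (conj eR cRR).
have mono n m s x y : (n <= m)%N -> sval (st n) s x y -> sval (st m) s x y.
  move=> /subnK <-; elim: (m - n)%N => // k IHk /IHk.
  exact: (stepP (_, st _)).1.
exists (fun s x y => exists n, sval (st n) s x y); split.
- move=> G p e e' ee'.
  (* A context is finite, so the entries of an environment are related at a common stage of the
     chain. *)
  suff [n ne] : exists n, env_rel (sval (st n)) e e' by apply: (svalP (st n)).1.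
  elim: G {p} e e' ee' => [|s G IHG] e e' ee'.
    by exists 0%N => s v; have := var_nil False v.
  have [|n nP] := IHG (fun s' v => e s' (VS s v)) (fun s' v => e' s' (VS s v)).
    by move=> s' v; apply: ee'.
  have [m mP] := ee' s (VZ s G).
  exists (maxn n m); rewrite /env_rel; apply: var_inv => [|s' v].
    by apply: mono mP; rewrite leq_maxr.
  by apply: mono (nP s' v); rewrite leq_maxl.
- have := cset_bigcup (fun n => (svalP (st n)).2).
  by apply: cset_sub => x [n nx]; exists n.
- by move=> s x y Rxy; exists 0%N.
- move=> s x /gD[n gn]; have [y yP] := (stepP (n, st n)).2 s x gn.
  by exists y, n.+1.
Qed.

End ElementaryRelations.
(** * The Hahn field as a ring *)

Section OrderedGroup.
Variable G : orderedAbGroupType.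
Implicit Types x y z : G.

Lemma oag_ltNge x y : (x < y) = ~~ (y <= x).
Proof. by rewrite oag_leNgt negbK. Qed.

Lemma oag_leP x y : (x <= y) \/ (y < x).
Proof. by rewrite oag_ltNge; case: (x <= y); [left | right]. Qed.

Lemma oag_ltD2lE z x y : (z + x < z + y) = (x < y).
Proof. by rewrite !oag_ltNge oag_leD2lE. Qed.

Lemma oag_leD2rE z x y : (x + z <= y + z) = (x <= y).
Proof. by rewrite ![_ + z]addrC oag_leD2lE. Qed.

Lemma oag_ltD2rE z x y : (x + z < y + z) = (x < y).
Proof. by rewrite ![_ + z]addrC oag_ltD2lE. Qed.

Lemma oag_ltBlD x y z : (x - y < z) = (x < z + y).
Proof. by rewrite -(oag_ltD2rE y (x - y)) subrK. Qed.

Lemma oag_leBrD x y z : (x <= z - y) = (x + y <= z).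
Proof. by rewrite -(oag_leD2rE y x) subrK. Qed.

Lemma oag_leN2 x y : (- x <= - y) = (y <= x).
Proof. by rewrite -(oag_leD2lE (x + y) (- x)) addrK addrAC subrr add0r. Qed.

Lemma oag_leD x y z t : x <= y -> z <= t -> x + z <= y + t.
Proof. by move=> xy zt; apply: le_trans (_ : y + z <= _); rewrite ?oag_leD2rE ?oag_leD2lE. Qed.

Lemma oag_ltleD x y z t : x < y -> z <= t -> x + z < y + t.
Proof. by move=> xy zt; apply: lt_le_trans (_ : y + z <= _); rewrite ?oag_ltD2rE ?oag_leD2lE. Qed.

Lemma oag_leMn x y n : x <= y -> x *+ n <= y *+ n.
Proof. by move=> xy; elim: n => // n IHn; rewrite !mulrS; apply: oag_leD. Qed.

Lemma oag_min (T : eqType) (s : seq T) (F : T -> G) (a : T) : a \in s ->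
  exists2 b, b \in s & forall d, d \in s -> F b <= F d.
Proof.
elim: s a => // a s IHs _ _.
case: s IHs => [_|b s IHs]; first by exists a => [|d]; rewrite inE // => /eqP ->.
have [|m ms mmin] := IHs b; first exact: mem_head.
have [am|ma] := oag_leP (F a) (F m).
  exists a => [|d]; first exact: mem_head.
  by rewrite inE => /predU1P[-> //|/mmin]; apply: le_trans.
exists m => [|d]; first by rewrite inE ms orbT.
by rewrite inE => /predU1P[->|/mmin //]; apply: ltW.
Qed.

End OrderedGroup.

Section HahnRing.
Variables (k : diffFieldType) (G : orderedAbGroupType).
Implicit Types (f : hahn k G) (F : G -> k).

Lemma hahn_ext f1 f2 : (forall g, f1 g = f2 g) -> f1 = f2.
Proof.
case: f1 f2 => [f1 p1] [f2 p2] /= E; have E' : f1 = f2 by apply/funext.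
by case: f2 / E' p2 {E} => p2; rewrite (Prop_irrelevance p1 p2).
Qed.

Definition hsum F := \sum_(a \in [set: G]) F a.

Lemma hsumE F (X : set G) : finite_set X -> (forall a, F a != 0 -> X a) ->
  hsum F = \sum_(a <- fset_set X) F a.
Proof.
move=> Xfin FX; rewrite /hsum -fsbig_finite //; apply/esym/fsbig_widen => //.
move=> a [_ nXa] /=; apply/eqP; apply: contrapT => /negP Fa.
exact: nXa (FX _ Fa).
Qed.

Lemma hsum0 F : (forall a, F a = 0) -> hsum F = 0.
Proof. by move=> F0; apply: fsbig1. Qed.

Lemma hsum1 F a : (forall b, b != a -> F b = 0) -> hsum F = F a.
Proof.
move=> F0; rewrite (@hsumE _ [set a]) ?fset_set1 ?big_seq_fset1 //.
by move=> b Fb; apply: contrapT => /eqP ba; rewrite F0 ?eqxx in Fb.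
Qed.

Lemma hsum_shift b F : hsum (fun a => F (a + b)) = hsum F.
Proof.
rewrite /hsum [RHS](reindex_fsbigT (fun a => a + b)) //.
by apply: (Bijective (g := fun a => a - b)) => a; rewrite ?addrK ?subrK.
Qed.

Lemma hsum_opp b F : hsum (fun a => F (b - a)) = hsum F.
Proof.
rewrite /hsum [RHS](reindex_fsbigT (fun a => b - a)) //.
by apply: (Bijective (g := fun a => b - a)) => a; rewrite subKr.
Qed.

Definition hprod f1 f2 g a := f1 a * f2 (g - a).

Definition hfib f1 f2 g := [set a | f1 a != 0 /\ f2 (g - a) != 0].

Lemma hfib_finite f1 f2 g : finite_set (hfib f1 f2 g).
Proof. exact: well_ordered_finite_fiber (hahn_wo f1) (hahn_wo f2). Qed.

Lemma hprod_fib f1 f2 g a : hprod f1 f2 g a != 0 -> hfib f1 f2 g a.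
Proof.
rewrite /hprod => nz; split; apply: contraNneq nz => ->; by rewrite ?mul0r ?mulr0.
Qed.

Lemma hahn_mulE f1 f2 g : hahn_mul f1 f2 g = hsum (hprod f1 f2 g).
Proof. by []. Qed.

Lemma hahn_mul_fin f1 f2 g (X : set G) : finite_set X ->
  hfib f1 f2 g `<=` X -> hahn_mul f1 f2 g = \sum_(a <- fset_set X) f1 a * f2 (g - a).
Proof. by move=> Xfin fX; apply: hsumE => // a /hprod_fib /fX. Qed.

HB.instance Definition _ := gen_eqMixin (hahn k G).
HB.instance Definition _ := gen_choiceMixin (hahn k G).

Fact hahn_addA : associative (@hahn_add k G).
Proof. by move=> f1 f2 f3; apply: hahn_ext => g /=; rewrite addrA. Qed.

Fact hahn_addC : commutative (@hahn_add k G).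
Proof. by move=> f1 f2; apply: hahn_ext => g /=; rewrite addrC. Qed.

Fact hahn_add0 : left_id (hahn_zero k G) (@hahn_add k G).
Proof. by move=> f; apply: hahn_ext => g /=; rewrite if_same add0r. Qed.

Fact hahn_addN : left_inverse (hahn_zero k G) (@hahn_opp k G) (@hahn_add k G).
Proof. by move=> f; apply: hahn_ext => g /=; rewrite if_same addNr. Qed.

HB.instance Definition _ := GRing.isZmodule.Build (hahn k G)
  hahn_addA hahn_addC hahn_add0 hahn_addN.

Fact hahn_mulC : commutative (@hahn_mul k G).
Proof.
move=> f1 f2; apply: hahn_ext => g; rewrite !hahn_mulE -(hsum_opp g).
by congr hsum; apply/funext => a; rewrite /hprod subKr mulrC.
Qed.

Fact hahn_mulA : associative (@hahn_mul k G).
Proof.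
move=> f1 f2 f3; apply: hahn_ext => g.
pose f12 := hahn_mul f1 f2; pose f23 := hahn_mul f2 f3.
pose S A B := [set x : G | exists a b, [/\ A a, B b & x = a + b]].
have wS (h1 h2 : hahn k G) := well_orderedD (hahn_wo h1) (hahn_wo h2).
(* The finite sets [XA] and [XB] contain the supports of the outer sums and, after a shift, of the
   inner ones. Both triple products become the same finite double sum. *)
pose XA := [set a | S (hsupp f1) (hsupp f2) a /\ hsupp f3 (g - a)].
pose XB := [set b | hsupp f1 b /\ S (hsupp f2) (hsupp f3) (g - b)].
have XAfin : finite_set XA := well_ordered_finite_fiber g (wS f1 f2) (hahn_wo f3).
have XBfin : finite_set XB := well_ordered_finite_fiber g (hahn_wo f1) (wS f2 f3).
have nzS (h1 h2 : hahn k G) a : hahn_mul h1 h2 a != 0 -> S (hsupp h1) (hsupp h2) a.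
  move=> nz; apply: contrapT => nS; case/eqP: nz; apply: hsum0 => b.
  apply: contrapT => /eqP /hprod_fib [h1b h2b]; apply: nS.
  by exists b, (a - b); split=> //; rewrite addrC subrK.
rewrite -[RHS]/(hahn_mul f12 f3 g) (@hahn_mul_fin f12 f3 g XA) //; last first.
  by move=> a [nz f3a]; split=> //; exact: (nzS f1 f2 a nz).
rewrite (@hahn_mul_fin f1 f23 g XB) //; last first.
  by move=> b [f1b nz]; split=> //; exact: (nzS f2 f3 _ nz).
transitivity (\sum_(b <- fset_set XB) \sum_(a <- fset_set XA)
    f1 b * f2 (a - b) * f3 (g - a)).
  apply: eq_big_seq => b; rewrite in_fset_set // inE => -[f1b _].
  rewrite hahn_mulE -(hsum_shift (- b)) (@hsumE _ XA) // => [|a].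
    rewrite big_distrr /=; apply: eq_bigr => a _.
    by rewrite /hprod mulrA opprB addrA subrK.
  case/hprod_fib; rewrite opprB addrA subrK => f2ab f3a; split=> //.
  by exists b, (a - b); split=> //; rewrite addrC subrK.
rewrite exchange_big /=; apply: eq_big_seq => a; rewrite in_fset_set // inE => -[_ f3a].
rewrite -big_distrl /=; have [->|f3nz] := eqVneq (f3 (g - a)) 0.
  by rewrite !mulr0.
congr (_ * _); apply/esym/hahn_mul_fin => // b [f1b f2b]; split=> //.
by exists (a - b), (g - a); split=> //; rewrite [RHS]addrC addrA subrK.
Qed.

Fact hahn_mul1 : left_id (hahn_one k G) (@hahn_mul k G).
Proof.
move=> f; apply: hahn_ext => g; rewrite hahn_mulE (@hsum1 _ 0) /hprod /=.
  by rewrite eqxx mul1r subr0.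
by move=> b /negPf ->; rewrite mul0r.
Qed.

Fact hahn_mulDl : left_distributive (@hahn_mul k G) (@hahn_add k G).
Proof.
move=> f1 f2 f3; apply: hahn_ext => g.
pose X := hfib f1 f3 g `|` hfib f2 f3 g.
have Xfin : finite_set X by rewrite finite_setU; split; apply: hfib_finite.
have sub : hfib (hahn_add f1 f2) f3 g `<=` X.
  move=> a [/= nz f3a]; have [f1a|] := eqVneq (f1 a) 0; last by left.
  by right; split=> //; rewrite f1a add0r in nz.
rewrite -[RHS]/(hahn_mul f1 f3 g + hahn_mul f2 f3 g).
rewrite (hahn_mul_fin Xfin sub) (hahn_mul_fin Xfin (@subsetUl _ _ _)).
rewrite (hahn_mul_fin Xfin (@subsetUr _ _ _)) -big_split /=.
by apply: eq_bigr => a _; rewrite mulrDl.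
Qed.

Fact hahn_one_neq0 : hahn_one k G != hahn_zero k G.
Proof.
apply/eqP => /(congr1 (fun f : hahn k G => f 0)) /= /eqP.
by rewrite eqxx oner_eq0.
Qed.

HB.instance Definition _ := GRing.Zmodule_isComNzRing.Build (hahn k G)
  hahn_mulA hahn_mulC hahn_mul1 hahn_mulDl hahn_one_neq0.

End HahnRing.

(** * An axiomatic form of Hahn fields, stable under ultrapowers *)

(* The ring is recorded with its coefficient functions and its monomials
   [a t^g]; inverses are never used. *)
Record hcore (k : diffFieldType) (G : orderedAbGroupType)
    (c : {additive G -> k}) := HCore {
  hring :> comNzRingType;
  hD : hring -> hring;
  coef : hring -> G -> k;
  mono : k -> G -> hring;
  hDD : {morph hD : x y / x + y};
  hDM : forall x y, hD (x * y) = hD x * y + x * hD y;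
  coefB : forall u w g, coef (u - w) g = coef u g - coef w g;
  coef_D : forall u g, coef (hD u) g = der (coef u g) + c g * coef u g;
  coefM : forall u w g h,
    (forall x, x < g -> coef u x = 0) -> (forall x, x < h -> coef w x = 0) ->
    (forall x, x < g + h -> coef (u * w) x = 0) /\
    coef (u * w) (g + h) = coef u g * coef w h;
  coef_least : forall u, u != 0 ->
    exists g, coef u g != 0 /\ forall x, x < g -> coef u x = 0;
  coef_mono : forall a g x, coef (mono a g) x = if x == g then a else 0;
  monoM : forall a g b h, mono a g * mono b h = mono (a * b) (g + h);
  mono1 : mono 1 0 = 1
}.

Section HahnCore.
Variables (k : diffFieldType) (G : orderedAbGroupType) (c : {additive G -> k}).
Implicit Types f : hahn k G.

Lemma der_sum (I : Type) (s : seq I) (F : I -> k) :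
  der (\sum_(i <- s) F i) = \sum_(i <- s) der (F i).
Proof. by apply: (big_morph der (@derD k) (@der0 k)). Qed.

Fact hahn_derD : {morph @hahn_der k G c : x y / x + y}.
Proof.
by move=> f1 f2; apply: hahn_ext => g /=; rewrite derD mulrDr addrACA.
Qed.

Fact hahn_derM f1 f2 :
  hahn_der c (f1 * f2) = hahn_der c f1 * f2 + f1 * hahn_der c f2.
Proof.
apply: hahn_ext => g.
have derN0 f x : hahn_der c f x != 0 -> f x != 0.
  by apply: contra_neq => fx; rewrite /= fx der0 mulr0 addr0.
have fibE := hfib_finite f1 f2 g.
rewrite -[LHS]/(der (hahn_mul f1 f2 g) + c g * hahn_mul f1 f2 g).
rewrite -[RHS]/(hahn_mul (hahn_der c f1) f2 g + hahn_mul f1 (hahn_der c f2) g).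
have sub1 : hfib (hahn_der c f1) f2 g `<=` hfib f1 f2 g by move=> a [/derN0].
have sub2 : hfib f1 (hahn_der c f2) g `<=` hfib f1 f2 g.
  by move=> a [f1a /derN0].
rewrite (hahn_mul_fin fibE (@subset_refl _ _)) (hahn_mul_fin fibE sub1).
rewrite (hahn_mul_fin fibE sub2).
rewrite der_sum big_distrr -!big_split /=; apply: eq_bigr => a _.
have -> : c g = c a + c (g - a) by rewrite -raddfD addrC subrK.
rewrite derM !mulrDl !mulrDr addrACA mulrA; congr (_ + _ + (_ + _)).
by rewrite mulrCA.
Qed.

Fact hahn_coefM f1 f2 g h :
  (forall x, x < g -> f1 x = 0) -> (forall x, x < h -> f2 x = 0) ->
  (forall x, x < g + h -> (f1 * f2) x = 0) /\ (f1 * f2) (g + h) = f1 g * f2 h.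
Proof.
move=> f1g f2h; split=> [x xgh|].
  apply: hsum0 => a; rewrite /hprod; have [ga|ag] := oag_leP g a; last first.
    by rewrite f1g ?mul0r.
  rewrite f2h ?mulr0 // oag_ltBlD; apply: lt_le_trans xgh _.
  by rewrite addrC oag_leD2lE.
rewrite -[LHS]/(hsum _) (@hsum1 _ _ _ g) /hprod; first by rewrite [g + h]addrC addrK.
move=> a ag; have [ga|{}ag] := oag_leP g a; last by rewrite f1g ?mul0r.
rewrite f2h ?mulr0 // oag_ltBlD [h + a]addrC oag_ltD2rE.
by rewrite lt_neqAle eq_sym ag.
Qed.

Fact hahn_coef_least f : f != 0 -> exists g, f g != 0 /\ forall x, x < g -> f x = 0.
Proof.
move=> f0; have [x fx] : hsupp f !=set0.
  apply: contrapT => nf; case/eqP: f0; apply: hahn_ext => g /=.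
  rewrite if_same; apply: contrapT => /eqP fg; apply: nf; by exists g.
have [g [fg gmin]] := hahn_wo f (hsupp f) (fun _ => id) (ex_intro _ x fx).
exists g; split=> // y yg; apply: contrapT => /eqP fy.
by have := gmin y fy; rewrite oag_leNgt yg.
Qed.

Fact hahn_monoM (a : k) (g : G) (b : k) (h : G) :
  hahn_monomial a g * hahn_monomial b h = hahn_monomial (a * b) (g + h).
Proof.
apply: hahn_ext => x; rewrite -[LHS]/(hsum _) (@hsum1 _ _ _ g) /hprod /=.
  by rewrite eqxx subr_eq [h + g]addrC; case: eqP => //; rewrite mulr0.
by move=> y /negPf ->; rewrite mul0r.
Qed.

Definition hahn_core : hcore c := @HCore k G c (hahn k G) (hahn_der c)
  (fun f => f) (@hahn_monomial k G) hahn_derD hahn_derM (fun _ _ _ => erefl)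
  (fun _ _ => erefl) hahn_coefM hahn_coef_least (fun _ _ _ => erefl)
  hahn_monoM erefl.

End HahnCore.
(** * Translation of multivariate polynomials *)

(** Such a polynomial is built by ring operations from coefficients in [S] and the variables in [V],
    since the remaining variables have exponent zero. *)
Lemma mpoly_ring_indV (n : nat) (R : comNzRingType) (S : R -> Prop)
    (V : 'I_n -> Prop) (T : {mpoly R[n]} -> Prop) :
  S 0 -> (forall a, S a -> T a%:MP) -> (forall i, V i -> T 'X_i) ->
  (forall p q, T p -> T q -> T (p + q)) -> (forall p q, T p -> T q -> T (p * q)) ->
  T 1 -> forall p, (forall m, S p@_m) ->
  (forall m, p@_m != 0 -> forall i, ~ V i -> m i = 0%N) -> T p.
Proof.
move=> S0 TC TX TD TM T1 p Sp Vp; rewrite (mpolyE p) big_seq.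
apply: (big_ind T) => //; first by rewrite -mpolyC0; apply: TC.
move=> m mp; rewrite -mul_mpolyC; apply: (TM); first exact: TC.
rewrite mpolyXE_id; apply: (big_ind T) => [//|p' q'|i _]; first exact: TM.
rewrite mcoeff_msupp in mp.
have [Vi|/(Vp m mp i)->] := pselect (V i); last by rewrite expr0.
by elim: (m i) => // j IHj; rewrite exprS; apply: TM => //; apply: TX.
Qed.

Lemma mpoly_ring_ind (n : nat) (R : comNzRingType) (S : R -> Prop)
    (T : {mpoly R[n]} -> Prop) :
  S 0 -> (forall a, S a -> T a%:MP) -> (forall i, T 'X_i) ->
  (forall p q, T p -> T q -> T (p + q)) -> (forall p q, T p -> T q -> T (p * q)) ->
  T 1 -> forall p, (forall m, S p@_m) -> T p.
Proof.
move=> S0 TC TX TD TM T1 p Sp.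
by apply: (@mpoly_ring_indV n R S (fun=> True)) => // i _; apply: TX.
Qed.

Lemma mpoly_ring_indT (n : nat) (R : comNzRingType) (T : {mpoly R[n]} -> Prop) :
  (forall a, T a%:MP) -> (forall i, T 'X_i) ->
  (forall p q, T p -> T q -> T (p + q)) -> (forall p q, T p -> T q -> T (p * q)) ->
  forall p, T p.
Proof.
move=> TC TX TD TM p; have T1 : T 1 by rewrite -mpolyC1.
exact: (@mpoly_ring_ind n R (fun=> True) T I (fun a _ => TC a) TX TD TM T1 p (fun=> I)).
Qed.

Section Shift.
Variables (n : nat) (R : comNzRingType).
Implicit Types (h v : 'I_n -> R) (p q : {mpoly R[n]}).

Definition shift h p : {mpoly R[n]} :=
  mmap (@mpolyC n R) (fun i => 'X_i + (h i)%:MP) p.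

Lemma shiftC h a : shift h a%:MP = a%:MP.
Proof. by rewrite /shift mmapC. Qed.

Lemma shiftX h i : shift h 'X_i = 'X_i + (h i)%:MP.
Proof. by rewrite /shift mmapX mmap1U. Qed.

Lemma shiftD h p q : shift h (p + q) = shift h p + shift h q.
Proof. exact: mmapD. Qed.

Lemma shiftB h p q : shift h (p - q) = shift h p - shift h q.
Proof. exact: mmapB. Qed.

Lemma shiftM h p q : shift h (p * q) = shift h p * shift h q.
Proof. exact: rmorphM. Qed.

Lemma meval_shift h v p : (shift h p).@[v] = p.@[fun i => v i + h i].
Proof.
elim/mpoly_ring_indT: p => [a|i|p q|p q]; rewrite ?shiftC ?shiftX ?shiftD ?shiftM.
- by rewrite !mevalC.
- by rewrite mevalD mevalC !mevalXU.
- by rewrite !mevalD => -> ->.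
- by rewrite !mevalM => -> ->.
Qed.

Lemma shift_shift h v p : shift v (shift h p) = shift (fun i => v i + h i) p.
Proof.
elim/mpoly_ring_indT: p => [a|i|p q|p q];
  rewrite ?shiftC ?shiftX ?shiftD ?shiftM ?shiftX ?shiftC //.
- by rewrite mpolyCD addrA.
- by move=> -> ->.
- by move=> -> ->.
Qed.

Lemma mcoeff0_meval p : p@_0 = p.@[fun=> 0].
Proof.
rewrite mevalE; have [m0|m0] := boolP (0%MM \in msupp p); last first.
  rewrite (memN_msupp_eq0 m0) big_seq big1 // => m mp.
  have [i mi] : exists i, m i != 0%N.
    apply/existsP; apply: contraNT m0; rewrite negb_exists => /forallP mi.
    suff -> : 0%MM = m by [].
    by apply/mnmP => i; rewrite mnm0E; apply/esym/eqP; have := mi i; rewrite negbK.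
  by rewrite (bigD1 i) //= expr0n (negPf mi) mul0r mulr0.
rewrite (bigD1_seq 0%MM) ?msupp_uniq //= big1 ?big1 ?mulr1 ?addr0 //.
- move=> m m0'; have [i mi] : exists i, m i != 0%N.
    apply/existsP; apply: contraNT m0'; rewrite negb_exists => /forallP mi.
    apply/eqP/mnmP => i; rewrite mnm0E; apply/eqP.
    by have := mi i; rewrite negbK.
  by rewrite (bigD1 i) //= expr0n (negPf mi) mul0r mulr0.
- by move=> i _; rewrite mnm0E expr0.
Qed.

Lemma mcoeff0_shift h p : (shift h p)@_0 = p.@[h].
Proof.
by rewrite mcoeff0_meval meval_shift; apply: meval_eq => i; rewrite add0r.
Qed.

Lemma mderiv_shift h i p : (shift h p)^`M(i) = shift h p^`M(i).
Proof.
elim/mpoly_ring_indT: p => [a|j|p q IHp IHq|p q IHp IHq];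
  rewrite ?shiftC ?shiftX ?shiftD ?shiftM ?mderivD ?mderivM.
- by rewrite !mderivC /shift mmap0.
- rewrite mderivC addr0 mderivX mnm1E; have [->|ji] := eqVneq j i.
    rewrite scale1r (_ : U_(i) - U_(i) = 0)%MM ?mpolyX0 ?rmorph1 //.
      by rewrite /shift rmorph1.
    by apply/mnmP => j'; rewrite mnmBE mnm0E subnn.
  by rewrite !scale0r /shift mmap0.
- by rewrite IHp IHq shiftD.
- by rewrite IHp IHq shiftD !shiftM.
Qed.

End Shift.

Lemma map_mpoly_shift (n : nat) (R S : comNzRingType) (f : {rmorphism R -> S})
    (h : 'I_n -> R) (p : {mpoly R[n]}) :
  map_mpoly f (shift h p) = shift (f \o h) (map_mpoly f p).
Proof.
have XE i : map_mpoly f 'X_i = 'X_i by rewrite map_mpolyX.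
elim/mpoly_ring_indT: p => [a|i|p q IHp IHq|p q IHp IHq].
- by rewrite shiftC map_mpolyC shiftC.
- by rewrite shiftX rmorphD /= !XE map_mpolyC shiftX.
- by rewrite shiftD !rmorphD /= IHp IHq shiftD.
- by rewrite shiftM !rmorphM /= IHp IHq shiftM.
Qed.

Lemma meval_map_mpoly (n : nat) (R S : comNzRingType) (f : {rmorphism R -> S})
    (h : 'I_n -> R) (p : {mpoly R[n]}) :
  (map_mpoly f p).@[f \o h] = f p.@[h].
Proof.
elim/mpoly_ring_indT: p => [a|i|p q IHp IHq|p q IHp IHq].
- by rewrite map_mpolyC !mevalC.
- by rewrite map_mpolyX !mevalXU.
- by rewrite rmorphD /= !mevalD rmorphD /= IHp IHq.
- by rewrite rmorphM /= !mevalM rmorphM /= IHp IHq.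
Qed.

Lemma mcoeffM_ind (n : nat) (R : comNzRingType) (T : R -> Prop)
    (p q : {mpoly R[n]}) (m : 'X_{1..n}) :
  T 0 -> (forall a b, T a -> T b -> T (a + b)) ->
  (forall m1 m2, (m1 + m2)%MM = m -> T (p@_m1 * q@_m2)) -> T (p * q)@_m.
Proof.
move=> T0 TD TM; rewrite mcoeffM; apply: (big_ind T) => //.
by move=> [m1 m2] /= /eqP E; apply: TM.
Qed.

(** * Polynomials over a subring, with restricted monomials *)

Section PolynomialsOver.
Variables (R : comNzRingType) (T : R -> Prop).

Definition subring := [/\ T 1, forall x y, T x -> T y -> T (x - y) &
  forall x y, T x -> T y -> T (x * y)].

Hypothesis cT : subring.

Lemma subring0 : T 0.
Proof. by case: cT => T1 TB _; rewrite -(subrr 1); apply: TB. Qed.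

Lemma subringD x y : T x -> T y -> T (x + y).
Proof.
case: cT => _ TB _ Tx Ty; rewrite -(opprK y); apply: (TB) => //.
by rewrite -sub0r; apply: (TB) => //; apply: subring0.
Qed.

Lemma subringMn x n : T x -> T (x *+ n).
Proof.
move=> Tx; elim: n => [|n IHn]; first by rewrite mulr0n; apply: subring0.
by rewrite mulrS; apply: subringD.
Qed.

Variable n : nat.
Implicit Types (p q : {mpoly R[n]}) (m : 'X_{1..n}).

Definition over p := forall m, T p@_m.

Lemma overC a : T a -> over a%:MP.
Proof.
move=> Ta m; rewrite mcoeffC; case: eqP => _; rewrite ?mulr1 ?mulr0 //.
exact: subring0.
Qed.

Lemma over0 : over 0. Proof. by move=> m; rewrite mcoeff0; apply: subring0. Qed.

Lemma over1 : over 1. Proof. by rewrite -mpolyC1; apply: overC; case: cT. Qed.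

Lemma overXm m : over 'X_[m].
Proof.
move=> m'; rewrite mcoeffX; case: eqP => _; first by case: cT.
exact: subring0.
Qed.

Lemma overD p q : over p -> over q -> over (p + q).
Proof. by move=> op oq m; rewrite mcoeffD; apply: subringD. Qed.

Lemma overB p q : over p -> over q -> over (p - q).
Proof. by case: cT => _ TB _ op oq m; rewrite mcoeffB; apply: TB. Qed.

Lemma overM p q : over p -> over q -> over (p * q).
Proof.
case: cT => _ _ TM op oq m; apply: (@mcoeffM_ind _ _ T); first exact: subring0.
  exact: subringD.
by move=> m1 m2 _; apply: TM.
Qed.

Lemma over_mderiv i p : over p -> over p^`M(i).
Proof. by move=> op m; rewrite mcoeff_deriv; apply: subringMn. Qed.

Lemma over_shift h p : (forall i, T (h i)) -> over p -> over (shift h p).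
Proof.
move=> Th; apply: (@mpoly_ring_ind n R T (fun p => over (shift h p))).
- exact: subring0.
- by move=> a Ta; rewrite shiftC; apply: overC.
- by move=> i; rewrite shiftX; apply: overD; [apply: overXm | apply: overC].
- by move=> p1 p2; rewrite shiftD; apply: overD.
- by move=> p1 p2; rewrite shiftM; apply: overM.
- by rewrite -mpolyC1 shiftC; apply: overC; case: cT.
Qed.

End PolynomialsOver.

Section MonomialsIn.
Variables (R : comNzRingType) (n : nat).
Implicit Types (p q : {mpoly R[n]}) (m : 'X_{1..n}) (Q : 'X_{1..n} -> Prop).

Definition mon_in Q p := forall m, p@_m != 0 -> Q m.

Lemma mon_inS Q Q' p : (forall m, Q m -> Q' m) -> mon_in Q p -> mon_in Q' p.
Proof. by move=> QQ' Qp m /Qp; apply: QQ'. Qed.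

Lemma mon_inC Q a : Q 0%MM -> mon_in Q a%:MP.
Proof.
move=> Q0 m; rewrite mcoeffC; have [->|_] := eqVneq m 0%MM; first by [].
by rewrite mulr0 eqxx.
Qed.

Lemma mon_inX Q m : Q m -> mon_in Q 'X_[m].
Proof.
move=> Qm m'; rewrite mcoeffX; have [<-|_] := eqVneq m m'; first by [].
by rewrite eqxx.
Qed.

Lemma mon_inD Q p q : mon_in Q p -> mon_in Q q -> mon_in Q (p + q).
Proof.
move=> Qp Qq m; rewrite mcoeffD; have [->|/Qp //] := eqVneq p@_m 0.
by rewrite add0r; apply: Qq.
Qed.

Lemma mon_inB Q p q : mon_in Q p -> mon_in Q q -> mon_in Q (p - q).
Proof.
move=> Qp Qq m; rewrite mcoeffB; have [->|/Qp //] := eqVneq p@_m 0.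
by rewrite sub0r oppr_eq0; apply: Qq.
Qed.

Lemma mon_inM Q1 Q2 Q p q : (forall m1 m2, Q1 m1 -> Q2 m2 -> Q (m1 + m2)%MM) ->
  mon_in Q1 p -> mon_in Q2 q -> mon_in Q (p * q).
Proof.
move=> QQ Qp Qq m; apply: (@mcoeffM_ind _ _ (fun a => a != 0 -> Q m)).
- by rewrite eqxx.
- by move=> a b; have [->|a0 /(_ isT)//] := eqVneq a 0; rewrite add0r.
- move=> m1 m2 <-; have [->|/Qp Q1m] := eqVneq p@_m1 0; first by rewrite mul0r eqxx.
  have [->|/Qq Q2m] := eqVneq q@_m2 0; first by rewrite mulr0 eqxx.
  by move=> _; apply: QQ.
Qed.

Lemma mon_in_mderiv Q Q' i p : (forall m, Q (m + U_(i))%MM -> Q' m) ->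
  mon_in Q p -> mon_in Q' p^`M(i).
Proof.
move=> QQ Qp m; rewrite mcoeff_deriv; have [->|/Qp/QQ //] := eqVneq p@_(m + U_(i)) 0.
by rewrite mul0rn eqxx.
Qed.

(** Collects the terms of degree [e] in ['X_o]. The stability of [Q] keeps the coefficient [q],
    whose monomials lose their exponent at [o], inside [Q]. The splitting of a polynomial with its
    initial as [q] is the case used in pseudo-division. *)
Lemma mon_split (T : R -> Prop) (Q : 'X_{1..n} -> Prop) (o : 'I_n) (e : nat) p :
  subring T -> (forall m, Q m -> Q [multinom if i == o then 0 else m i | i < n]%N) ->
  over T p -> mon_in (fun m => Q m /\ (m o < e.+1)%N) p ->
  exists q r, [/\ over T q, over T r, mon_in (fun m => Q m /\ m o = 0%N) q,
    mon_in (fun m => Q m /\ (m o < e)%N) r & p = q * 'X_o ^+ e + r].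
Proof.
move=> cT Qo op Qp; rewrite (mpolyE p) big_seq.
apply: (big_ind (fun p => exists q r, [/\ over T q, over T r,
  mon_in (fun m => Q m /\ m o = 0%N) q, mon_in (fun m => Q m /\ (m o < e)%N) r &
  p = q * 'X_o ^+ e + r])).
- exists 0, 0; split; rewrite ?mul0r ?add0r //; try exact: over0;
    by move=> m; rewrite mcoeff0 eqxx.
- move=> p1 p2 [q1 [r1 [oq1 or1 Qq1 Qr1 ->]]] [q2 [r2 [oq2 or2 Qq2 Qr2 ->]]].
  exists (q1 + q2), (r1 + r2); split.
  + exact: overD.
  + exact: overD.
  + exact: mon_inD.
  + exact: mon_inD.
  + by rewrite mulrDl addrACA.
move=> m; rewrite mcoeff_msupp => pm; have [Qm mo] := Qp m pm.
have oC : over T (p@_m)%:MP_[n] by apply: overC.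
rewrite -mul_mpolyC; move: mo; rewrite ltnS leq_eqVlt => /predU1P[mo|mo].
  pose m' := [multinom (if i == o then 0 else m i)%N | i < n].
  have mE : m = (m' + U_(o) *+ e)%MM.
    apply/mnmP => i; rewrite mnmDE mulmnE mnm1E mnmE eq_sym.
    by case: eqP => [<-|_]; rewrite ?mul1n // mul0n addn0.
  exists ((p@_m)%:MP * 'X_[m']), 0; split.
  + by apply: overM => //; apply: overXm.
  + exact: over0.
  + apply: (@mon_inM (fun m => m = 0%MM) (fun m => m = m')); last 2 first.
    * exact: mon_inC.
    * exact: mon_inX.
    by move=> m1 m2 -> ->; rewrite add0m /m' mnmE eqxx; split=> //; apply: Qo.
  + by move=> m1; rewrite mcoeff0 eqxx.
  + by rewrite addr0 -mulrA mpolyXn -mpolyXD -mE.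
exists 0, ((p@_m)%:MP * 'X_[m]); split.
- exact: over0.
- by apply: overM => //; apply: overXm.
- by move=> m1; rewrite mcoeff0 eqxx.
- apply: (@mon_inM (fun m => m = 0%MM) (fun m' => m' = m)); last 2 first.
  + exact: mon_inC.
  + exact: mon_inX.
  by move=> m1 m2 -> ->; rewrite add0m.
- by rewrite mul0r add0r.
Qed.

End MonomialsIn.

(** * Valuation theory of Hahn cores *)

Section Core.
Variables (k : diffFieldType) (G : orderedAbGroupType) (c : {additive G -> k}).
Variable K : hcore c.
Implicit Types (u w : K) (a b : k) (x g : G).

(** Bounds on the valuation are stated as vanishing of coefficients. Zero satisfies all of them, and
    no value at infinity is needed. *)
Definition vge u g := forall x, x < g -> coef u x = 0.
Definition vgt u g := forall x, x <= g -> coef u x = 0.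
Definition lead u a g := [/\ vge u g, coef u g = a & a != 0].

Lemma coef0 g : coef (0 : K) g = 0.
Proof. by rewrite -(subrr (0 : K)) coefB subrr. Qed.

Lemma coefN u g : coef (- u) g = - coef u g.
Proof. by rewrite -sub0r coefB coef0 sub0r. Qed.

Lemma coef_add u w g : coef (u + w) g = coef u g + coef w g.
Proof. by rewrite -{1}(opprK w) coefB coefN opprK. Qed.

Lemma coef_ext u w : (forall g, coef u g = coef w g) -> u = w.
Proof.
move=> E; apply/eqP; rewrite -subr_eq0; apply: contrapT => /negP.
by move=> /coef_least[g []]; rewrite coefB E subrr eqxx.
Qed.

Lemma coef_sum (I : Type) (s : seq I) (P : pred I) (F : I -> K) g :
  coef (\sum_(i <- s | P i) F i) g = \sum_(i <- s | P i) coef (F i) g.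
Proof.
by apply: (big_morph (fun u : K => coef u g)) => [u w|]; rewrite ?coef_add ?coef0.
Qed.

Lemma mono0 g : mono K 0 g = 0.
Proof. by apply: coef_ext => x; rewrite coef_mono coef0 if_same. Qed.

Lemma monoB a b g : mono K (a - b) g = mono K a g - mono K b g.
Proof.
apply: coef_ext => x; rewrite coefB !coef_mono.
by case: eqP => // _; rewrite subrr.
Qed.

Lemma monoD a b g : mono K (a + b) g = mono K a g + mono K b g.
Proof.
apply: coef_ext => x; rewrite coef_add !coef_mono.
by case: eqP => // _; rewrite addr0.
Qed.

Lemma hD_mono a g : hD (mono K a g) = mono K (der a + c g * a) g.
Proof.
apply: coef_ext => x; rewrite coef_D !coef_mono; case: eqP => [->//|_].
by rewrite der0 mulr0 addr0.
Qed.

Lemma hD0 : hD (0 : K) = 0.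
Proof. by apply: (addrI (hD (0 : K))); rewrite -hDD !addr0. Qed.

Lemma vgeW u g : vgt u g -> vge u g.
Proof. by move=> ug x /ltW; apply: ug. Qed.

Lemma vgtE u g : vgt u g <-> vge u g /\ coef u g = 0.
Proof.
split=> [ug|[ug u0] x]; first by split; [apply: vgeW | apply: ug].
by rewrite le_eqVlt => /predU1P[->//|/ug].
Qed.

Lemma vge_le u g h : h <= g -> vge u g -> vge u h.
Proof. by move=> hg ug x xh; apply: ug; apply: lt_le_trans xh hg. Qed.

Lemma vgt_le u g h : h <= g -> vgt u g -> vgt u h.
Proof. by move=> hg ug x xh; apply: ug; apply: le_trans xh hg. Qed.

Lemma vge_lt u g h : h < g -> vge u g -> vgt u h.
Proof. by move=> hg ug x xh; apply: ug; apply: le_lt_trans xh hg. Qed.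

Lemma vge0 g : vge 0 g. Proof. by move=> x _; rewrite coef0. Qed.
Lemma vgt0 g : vgt 0 g. Proof. by move=> x _; rewrite coef0. Qed.

Lemma vgeD u w g : vge u g -> vge w g -> vge (u + w) g.
Proof. by move=> ug wg x xg; rewrite coef_add ug ?wg ?addr0. Qed.

Lemma vgtD u w g : vgt u g -> vgt w g -> vgt (u + w) g.
Proof. by move=> ug wg x xg; rewrite coef_add ug ?wg ?addr0. Qed.

Lemma vgeN u g : vge u g -> vge (- u) g.
Proof. by move=> ug x xg; rewrite coefN ug ?oppr0. Qed.

Lemma vgeB u w g : vge u g -> vge w g -> vge (u - w) g.
Proof. by move=> ug wg; apply: vgeD => //; apply: vgeN. Qed.

Lemma vge_sum (I : Type) (s : seq I) (P : pred I) (F : I -> K) g :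
  (forall i, P i -> vge (F i) g) -> vge (\sum_(i <- s | P i) F i) g.
Proof. by move=> FP; apply: (big_ind (vge^~ g)); [apply: vge0 | move=> u w; apply: vgeD |]. Qed.

(** The derivative has at each exponent a coefficient that depends only on the coefficient there.
    All entries of a jet therefore obey the same bound. *)
Lemma vge_D u g : vge u g -> vge (hD u) g.
Proof. by move=> ug x xg; rewrite coef_D ug // der0 mulr0 addr0. Qed.

Lemma vge_iterD u g i : vge u g -> vge (iter i (@hD _ _ _ K) u) g.
Proof. by move=> ug; elim: i => //= i; apply: vge_D. Qed.

Lemma vge_mono a g : vge (mono K a g) g.
Proof. by move=> x; rewrite coef_mono lt_neqAle => /andP[/negPf ->]. Qed.

Lemma vge1 : vge (1 : K) 0.
Proof. by rewrite -mono1; apply: vge_mono. Qed.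

Lemma lead_ex u : u != 0 -> exists a g, lead u a g.
Proof. by move=> /coef_least[g [ug mg]]; exists (coef u g), g. Qed.

Lemma lead_vge u a g x : lead u a g -> vge u x <-> x <= g.
Proof.
case=> ug ua a0; split=> [ux|xg]; last exact: vge_le ug.
by rewrite oag_leNgt; apply/negP => /ux; rewrite ua => /eqP; rewrite (negPf a0).
Qed.

Lemma lead_vgt u a g x : lead u a g -> vgt u x <-> x < g.
Proof.
case=> ug ua a0; split=> [ux|xg]; last exact: vge_lt ug.
by rewrite oag_ltNge; apply/negP => /ux; rewrite ua => /eqP; rewrite (negPf a0).
Qed.

Lemma lead_neq0 u a g : lead u a g -> u != 0.
Proof. by case=> _ <-; apply: contra_neq => ->; rewrite coef0. Qed.

Lemma lead_inj u a g b h : lead u a g -> lead u b h -> a = b /\ g = h.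
Proof.
move=> ug uh; have gh : g = h.
  apply: le_anti; apply/andP; split.
    by apply/(lead_vge _ uh); case: ug.
  by apply/(lead_vge _ ug); case: uh.
by split=> //; case: ug uh => _ <- _ [_ <- _]; rewrite gh.
Qed.

Lemma lead_mono a g : a != 0 -> lead (mono K a g) a g.
Proof. by move=> a0; split; [apply: vge_mono | rewrite coef_mono eqxx |]. Qed.

Lemma leadM u a g w b h : lead u a g -> lead w b h -> lead (u * w) (a * b) (g + h).
Proof.
move=> [ug ua a0] [wh wb b0]; have [uw E] := coefM ug wh.
by split=> //; [rewrite E ua wb | rewrite mulf_neq0].
Qed.

Lemma leadD u a g w : lead u a g -> vgt w g -> lead (u + w) a g.
Proof.
move=> [ug ua a0] wg; split=> //; last by rewrite coef_add (wg g) ?addr0.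
by apply: vgeD => //; apply: vgeW.
Qed.

Lemma leadX u a g n : lead u a g -> lead (u ^+ n) (a ^+ n) (g *+ n).
Proof.
move=> ug; elim: n => [|n IHn].
  by rewrite !expr0 mulr0n -mono1; apply: lead_mono; rewrite oner_neq0.
by rewrite !exprS mulrS; apply: leadM.
Qed.

Lemma core_mulf_eq0 u w : u * w = 0 -> u = 0 \/ w = 0.
Proof.
move=> uw; have [->|/lead_ex[a [g ug]]] := eqVneq u 0; first by left.
have [->|/lead_ex[b [h wh]]] := eqVneq w 0; first by right.
by have := lead_neq0 (leadM ug wh); rewrite uw eqxx.
Qed.

Lemma vgeM u g w h : vge u g -> vge w h -> vge (u * w) (g + h).
Proof.
have [->|/lead_ex[a [g' ug']]] := eqVneq u 0; first by rewrite mul0r => *; apply: vge0.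
have [->|/lead_ex[b [h' wh']]] := eqVneq w 0; first by rewrite mulr0 => *; apply: vge0.
move=> /(lead_vge _ ug') gg' /(lead_vge _ wh') hh'.
by apply/(lead_vge _ (leadM ug' wh')); apply: oag_leD.
Qed.

Lemma vgtM u g w h : vgt u g -> vge w h -> vgt (u * w) (g + h).
Proof.
have [->|/lead_ex[a [g' ug']]] := eqVneq u 0; first by rewrite mul0r => *; apply: vgt0.
have [->|/lead_ex[b [h' wh']]] := eqVneq w 0; first by rewrite mulr0 => *; apply: vgt0.
move=> /(lead_vgt _ ug') gg' /(lead_vge _ wh') hh'.
by apply/(lead_vgt _ (leadM ug' wh')); apply: oag_ltleD.
Qed.

Lemma natr_mono n : n%:R = mono K n%:R 0.
Proof.
elim: n => [|n IHn]; first by rewrite mono0.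
by rewrite -addn1 !natrD IHn monoD -mono1.
Qed.

Lemma natr_neq0 n : (n.+1)%:R != 0 :> k.
Proof.
have /pcharf0P -> // := (@diff_pchar0 k : [pchar k] =i pred0).
Qed.

(** In characteristic zero the positive integers have valuation zero. This lets coefficients of a
    polynomial be estimated through those of its partial derivatives. *)
Lemma leadMn u a g n : lead u a g -> lead (u *+ n.+1) (a *+ n.+1) g.
Proof.
move=> ug; rewrite -(mulr_natl u) -(mulr_natl a) natr_mono -[g]add0r; apply: leadM => //.
exact/lead_mono/natr_neq0.
Qed.

Lemma vgtMn u g n : vgt (u *+ n.+1) g <-> vgt u g.
Proof.
have [->|/lead_ex[a [h uh]]] := eqVneq u 0; first by rewrite mul0rn.
by rewrite (lead_vgt _ uh) (lead_vgt _ (leadMn n uh)).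
Qed.

(** * Polynomials: Gauss valuations and the differential-Hensel configuration *)

Section Gauss.
Variable n : nat.
Implicit Types (p q : {mpoly K[n]}) (h v : 'I_n -> K) (m : 'X_{1..n}).

(* [GE g y p] says that p(t^g Z) has Gauss valuation at least y. *)
Definition GE g y p := forall m, vge p@_m (y - g *+ mdeg m).
Definition GT g y p := forall m, vgt p@_m (y - g *+ mdeg m).

Lemma GTD g y p q : GT g y p -> GT g y q -> GT g y (p + q).
Proof. by move=> gp gq m; rewrite mcoeffD; apply: vgtD. Qed.

Lemma GED g y p q : GE g y p -> GE g y q -> GE g y (p + q).
Proof. by move=> gp gq m; rewrite mcoeffD; apply: vgeD. Qed.

Lemma GEM g y z p q : GE g y p -> GE g z q -> GE g (y + z) (p * q).
Proof.
move=> gp gq m; apply: (@mcoeffM_ind _ _ (fun u => vge u _)); [exact: vge0 | move=> u w; exact: vgeD |].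
move=> m1 m2 <-.
rewrite mdegD mulrnDr opprD addrACA; exact: vgeM.
Qed.

Lemma GTM g y z p q : GT g y p -> GE g z q -> GT g (y + z) (p * q).
Proof.
move=> gp gq m; apply: (@mcoeffM_ind _ _ (fun u => vgt u _)); [exact: vgt0 | move=> u w; exact: vgtD |].
move=> m1 m2 <-.
rewrite mdegD mulrnDr opprD addrACA; exact: vgtM.
Qed.

Lemma GEC g y u : vge u y -> GE g y u%:MP.
Proof.
move=> uy m; rewrite mcoeffC; have [->|_] := eqVneq m 0%MM.
  by rewrite mulr1 mdeg0 subr0.
by rewrite mulr0; apply: vge0.
Qed.

Lemma GTC g y u : vgt u y -> GT g y u%:MP.
Proof.
move=> uy m; rewrite mcoeffC; have [->|_] := eqVneq m 0%MM.
  by rewrite mulr1 mdeg0 subr0.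
by rewrite mulr0; apply: vgt0.
Qed.

Lemma GEX g i : GE g g 'X_i.
Proof.
move=> m; rewrite mcoeffX; case: eqP => [<-|_]; last by apply: vge0.
by rewrite mdeg1 subrr; apply: vge1.
Qed.

Lemma GE_exp g y p j : GE g y p -> GE g (y *+ j) (p ^+ j).
Proof.
move=> gp; elim: j => [|j IHj]; last by rewrite exprS mulrS; apply: GEM.
by rewrite expr0 -mpolyC1; apply: GEC; apply: vge1.
Qed.

Lemma GE_prod g (I : Type) (s : seq I) (y : I -> G) (F : I -> {mpoly K[n]}) :
  (forall i, GE g (y i) (F i)) -> GE g (\sum_(i <- s) y i) (\prod_(i <- s) F i).
Proof.
move=> gF; elim: s => [|i s IHs].
  by rewrite !big_nil -mpolyC1; apply: GEC; apply: vge1.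
by rewrite !big_cons; apply: GEM.
Qed.

(** Both ['X_i] and ['X_i + h i] have Gauss valuation at least [g] at radius [g], so the
    substitution cannot lower that of [p]. *)
Lemma GT_shift g y h p : (forall i, vge (h i) g) -> GT g y p -> GT g y (shift h p).
Proof.
move=> hg gp; rewrite /shift /mmap.
apply: (big_ind (GT g y)) => [|p1 p2|m _]; [|exact: GTD|].
  by move=> m; rewrite mcoeff0; apply: vgt0.
rewrite -[y](subrK (g *+ mdeg m)); apply: GTM; first exact: GTC.
have -> : g *+ mdeg m = \sum_(i < n) g *+ m i by rewrite mdegE sumrMnr.
apply: (@GE_prod g _ _ (fun i => g *+ m i)) => i.
by apply: GE_exp; apply: GED; [apply: GEX | apply: GEC].
Qed.

Lemma GT_meval g y h p : (forall i, vge (h i) g) -> GT g y p -> vgt p.@[h] y.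
Proof.
move=> hg /(GT_shift hg) /(_ 0%MM).
by rewrite mcoeff0_shift mdeg0 subr0.
Qed.

Definition linpart p : {mpoly K[n]} :=
  (p@_0)%:MP + \sum_(i < n) (p@_U_(i))%:MP * 'X_i.

Lemma linpart0 p : (linpart p)@_0 = p@_0.
Proof.
rewrite mcoeffD mcoeffC eqxx mulr1 raddf_sum big1 /= ?addr0 // => i _.
by rewrite mcoeffCM mcoeffX mnm1_eq0 mulr0.
Qed.

Lemma linpart1 p i : (linpart p)@_U_(i) = p@_U_(i).
Proof.
rewrite mcoeffD mcoeffC mnm1_eq0 mulr0 add0r raddf_sum (bigD1 i) //=.
rewrite mcoeffCM mcoeffX eqxx mulr1 big1 ?addr0 // => j ji.
by rewrite mcoeffCM mcoeffX eq_mnm1 (negPf ji) mulr0.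
Qed.

Lemma linpart_gt1 p m : (1 < mdeg m)%N -> (linpart p)@_m = 0.
Proof.
move=> m1; have m0 : m != 0%MM by rewrite -mdeg_eq0 -lt0n ltnW.
rewrite mcoeffD mcoeffC (negPf m0) mulr0 add0r raddf_sum big1 // => i _.
rewrite /= mcoeffCM mcoeffX; case: eqP => [E|_]; last by rewrite mulr0.
by rewrite -E mdeg1 in m1.
Qed.

Lemma mdeg_cases m : [\/ m = 0%MM, exists i, m = U_(i)%MM | (1 < mdeg m)%N].
Proof.
case E : (mdeg m) => [|[|j]]; last by apply: Or33.
- by apply: Or31; apply/eqP; rewrite -mdeg_eq0 E.
- by apply: Or32; have /eqP/mdeg1P[i /eqP ->] := E; exists i.
Qed.

(* On the ball of radius [g] around 0 the linear part of [p], of valuation [b],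
   dominates the terms of higher degree, and [p] may have a zero there. *)
Definition hconf p (b g : G) := [/\ vge p@_0 (b + g), forall i, vge p@_U_(i) b,
  exists i, coef p@_U_(i) b != 0 &
  forall m, (1 < mdeg m)%N -> vgt p@_m (b + g - g *+ mdeg m)].

Lemma hconf_GT p (b g : G) : hconf p b g -> GT g (b + g) (p - linpart p).
Proof.
case=> _ _ _ p2 m; rewrite mcoeffB; case: (mdeg_cases m) => [->|[i ->]|m1].
- by rewrite linpart0 subrr; apply: vgt0.
- by rewrite linpart1 subrr; apply: vgt0.
- by rewrite linpart_gt1 // subr0; apply: p2.
Qed.

Lemma meval_linpart p h :
  (linpart p).@[h] = p@_0 + \sum_(i < n) p@_U_(i) * h i.
Proof.
rewrite mevalD mevalC raddf_sum; congr (_ + _); apply: eq_bigr => i _.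
by rewrite /= mevalM mevalC mevalXU.
Qed.

Lemma shift_linpart p h :
  shift h (linpart p) = linpart p + (\sum_(i < n) p@_U_(i) * h i)%:MP.
Proof.
rewrite shiftD shiftC /linpart -addrA; congr (_ + _).
have -> : shift h (\sum_(i < n) (p@_U_(i))%:MP * 'X_i) =
    \sum_(i < n) shift h ((p@_U_(i))%:MP * 'X_i).
  by apply: big_morph => [q q'|]; rewrite ?shiftD // /shift mmap0.
rewrite raddf_sum /= -big_split /=; apply: eq_bigr => i _.
by rewrite shiftM shiftC shiftX mulrDr mpolyCM.
Qed.

Lemma hconf_meval p (b g : G) h : hconf p b g -> (forall i, vge (h i) g) ->
  vgt (p.@[h] - (p@_0 + \sum_(i < n) p@_U_(i) * h i)) (b + g).
Proof.
move=> /hconf_GT pg hg; rewrite -meval_linpart -mevalB.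
exact: GT_meval pg.
Qed.

(** The difference between [p] and its linear part stays small under the translation, while the
    linear part changes only in its constant term. So the linear coefficients change by terms of
    valuation above [b]. *)
Lemma hconf_shift p (b g : G) h : hconf p b g -> (forall i, vge (h i) g) ->
  hconf (shift h p) b g.
Proof.
move=> pg hg; have := GT_shift hg (hconf_GT pg).
rewrite shiftB shift_linpart => sg.
set s := \sum_(i < n) p@_U_(i) * h i in sg.
have coefE m : (shift h p)@_m =
    (shift h p - (linpart p + s%:MP))@_m + (linpart p)@_m + (s%:MP)@_m.
  by rewrite mcoeffB mcoeffD -addrA subrK.
have [p0 p1 [i pi] p2] := pg.
have C1 j : (s%:MP)@_U_(j) = 0 by rewrite mcoeffC mnm1_eq0 mulr0.
have S1 j : vgt (shift h p - (linpart p + s%:MP))@_U_(j) b.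
  by have := sg U_(j)%MM; rewrite mdeg1 addrK.
split.
- rewrite coefE linpart0 mcoeffC eqxx mulr1; apply: vgeD; first apply: vgeD => //.
    by have := sg 0%MM; rewrite mdeg0 subr0; apply: vgeW.
  by apply: vge_sum => j _; apply: vgeM.
- move=> j; rewrite coefE linpart1 C1 addr0; apply: vgeD => //.
  exact: vgeW.
- exists i; rewrite coefE linpart1 C1 addr0 coef_add (S1 i) ?add0r //.
- move=> m m1; rewrite coefE linpart_gt1 // mcoeffC.
  have /negPf -> : m != 0%MM by rewrite -mdeg_eq0 -lt0n ltnW.
  by rewrite mulr0 !addr0; apply: sg.
Qed.

(** On a smaller ball the terms of degree at least 2 shrink faster than the linear ones; only the
    constant term needs a new bound. *)
Lemma hconf_raise p (b g d : G) : hconf p b g -> g <= d -> vge p@_0 (b + d) ->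
  hconf p b d.
Proof.
move=> [_ p1 p1' p2] gd p0; split=> // m m1; apply: vgt_le (p2 m m1).
case: (mdeg m) m1 => [|[|j]] // _; rewrite -!addrA oag_leD2lE.
rewrite ![_ *+ j.+2]mulrS !opprD !addrA !subrr !add0r.
by rewrite oag_leN2 oag_leMn.
Qed.

End Gauss.

Definition jet n u : 'I_n -> K := fun i => iter i (@hD _ _ _ K) u.

Lemma jetD n u w (i : 'I_n) : jet (u + w) i = jet u i + jet w i.
Proof. by rewrite /jet; elim: (i : nat) => //= j ->; rewrite hDD. Qed.

Lemma vge_jet n u g (i : 'I_n) : vge u g -> vge (jet u i) g.
Proof. exact: vge_iterD. Qed.

Lemma meval_shift_jet n u w (p : {mpoly K[n]}) :
  (shift (jet u) p).@[jet w] = p.@[jet (w + u)].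
Proof. by rewrite meval_shift; apply: meval_eq => i; rewrite jetD. Qed.

(** A property of one polynomial at a time, hence of finitely many elements, which makes it pass to
    ultrapowers; [spherical] ranges over families of balls. *)
Definition hensel := forall n (p : {mpoly K[n]}) (b g : G), hconf p b g ->
  exists u, vge u g /\ p.@[jet u] = 0.

Definition spherical := forall C : K -> G -> Prop,
  (forall u g w h, C u g -> C w h -> g <= h -> vge (w - u) g) ->
  exists z, forall u g, C u g -> vge (z - u) g.

End Core.

(** * Linear operators over k in the twisted derivation *)

Section TwistedOperator.
Variables (k : diffFieldType) (c0 : k).

Definition twder (z : k) := der z + c0 * z.

(* The coefficients of (der + c0)^i as an operator in der. *)
Fixpoint twcoef (i j : nat) : k :=
  if i is i'.+1 then
    der (twcoef i' j) + (if j is j'.+1 then twcoef i' j' else 0) + c0 * twcoef i' j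
  else (j == 0%N)%:R.

Lemma twcoef_gt i j : (i < j)%N -> twcoef i j = 0.
Proof.
elim: i j => [|i IHi] [|j] //= ij; rewrite !IHi ?(ltnW ij) //.
by rewrite der0 mulr0 !addr0.
Qed.

Lemma twcoef_diag i : twcoef i i = 1.
Proof.
by elim: i => //= i IHi; rewrite twcoef_gt // IHi der0 mulr0 add0r addr0.
Qed.

Lemma iter_twder N i z : (i < N)%N ->
  iter i twder z = \sum_(j < N) twcoef i j * iter j der z.
Proof.
elim: i => [|i IHi] iN.
  case: N iN => // N _; rewrite big_ord_recl /= mul1r big1 ?addr0 // => j _.
  by rewrite mul0r.
rewrite iterS IHi ?(ltnW iN) // /twder der_sum big_distrr /= -big_split /=.
have -> : \sum_(j < N) (der (twcoef i j * iter j der z) + c0 * (twcoef i j * iter j der z)) =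
    \sum_(j < N) (der (twcoef i j) + c0 * twcoef i j) * iter j der z +
    \sum_(j < N) twcoef i j * iter j.+1 der z.
  rewrite -big_split; apply: eq_bigr => j _ /=.
  by rewrite derM mulrDl -mulrA addrAC.
case: N iN {IHi} => // N iN; rewrite [X in _ + X]big_ord_recr /=.
rewrite twcoef_gt // mul0r addr0 !big_ord_recl -addrA -big_split /=.
congr (_ + _); first by rewrite addr0.
by apply: eq_bigr => j _; rewrite -mulrDl /bump /= add1n add0n addrAC.
Qed.

(** The power [(der + c0)^i] is monic of order [i] in [der]. Rewriting the operator in powers of
    [der] thus keeps its leading coefficient, and it remains nonzero. *)
Lemma twisted_surjective n (a : 'I_n -> k) : linearly_surjective k ->
  (exists i, a i != 0) -> forall b, exists z, \sum_(i < n) a i * iter i twder z = b.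
Proof.
move=> ls [i0 ai0] b; case: n a i0 ai0 => [|n] a i0 ai0; first by case: i0 {ai0}.
pose A (j : 'I_n.+1) := \sum_(i < n.+1) a i * twcoef i j.
have [|z zb] := ls n A _ b.
  case: (@arg_maxnP _ i0 (fun i => a i != 0) (fun i : 'I_n.+1 => (i : nat)) ai0) => i ai imax.
  exists i; rewrite /A (bigD1 i) //= twcoef_diag mulr1 big1 ?addr0 // => j ji.
  have [->|aj] := eqVneq (a j) 0; first by rewrite mul0r.
  by rewrite twcoef_gt ?mulr0 // ltn_neqAle ji; apply: imax.
exists z; rewrite -zb /A.
transitivity (\sum_(i < n.+1) \sum_(j < n.+1) a i * (twcoef i j * iter j der z)).
  by apply: eq_bigr => i _; rewrite (@iter_twder n.+1) // big_distrr.
rewrite exchange_big; apply: eq_bigr => j _ /=.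
by rewrite big_distrl; apply: eq_bigr => i _; rewrite mulrA.
Qed.

End TwistedOperator.
(** * The differential-Hensel property of Hahn fields *)

Section Hensel.
Variables (k : diffFieldType) (G : orderedAbGroupType) (c : {additive G -> k}).
Variable K : hcore c.
Hypothesis Ksph : spherical K.
Hypothesis kls : linearly_surjective k.

Lemma iter_hD_mono (z : k) (d : G) i :
  iter i (@hD _ _ _ K) (mono K z d) = mono K (iter i (twder (c d)) z) d.
Proof. by elim: i => //= i ->; rewrite hD_mono. Qed.

(* A Newton step: the linear part is inverted in k by linear surjectivity. *)
Lemma hconf_improve n (p : {mpoly K[n]}) (b d : G) : hconf p b d ->
  exists u, vge u d /\ vgt p.@[jet u] (b + d).
Proof.
move=> pbd; have [p0 p1 p1' _] := pbd.
(* On monomials of exponent [d] the derivation is twisted by [c d]. The solution [z] makes the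
   linear terms cancel the constant term at exponent [b + d]. *)
have [z zP] := twisted_surjective (c d) kls p1' (- coef p@_0 (b + d)).
exists (mono K z d); split; first exact: vge_mono.
have jv (i : 'I_n) : vge (jet (mono K z d) i) d by apply/vge_jet/vge_mono.
rewrite -[p.@[_]](subrK (p@_0 + \sum_(i < n) p@_U_(i) * jet (mono K z d) i)).
apply: vgtD; first exact: hconf_meval pbd jv.
apply/vgtE; split.
  by apply: vgeD => //; apply: vge_sum => i _; apply: vgeM.
rewrite coef_add coef_sum; apply/eqP; rewrite addrC addr_eq0 -zP; apply/eqP.
apply: eq_bigr => i _; rewrite (coefM (p1 i) (jv i)).2.
by rewrite /jet iter_hD_mono coef_mono eqxx.
Qed.

(** Without a zero, every approximation [t] gets a radius [dl t], the valuation of the value at [t]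
    being [b + dl t]. Spherical completeness bounds chains of nested balls, and a Newton step from a
    Zorn-maximal approximation enlarges its radius, a contradiction. *)
Lemma spherical_hensel : hensel K.
Proof.
move=> n p b g pbg; apply: contrapT => nz.
have nz' u : vge u g -> p.@[jet u] != 0.
  by move=> ug; apply/eqP => pu; apply: nz; exists u.
pose T := {u : K | vge u g}.
have /choice[dl dlP] : forall t : T, exists d, exists a,
    lead p.@[jet (sval t)] a (b + d).
  move=> [u ug] /=; have [a [d ud]] := lead_ex (nz' u ug).
  by exists (d - b), a; rewrite addrC subrK.
have conf (t : T) : hconf (shift (jet (sval t)) p) b (dl t).
  have cg : hconf (shift (jet (sval t)) p) b g.
    by apply: hconf_shift => // i; apply/vge_jet/(svalP t).
  have [a dt] := dlP t; have [p0 _ _ _] := cg.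
  rewrite mcoeff0_shift in p0; apply: hconf_raise cg _ _.
    by have /(lead_vge _ dt) := p0; rewrite oag_leD2lE.
  by rewrite mcoeff0_shift; case: dt.
have gdl (t : T) : g <= dl t.
  have [a dt] := dlP t; rewrite -(oag_leD2lE b); apply/(lead_vge _ dt).
  have cg : hconf (shift (jet (sval t)) p) b g.
    by apply: hconf_shift => // i; apply/vge_jet/(svalP t).
  by have [] := cg; rewrite mcoeff0_shift.
pose R (s t : T) := `[< dl s <= dl t /\ vge (sval t - sval s) (dl s) >].
have t0 : T by exists 0; apply: vge0.
have [] := @ZL_preorder T t0 R.
- by move=> t; apply/asboolP; rewrite subrr; split=> //; apply: vge0.
- move=> r s t /asboolP[rs vrs] /asboolP[st vst]; apply/asboolP.
  split; first exact: le_trans rs st.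
  rewrite -(subrK (sval s) (sval t)) -addrA; apply: vgeD => //.
  exact: vge_le vst.
- move=> A Atot; have [[s0 As0]|nA] := pselect (A !=set0); last first.
    by exists t0 => s As; case: nA; exists s.
  have [|z zP] := Ksph (C := fun u d => exists2 t, A t & u = sval t /\ d = dl t).
    move=> u d w e [s As [-> ->]] [t At [-> ->]] st.
    have [/asboolP[_ //]|/asboolP[ts]] := Atot _ _ As At.
    rewrite -opprB => /vgeN; rewrite !opprB; apply: vge_le.
    exact: st.
  have zs s : A s -> vge (z - sval s) (dl s) by move=> As; apply: zP; exists s.
  have zg : vge z g.
    rewrite -(subrK (sval s0) z); apply: vgeD (svalP s0).
    by apply: vge_le (zs _ As0); apply: gdl.
  exists (exist _ z zg) => s As; apply/asboolP; split=> /=; last exact: zs.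
  (* Translating the configuration at [s] to the pseudo-limit [z] gives a value of valuation at
     least [b + dl s]. *)
  have [a zd] := dlP (exist _ z zg); rewrite -(oag_leD2lE b).
  apply/(lead_vge _ zd) => /=.
  have := hconf_shift (conf s) (fun i => vge_jet i (zs s As)).
  by case; rewrite mcoeff0_shift meval_shift_jet subrK.
move=> t tmax; have [u [ud pu]] := hconf_improve (conf t).
rewrite meval_shift_jet in pu.
have utg : vge (u + sval t) g.
  by apply: vgeD (svalP t); apply: vge_le ud; apply: gdl.
pose s : T := exist _ (u + sval t) utg.
have [a sa] := dlP s.
have lt : dl t < dl s by rewrite -(oag_ltD2lE b); apply/(lead_vgt _ sa).
have /tmax/asboolP[] : R t s.
  by apply/asboolP; split; [apply: ltW | rewrite /= addrK].
by rewrite oag_leNgt lt.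
Qed.

End Hensel.

(** The coefficient at [x] is read off the centre of any ball of radius above [x], and is zero if
    there is none. Below each radius the support agrees with that of a centre, so it is well
    ordered. *)
Lemma hahn_spherical (k : diffFieldType) (G : orderedAbGroupType)
  (c : {additive G -> k}) : spherical (hahn_core c).
Proof.
move=> C Cc; pose z (x : G) : k :=
  if pselect (exists ug : hahn k G * G, C ug.1 ug.2 /\ x < ug.2) is left p
  then (projT1 (cid p)).1 x else 0.
have zE u g x : C u g -> x < g -> z x = u x.
  move=> Cu xg; rewrite /z; case: pselect => [p|[]]; last by exists (u, g).
  case: cid => -[w h] /= [Cw xh]; apply/eqP; rewrite -subr_eq0; apply/eqP.
  have [gh|/ltW hg] := oag_leP g h; first exact: (Cc _ _ _ _ Cu Cw gh x xg).
  by apply/eqP; rewrite -oppr_eq0 opprB; apply/eqP; apply: (Cc _ _ _ _ Cw Cu hg x xh).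
have zwo : well_ordered (hsupp z).
  move=> B Bz [b Bb]; have [[u g] [/= Cu bg]] : exists ug : hahn k G * G,
      C ug.1 ug.2 /\ b < ug.2.
    apply: contrapT => nb; have := Bz b Bb; rewrite /hsupp /= /z.
    by case: pselect => // _; rewrite eqxx.
  have [m [[Bm mg] mmin]] : exists x, is_least [set x | B x /\ x < g] x.
    apply: (hahn_wo u); last by exists b.
    by move=> x [Bx xg]; rewrite /hsupp /= -(zE _ _ _ Cu xg); apply: Bz.
  exists m; split=> // y By; have [yg|gy] := oag_leP g y; last by apply: mmin.
  by apply: ltW; apply: lt_le_trans yg.
exists (Hahn zwo : hahn_core c) => u g Cu x xg.
by rewrite -[LHS]/(z x - u x) (zE _ _ _ Cu xg) subrr.
Qed.

(** * Ultrapowers of Hahn cores *)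

Section UltraCore.
Variables (k : diffFieldType) (G : orderedAbGroupType) (c : {additive G -> k}).
Variable K : hcore c.

Definition ucoef (u : ult K) (g : ult G) : ult k := umap2 (@coef _ _ _ K) u g.
Definition umono (a : ult k) (g : ult G) : ult K := umap2 (@mono _ _ _ K) a g.
Definition uD (u : ult K) : ult K := umap (@hD _ _ _ K) u.

Lemma cl_coef f g : ucoef (cl f) (cl g) = cl (fun n => coef (f n) (g n)).
Proof. exact: umap2E. Qed.

Lemma cl_mono f g : umono (cl f) (cl g) = cl (fun n => mono K (f n) (g n)).
Proof. exact: umap2E. Qed.

Lemma cl_D f : uD (cl f) = cl (fun n => hD (f n)).
Proof. exact: umapE. Qed.

(** If the bound fails in almost all coordinates, chosen bad exponents form one bad exponent of the
    ultrapower. *)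
Lemma cl_vge (f : nat -> K) (g : nat -> G) :
  (forall x, x < cl g -> ucoef (cl f) x = 0) <-> ae (fun n => vge (f n) (g n)).
Proof.
split=> [fg|fg x]; last first.
  have [h ->] := cl_surj x => /cl_ltP hg; rewrite cl_coef; apply/cl_eqP.
  by apply: aeS2 hg fg => n hg fg; apply: fg.
apply: contrapT => /aeN nfg.
have /choice[h hP] : forall n, exists x, ~ vge (f n) (g n) ->
    x < g n /\ coef (f n) x <> 0.
  move=> n; have [v|nv] := pselect (vge (f n) (g n)); first by exists 0 => /(_ v).
  apply: contrapT => nx; apply: nv => x xg; apply: contrapT => fx.
  by apply: nx; exists x.
have hg : cl h < cl g by apply/cl_ltP; apply: aeS nfg => n /hP[].
have := fg _ hg; rewrite cl_coef => /cl_eqP f0.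
by apply: (@ae_const False); apply: aeS2 f0 nfg => n f0 /hP[_]; apply.
Qed.

Fact uDD : {morph uD : x y / x + y}.
Proof.
move=> x y; have [f ->] := cl_surj x; have [g ->] := cl_surj y.
by rewrite clD !cl_D clD; congr cl; apply/funext => n; rewrite hDD.
Qed.

Fact uDM x y : uD (x * y) = uD x * y + x * uD y.
Proof.
have [f ->] := cl_surj x; have [g ->] := cl_surj y.
by rewrite clM !cl_D !clM clD; congr cl; apply/funext => n; rewrite hDM.
Qed.

Fact ucoefB u w g : ucoef (u - w) g = ucoef u g - ucoef w g.
Proof.
have [f ->] := cl_surj u; have [h ->] := cl_surj w; have [x ->] := cl_surj g.
by rewrite clB !cl_coef clB; congr cl; apply/funext => n; rewrite coefB.
Qed.

Fact ucoef_D u g : ucoef (uD u) g = der (ucoef u g) + umapc c g * ucoef u g.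
Proof.
have [f ->] := cl_surj u; have [x ->] := cl_surj g.
rewrite cl_D !cl_coef cl_c clM [der _]cl_der clD.
by congr cl; apply/funext => n; rewrite coef_D.
Qed.

Fact ucoefM u w g h :
  (forall x, x < g -> ucoef u x = 0) -> (forall x, x < h -> ucoef w x = 0) ->
  (forall x, x < g + h -> ucoef (u * w) x = 0) /\
  ucoef (u * w) (g + h) = ucoef u g * ucoef w h.
Proof.
have [f ->] := cl_surj u; have [f' ->] := cl_surj w.
have [x ->] := cl_surj g; have [y ->] := cl_surj h.
move=> /cl_vge fx /cl_vge fy; rewrite !clD !clM !cl_coef clM; split.
  by apply/cl_vge; apply: aeS2 fx fy => n fx fy; apply: (coefM fx fy).1.
by apply/cl_eqP; apply: aeS2 fx fy => n fx fy; apply: (coefM fx fy).2.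
Qed.

Fact ucoef_least u : u != 0 ->
  exists g, ucoef u g != 0 /\ forall x, x < g -> ucoef u x = 0.
Proof.
have [f ->] := cl_surj u => f0.
have {f0}nf : ae (fun n => ~ f n = 0).
  by apply/aeN => E; case/eqP: f0; apply/cl_eqP.
have /choice[g gP] : forall n, exists g, ~ f n = 0 ->
    coef (f n) g != 0 /\ vge (f n) g.
  move=> n; have [->|/coef_least[g gP]] := eqVneq (f n) 0; last by exists g.
  by exists 0.
exists (cl g); split; last by apply/cl_vge; apply: aeS nf => n /gP[].
rewrite cl_coef; apply/eqP => /cl_eqP E; apply: (@ae_const False).
by apply: aeS2 nf E => n /gP[/eqP].
Qed.

Fact ucoef_mono a g x : ucoef (umono a g) x = if x == g then a else 0.
Proof.
have [f ->] := cl_surj a; have [h ->] := cl_surj g; have [y ->] := cl_surj x.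
rewrite cl_mono cl_coef; case: eqP => [/cl_eqP E|/cl_eqP/aeN E]; apply/cl_eqP.
  by apply: aeS E => n ->; rewrite coef_mono eqxx.
by apply: aeS E => n /eqP/negPf yh; rewrite coef_mono yh.
Qed.

Fact umonoM a g b h : umono a g * umono b h = umono (a * b) (g + h).
Proof.
have [f ->] := cl_surj a; have [x ->] := cl_surj g.
have [f' ->] := cl_surj b; have [y ->] := cl_surj h.
rewrite clM clD !cl_mono clM; congr cl; apply/funext => n; exact: monoM.
Qed.

Fact umono1 : umono 1 0 = 1.
Proof.
by rewrite -!cl1 -cl0 cl_mono; congr cl; apply/funext => n; apply: mono1.
Qed.

Definition ult_core : hcore (umapc c) := HCore uDD uDM ucoefB ucoef_D ucoefM
  ucoef_least ucoef_mono umonoM umono1.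

Lemma cl_vgeP (f : nat -> K) (g : nat -> G) :
  vge (cl f : ult_core) (cl g) <-> ae (fun n => vge (f n) (g n)).
Proof. exact: cl_vge. Qed.

Lemma cl_vgtP (f : nat -> K) (g : nat -> G) :
  vgt (cl f : ult_core) (cl g) <-> ae (fun n => vgt (f n) (g n)).
Proof.
rewrite vgtE cl_vgeP [coef _ _]cl_coef; split=> [[v /cl_eqP]|v].
  by apply: aeS2 v => n v E; apply/vgtE.
split; first by apply: aeS v => n; apply: vgeW.
by apply/cl_eqP; apply: aeS v => n; apply.
Qed.

Lemma cl_jet n (f : nat -> K) (i : 'I_n) :
  jet (cl f : ult_core) i = cl (fun m => jet (f m) i).
Proof. by rewrite /jet; elim: (i : nat) => //= j ->; apply: cl_D. Qed.

(** All coordinates use monomials from the finite support of [p]. A condition on every coefficient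
    thus reduces to finitely many conditions, each true almost everywhere. *)
Definition mpoly_rep n (p : {mpoly ult_core[n]}) (i : nat) : {mpoly K[n]} :=
  \sum_(m <- msupp p) rep (p@_m) i *: 'X_[m].

Lemma mcoeff_rep n (p : {mpoly ult_core[n]}) i m :
  (mpoly_rep p i)@_m = if m \in msupp p then rep (p@_m) i else 0.
Proof.
rewrite /mpoly_rep raddf_sum /=; case: ifPn => mp.
  rewrite (bigD1_seq m) ?msupp_uniq //= mcoeffZ mcoeffX eqxx mulr1.
  by rewrite big1 ?addr0 // => m' /negPf m'm; rewrite mcoeffZ mcoeffX m'm mulr0.
rewrite big_seq big1 // => m' m'p; rewrite mcoeffZ mcoeffX.
by case: eqP => [E|_]; rewrite ?mulr0 //; rewrite -E m'p in mp.
Qed.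

Lemma cl_mcoeff n (p : {mpoly ult_core[n]}) m :
  cl (fun i => (mpoly_rep p i)@_m) = p@_m.
Proof.
have [mp|mp] := boolP (m \in msupp p).
  by rewrite -[RHS]repK; congr cl; apply/funext => i; rewrite mcoeff_rep mp.
rewrite (memN_msupp_eq0 mp) -cl0; congr cl; apply/funext => i.
by rewrite mcoeff_rep (negPf mp).
Qed.

Lemma cl_meval n (p : {mpoly ult_core[n]}) (v : 'I_n -> nat -> K) :
  p.@[fun i => cl (v i)] = cl (fun i => (mpoly_rep p i).@[fun j => v j i]).
Proof.
rewrite mevalE; transitivity (\sum_(m <- msupp p)
    cl (fun i => rep p@_m i * \prod_j v j i ^+ m j)).
  apply: eq_bigr => m _; rewrite -[p@_m]repK.
  rewrite (eq_bigr (fun j => cl (fun i => v j i ^+ m j))); last first.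
    by move=> j _; rewrite clX.
  by rewrite cl_prod clM repK.
rewrite cl_sum; congr cl; apply/funext => i.
rewrite /mpoly_rep raddf_sum; apply: eq_bigr => m _ /=.
by rewrite mevalZ mevalX.
Qed.

Lemma ult_hensel : hensel K -> hensel ult_core.
Proof.
move=> Kh n p b g; have [b' ->] := cl_surj b; have [g' ->] := cl_surj g.
case=> p0 p1 [i0 p1'] p2.
have conf : ae (fun i => hconf (mpoly_rep p i) (b' i) (g' i)).
  have a0 : ae (fun i => vge (mpoly_rep p i)@_0 (b' i + g' i)).
    by apply/cl_vgeP; rewrite cl_mcoeff -clD.
  have a1 : ae (fun i => forall j, j \in enum 'I_n -> vge (mpoly_rep p i)@_U_(j) (b' i)).
    apply: (@ae_all_in _ _ (fun j i => vge (mpoly_rep p i)@_U_(j) (b' i))) => j _.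
    by apply/cl_vgeP; rewrite cl_mcoeff.
  have a1' : ae (fun i => ~ coef (mpoly_rep p i)@_U_(i0) (b' i) = 0).
    apply/aeN => /cl_eqP E; case/eqP: p1'.
    by rewrite -(cl_mcoeff p) [LHS]cl_coef.
  have a2 : ae (fun i => forall m, m \in msupp p -> (1 < mdeg m)%N ->
      vgt (mpoly_rep p i)@_m (b' i + g' i - g' i *+ mdeg m)).
    apply: (@ae_all_in _ _ (fun m i => (1 < mdeg m)%N ->
      vgt (mpoly_rep p i)@_m (b' i + g' i - g' i *+ mdeg m))) => m _.
    apply/ae_imp => /ae_const m1.
    by apply/cl_vgtP; rewrite cl_mcoeff -clB -clD -clMn; apply: p2.
  apply: aeS2 (aeI a0 a1) (aeI a1' a2) => i [c0 c1] [c1' c2]; split=> //.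
  - by move=> j; apply: c1; rewrite mem_enum.
  - by exists i0; apply/eqP.
  - move=> m m1; have [mp|mp] := boolP (m \in msupp p); first exact: c2.
    by rewrite mcoeff_rep (negPf mp); apply: vgt0.
have /choice[u uP] : forall i, exists u, hconf (mpoly_rep p i) (b' i) (g' i) ->
    vge u (g' i) /\ (mpoly_rep p i).@[jet u] = 0.
  move=> i; have [/Kh[u uP]|nc] := pselect (hconf (mpoly_rep p i) (b' i) (g' i)).
    by exists u.
  by exists 0.
exists (cl u : ult_core); split; first by apply/cl_vgeP; apply: aeS conf => i /uP[].
rewrite (meval_eq (v2 := fun i => cl (fun m => jet (u m) i))); last exact: cl_jet.
by rewrite cl_meval -cl0; apply/cl_eqP; apply: aeS conf => i /uP[].
Qed.

Lemma ult_core_saturated n (p : {mpoly ult_core[n]}) (a : nat -> ult_core)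
    (g : nat -> ult G) :
  (forall J, exists y, p.@[jet y] = 0 /\ forall j, (j < J)%N -> vge (y - a j) (g j)) ->
  exists y, p.@[jet y] = 0 /\ forall j, vge (y - a j) (g j).
Proof.
move=> fs; pose A j i (y : K) := (mpoly_rep p i).@[jet y] = 0 /\
  vge (y - rep (a j) i) (rep (g j) i).
have pE (y : nat -> K) : p.@[jet (cl y : ult_core)] =
    cl (fun i => (mpoly_rep p i).@[jet (y i)]).
  rewrite -cl_meval; apply: meval_eq => i; exact: cl_jet.
have vE (y : nat -> K) j : vge (cl y - a j : ult_core) (g j) <->
    ae (fun i => vge (y i - rep (a j) i) (rep (g j) i)).
  by rewrite -cl_vgeP -clB !repK.
have [J|y yP] := @ult_saturated _ A.
  have [y [py yJ]] := fs J; have [f E] := cl_surj y; exists f => j jJ.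
  move: py yJ; rewrite E pE -cl0 => /cl_eqP py yJ.
  by apply: aeI py _; apply/vE; apply: yJ.
exists (cl y : ult_core); split.
  by rewrite pE -cl0; apply/cl_eqP; apply: aeS (yP 0%N) => i [].
by move=> j; apply/vE; apply: aeS (yP j) => i [].
Qed.

End UltraCore.
(** * Ultrapowers of the structures at hand *)

Definition core_structure (k : diffFieldType) (G : orderedAbGroupType)
    (c : {additive G -> k}) (K : hcore c) : structure vdf_language :=
  @Structure vdf_language (fun _ => K)
    (fun f => match f return ('I_(farity (l := vdf_language) f) -> K) -> K with
       | VZero => fun _ => 0
       | VOne => fun _ => 1
       | VOpp => fun a => - a ord0
       | VAdd => fun a => a ord0 + a ord_max
       | VMul => fun a => a ord0 * a ord_max
       | VDer => fun a => hD (a ord0)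
       end)
    (fun r a => vge (a ord0) 0).

Section Structures.
Variables (k : diffFieldType) (G : orderedAbGroupType) (c : {additive G -> k}).

Lemma hahn_valringE (f : hahn k G) :
  hahn_valring f <-> vge (f : hahn_core c) 0.
Proof.
rewrite /hahn_valring /hahn_val; case: xgetP => [v _ [g -> [fg gmin]]|nog].
  split=> [g0 x x0|f0].
    apply: contrapT => /eqP fx; have := le_trans g0 (gmin x fx).
    by rewrite oag_leNgt x0.
  by rewrite oag_leNgt; apply/negP => /f0 E; rewrite /hsupp /= [f g]E eqxx in fg.
split=> // _ x _; apply: contrapT => /eqP fx.
have [g gl] := hahn_wo f (hsupp f) (fun _ => id) (ex_intro _ x fx).
by apply: (nog (Some g)); exists g.
Qed.

Lemma hahn_ultrapower : is_ultrapower (M := hahn_structure c)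
  (N := core_structure (ult_core (hahn_core c))) (fun _ f => cl f).
Proof.
split=> [s x|s f g|f a|r a].
- exact: cl_surj.
- exact: cl_eqP.
- by case: f a => a /=; rewrite ?clN ?clD ?clM ?[LHS]cl_D.
- rewrite /= -[0]cl0; split=> [/cl_vgeP|v]; last apply/cl_vgeP.
    by apply: aeS => n /hahn_valringE.
  by apply: aeS v => n /hahn_valringE.
Qed.

Definition kgc_cl s : (nat -> kgc_structure c s) -> kgc_structure (umapc c) s :=
  match s with
  | KField => fun f => cl (f : nat -> k)
  | KGroup => fun f => cl (f : nat -> G)
  end.

Lemma kgc_ultrapower : is_ultrapower kgc_cl.
Proof.
split=> [[] x|[] f g|f a|r a].
- exact: cl_surj.
- exact: cl_surj.
- exact: cl_eqP.
- exact: cl_eqP.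
- by case: f a => a /=; rewrite ?clN ?clD ?clM ?[LHS]cl_der ?[LHS]cl_c.
- exact: cl_leP.
Qed.

End Structures.

Lemma kgc_countable : [/\ cset [set: sort kgc_language],
  cset [set: fsym kgc_language] & cset [set: rsym kgc_language]].
Proof.
split.
- by exists (fun s => if s is KField then 0%N else 1%N) => -[] [].
- exists (fun f => match f with KZero => 0 | KOne => 1 | KOpp => 2 | KAdd => 3
    | KMul => 4 | KDer => 5 | GZero => 6 | GOpp => 7 | GAdd => 8 | CMap => 9 end)%N.
  by move=> [] [].
- by exists (fun=> 0%N) => -[] [].
Qed.

(** * Elementary relations between two-sorted structures *)

Section Pairs.
Variables (k1 k2 : diffFieldType) (G1 G2 : orderedAbGroupType).
Variables (c1 : {additive G1 -> k1}) (c2 : {additive G2 -> k2}).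

Definition kinv (a : k1 * k2) : k1 * k2 := (a.1^-1, a.2^-1).
Definition kder (a : k1 * k2) : k1 * k2 := (der a.1, der a.2).
Definition kc (g : G1 * G2) : k1 * k2 := (c1 g.1, c2 g.2).

Record partial_iso (Rk : k1 * k2 -> Prop) (RG : G1 * G2 -> Prop) : Prop := PIso {
  pi1 : Rk 1;
  piB : forall a b, Rk a -> Rk b -> Rk (a - b);
  piM : forall a b, Rk a -> Rk b -> Rk (a * b);
  piV : forall a, Rk a -> Rk (kinv a);
  piDer : forall a, Rk a -> Rk (kder a);
  pi_eq0 : forall a, Rk a -> a.1 = 0 <-> a.2 = 0;
  pg0 : RG 0;
  pgB : forall g h, RG g -> RG h -> RG (g - h);
  pg_le : forall g h, RG g -> RG h -> (g.1 <= h.1) = (g.2 <= h.2);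
  pgc : forall g, RG g -> Rk (kc g)
}.

Definition relk (R : forall s, kgc_structure c1 s -> kgc_structure c2 s -> Prop)
  (a : k1 * k2) : Prop := R KField a.1 a.2.
Definition relG (R : forall s, kgc_structure c1 s -> kgc_structure c2 s -> Prop)
  (g : G1 * G2) : Prop := R KGroup g.1 g.2.

(** The equation between a new variable and [t] holds on the left, hence on the right: a partner of
    a value is the value of the same term. *)
Lemma elem_term R (G : seq (sort kgc_language)) s (t : term G s)
    (e : env (kgc_structure c1) G) (e' : env (kgc_structure c2) G) y :
  elem_rel R -> env_rel R e e' -> R s (eval e t) y -> y = eval e' t.
Proof.
move=> eR ee' Ry.
pose r : rename G (s :: G) := fun s' v => VS s v.
have /(eR _ (FEq (TVar (VZ s G)) (tren r t))) /= := env_rel_cons Ry ee'.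
by rewrite !eval_tren => -[/(_ erefl)].
Qed.

Section FromElementary.
Variable R : forall s, kgc_structure c1 s -> kgc_structure c2 s -> Prop.
Arguments R : clear implicits.
Hypothesis eR : elem_rel R.
Local Notation M := (kgc_structure c1).
Local Notation N := (kgc_structure c2).

Let e0 : env M [::] := @env_nil _ M.
Let e0' : env N [::] := @env_nil _ N.

Let nil_rel : env_rel R e0 e0'.
Proof. by move=> s v; have := var_nil False v. Qed.

Let v1 (s : kgc_sort) := @TVar kgc_language [:: s] s (VZ s [::]).
Let w1 (s t : kgc_sort) := @TVar kgc_language [:: s; t] s (VZ s [:: t]).
Let w2 (s t : kgc_sort) := @TVar kgc_language [:: s; t] t (VS s (VZ t [::])).

Let tapp0 (f : fsym kgc_language) (f0 : farity f = 0%N) : term (L := kgc_language) [::] (fres f).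
Proof. by apply: TApp => i; exfalso; have := ltn_ord i; rewrite [X in (_ < X)%N]f0. Defined.

Lemma rel_env1 s x x' : R s x x' -> env_rel R (env_cons x e0) (env_cons x' e0').
Proof. by move=> Rx; apply: env_rel_cons. Qed.

Lemma rel_env2 s x x' t y y' : R s x x' -> R t y y' ->
  env_rel R (env_cons x (env_cons y e0)) (env_cons x' (env_cons y' e0')).
Proof. by move=> Rx Ry; do 2![apply: env_rel_cons => //]. Qed.

Lemma relk0 y : R KField 0 y -> y = 0.
Proof. exact: (elem_term (t := @tapp0 KZero erefl) eR nil_rel). Qed.

Lemma relk1 y : R KField 1 y -> y = 1.
Proof. exact: (elem_term (t := @tapp0 KOne erefl) eR nil_rel). Qed.

Lemma relkder x x' y : R KField x x' -> R KField (der (x : k1)) y -> y = der (x' : k2).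
Proof.
move=> Rx; exact: (elem_term (t := TApp (f := KDer : fsym kgc_language)
  (fun i => v1 KField)) eR (rel_env1 Rx)).
Qed.

Lemma relc x x' y : R KGroup x x' -> R KField (c1 x) y -> y = c2 x'.
Proof.
move=> Rx; exact: (elem_term (t := TApp (f := CMap : fsym kgc_language)
  (fun i => v1 KGroup)) eR (rel_env1 Rx)).
Qed.

Lemma relg0 y : R KGroup 0 y -> y = 0.
Proof. exact: (elem_term (t := @tapp0 GZero erefl) eR nil_rel). Qed.

Lemma relkB x x' y y' z : R KField x x' -> R KField y y' ->
  R KField ((x : k1) - (y : k1)) z -> z = (x' : k2) - (y' : k2).
Proof.
move=> Rx Ry; exact: (elem_term (t := TApp (f := KAdd : fsym kgc_language)
  (fun i => if i == ord0 then w1 KField KField else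
    TApp (f := KOpp : fsym kgc_language) (fun _ => w2 KField KField)))
  eR (rel_env2 Rx Ry)).
Qed.

Lemma relkM x x' y y' z : R KField x x' -> R KField y y' ->
  R KField ((x : k1) * (y : k1)) z -> z = (x' : k2) * (y' : k2).
Proof.
move=> Rx Ry; exact: (elem_term (t := TApp (f := KMul : fsym kgc_language)
  (fun i => if i == ord0 then w1 KField KField else w2 KField KField))
  eR (rel_env2 Rx Ry)).
Qed.

Lemma relgB x x' y y' z : R KGroup x x' -> R KGroup y y' ->
  R KGroup ((x : G1) - (y : G1)) z -> z = (x' : G2) - (y' : G2).
Proof.
move=> Rx Ry; exact: (elem_term (t := TApp (f := GAdd : fsym kgc_language)
  (fun i => if i == ord0 then w1 KGroup KGroup else
    TApp (f := GOpp : fsym kgc_language) (fun _ => w2 KGroup KGroup)))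
  eR (rel_env2 Rx Ry)).
Qed.

Lemma relg_le x x' y y' : R KGroup x x' -> R KGroup y y' ->
  ((x : G1) <= (y : G1)) = ((x' : G2) <= (y' : G2)).
Proof.
move=> Rx Ry; apply/idP/idP; apply (eR (FRel (r := GLe : rsym kgc_language)
  (fun i => if i == ord0 then w1 KGroup KGroup else w2 KGroup KGroup))
  (rel_env2 Rx Ry)).
Qed.

(** Only the domain has to be closed: each value then has some partner, which elementarity
    identifies. *)
Lemma elem_partial_iso (Dk : k1 -> Prop) (DG : G1 -> Prop) :
  (forall x, Dk x <-> exists y, R KField x y) ->
  (forall x, DG x <-> exists y, R KGroup x y) ->
  Dk 0 -> Dk 1 -> (forall x y, Dk x -> Dk y -> Dk (x - y)) ->
  (forall x y, Dk x -> Dk y -> Dk (x * y)) -> (forall x, Dk x -> Dk x^-1) ->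
  (forall x, Dk x -> Dk (der x)) -> DG 0 -> (forall x y, DG x -> DG y -> DG (x - y)) ->
  (forall x, DG x -> Dk (c1 x)) -> partial_iso (relk R) (relG R).
Proof.
move=> Dkr DGr D0 D1 DB DM DV Dd DG0 DGB Dc.
have dk a : relk R a -> Dk a.1 by move=> Ra; apply/Dkr; exists a.2.
have dg a : relG R a -> DG a.1 by move=> Ra; apply/DGr; exists a.2.
have r1 : relk R 1 by have /Dkr[y Ry] := D1; move: (Ry); rewrite (relk1 Ry).
have rB a b : relk R a -> relk R b -> relk R (a - b).
  move=> Ra Rb; have /Dkr[y Ry] := DB _ _ (dk _ Ra) (dk _ Rb).
  by move: (Ry); rewrite (relkB Ra Rb Ry).
have rM a b : relk R a -> relk R b -> relk R (a * b).
  move=> Ra Rb; have /Dkr[y Ry] := DM _ _ (dk _ Ra) (dk _ Rb).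
  by move: (Ry); rewrite (relkM Ra Rb Ry).
have r0 : relk R 0 by rewrite -(subrr 1); apply: rB.
have eq0 a : relk R a -> a.1 = 0 <-> a.2 = 0.
  move=> Ra; split=> E; first by move: Ra; rewrite /relk E => /relk0.
  have := eR (FEq (v1 KField)
    (tren (fun s v => VS _ v) (@tapp0 KZero erefl))) (rel_env1 Ra).
  by rewrite /= => -[_]; apply.
split=> //.
(* Inversion is not in the language. The partner of [a.1^-1] is found from the product with [a.1]
   being 1, zero apart. *)
- move=> a Ra; have /Dkr[y Ry] := DV _ (dk _ Ra); rewrite /relk /kinv /=.
  have [a0|a0] := eqVneq a.1 0.
    move: Ry; rewrite a0 invr0 => /[dup] /relk0 -> .
    by have /(eq0 _ Ra) -> := a0; rewrite invr0.
  have : relk R (a.1 * a.1^-1, a.2 * y) by apply: (rM a (a.1^-1, y)).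
  rewrite divff // => /relk1 E.
  have a20 : a.2 != 0 by apply: contra_eq_neq E => ->; rewrite mul0r eq_sym oner_eq0.
  by rewrite -[a.2^-1]mulr1 -E mulrA mulVf ?mul1r.
- move=> a Ra; have /Dkr[y Ry] := Dd _ (dk _ Ra).
  by move: (Ry); rewrite (relkder Ra Ry).
- by have /DGr[y Ry] := DG0; move: (Ry); rewrite (relg0 Ry).
- move=> a b Ra Rb; have /DGr[y Ry] := DGB _ _ (dg _ Ra) (dg _ Rb).
  by move: (Ry); rewrite (relgB Ra Rb Ry).
- by move=> g h Rg Rh; apply: relg_le.
- move=> g Rg; have /Dkr[y Ry] := Dc _ (dg _ Rg).
  by move: (Ry); rewrite (relc Rg Ry).
Qed.

End FromElementary.
End Pairs.
(** * Good subrings of a product of two Hahn cores *)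

Section Good.
Variables (k1 k2 : diffFieldType) (G1 G2 : orderedAbGroupType).
Variables (c1 : {additive G1 -> k1}) (c2 : {additive G2 -> k2}).
Variables (A : hcore c1) (B : hcore c2).
Local Notation W := (hring A * hring B)%type.
Implicit Types (w : W) (a : k1 * k2) (g : G1 * G2).

Definition pD w : W := (hD w.1, hD w.2).
Definition pmono a g : W := (mono A a.1 g.1, mono B a.2 g.2).

Lemma pair_eq (S T : Type) (x y : S * T) : x.1 = y.1 -> x.2 = y.2 -> x = y.
Proof. by case: x y => [x1 x2] [y1 y2] /= -> ->. Qed.

Lemma pDD w w' : pD (w + w') = pD w + pD w'.
Proof. by apply: pair_eq; apply: hDD. Qed.

Lemma pDM w w' : pD (w * w') = pD w * w' + w * pD w'.
Proof. by apply: pair_eq; apply: hDM. Qed.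

Lemma pD0 : pD 0 = 0.
Proof. by apply: pair_eq; apply: hD0. Qed.

Lemma pmonoM a g b h : pmono a g * pmono b h = pmono (a * b) (g + h).
Proof. by apply: pair_eq; apply: monoM. Qed.

Lemma pmonoD a b g : pmono (a + b) g = pmono a g + pmono b g.
Proof. by apply: pair_eq; apply: monoD. Qed.

Lemma pmono0 g : pmono 0 g = 0.
Proof. by apply: pair_eq; apply: mono0. Qed.

Lemma pmonoN a g : pmono (- a) g = - pmono a g.
Proof. by apply: (addrI (pmono a g)); rewrite -pmonoD !subrr pmono0. Qed.

Lemma pmono1 : pmono 1 0 = 1.
Proof. by apply: pair_eq; apply: mono1. Qed.

Lemma pmono_sum (I : Type) (s : seq I) (P : pred I) (F : I -> k1 * k2) g :
  pmono (\sum_(i <- s | P i) F i) g = \sum_(i <- s | P i) pmono (F i) g.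
Proof.
by apply: (big_morph (pmono^~ g)) => [a b|]; [apply: pmonoD | apply: pmono0].
Qed.

Lemma pD_mono a g : pD (pmono a g) = pmono (kder a + kc c1 c2 g * a) g.
Proof. by apply: pair_eq; apply: hD_mono. Qed.

Definition ring_closed (T : W -> Prop) := [/\ T 1,
  forall x y, T x -> T y -> T (x - y), forall x y, T x -> T y -> T (x * y) &
  forall x, T x -> T (pD x)].

Section RingClosed.
Variable T : W -> Prop.
Hypothesis cT : ring_closed T.

Lemma closed1 : T 1. Proof. by case: cT. Qed.

Lemma closedB x y : T x -> T y -> T (x - y).
Proof. by case: cT => _ + _ _; apply. Qed.

Lemma closedM x y : T x -> T y -> T (x * y).
Proof. by case: cT => _ _ + _; apply. Qed.

Lemma closed_D x : T x -> T (pD x).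
Proof. by case: cT => _ _ _; apply. Qed.

Lemma closed0 : T 0.
Proof. by rewrite -(subrr 1); apply: closedB; apply: closed1. Qed.

Lemma closedN x : T x -> T (- x).
Proof. by move=> Tx; rewrite -sub0r; apply: closedB => //; apply: closed0. Qed.

Lemma closedD x y : T x -> T y -> T (x + y).
Proof. by move=> Tx Ty; rewrite -(opprK y); apply: closedB => //; apply: closedN. Qed.

Lemma closed_sum (I : Type) (s : seq I) (P : pred I) (F : I -> W) :
  (forall i, P i -> T (F i)) -> T (\sum_(i <- s | P i) F i).
Proof. by apply: (big_ind T) => [|x y]; [apply: closed0 | apply: closedD]. Qed.

Lemma closed_iterD x i : T x -> T (iter i pD x).
Proof. by move=> Tx; elim: i => //= i; apply: closed_D. Qed.

End RingClosed.

Definition lead_match (Rk : k1 * k2 -> Prop) (RG : G1 * G2 -> Prop) w :=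
  (w.1 = 0 /\ w.2 = 0) \/
  exists a g, [/\ Rk a, RG g, lead w.1 a.1 g.1 & lead w.2 a.2 g.2].

Definition good Rk RG (Phi : W -> Prop) := [/\ ring_closed Phi,
  forall a g, Rk a -> RG g -> Phi (pmono a g) &
  forall w, Phi w -> lead_match Rk RG w].

Section Match.
Variables (Rk : k1 * k2 -> Prop) (RG : G1 * G2 -> Prop).
Hypothesis RR : partial_iso c1 c2 Rk RG.
Local Notation match_ := (lead_match Rk RG).

Lemma pi0 : Rk 0.
Proof. by rewrite -(subrr 1); apply: (piB RR); apply: (pi1 RR). Qed.

Lemma piN a : Rk a -> Rk (- a).
Proof. by move=> Ra; rewrite -sub0r; apply: (piB RR) => //; apply: pi0. Qed.

Lemma piD a b : Rk a -> Rk b -> Rk (a + b).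
Proof. by move=> Ra Rb; rewrite -(opprK b); apply: (piB RR) => //; apply: piN. Qed.

Lemma pi_sum (I : Type) (s : seq I) (P : pred I) (F : I -> k1 * k2) :
  (forall i, P i -> Rk (F i)) -> Rk (\sum_(i <- s | P i) F i).
Proof. by apply: (big_ind Rk) => [|x y]; [apply: pi0 | apply: piD]. Qed.

Lemma pgN g : RG g -> RG (- g).
Proof. by move=> Rg; rewrite -sub0r; apply: (pgB RR) => //; apply: (pg0 RR). Qed.

Lemma pgD g h : RG g -> RG h -> RG (g + h).
Proof. by move=> Rg Rh; rewrite -(opprK h); apply: (pgB RR) => //; apply: pgN. Qed.

Lemma pgMn g n : RG g -> RG (g *+ n).
Proof.
move=> Rg; elim: n => [|n IHn]; first by rewrite mulr0n; apply: (pg0 RR).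
by rewrite mulrS; apply: pgD.
Qed.

Lemma pg_lt g h : RG g -> RG h -> (g.1 < h.1) = (g.2 < h.2).
Proof. by move=> Rg Rh; rewrite !oag_ltNge (pg_le RR Rh Rg). Qed.

Lemma pg_inj g h : RG g -> RG h -> g.1 = h.1 -> g = h.
Proof.
move=> Rg Rh E; apply: pair_eq => //; apply: le_anti.
by rewrite -(pg_le RR Rg Rh) -(pg_le RR Rh Rg) E lexx.
Qed.

Lemma pg_eq g h : RG g -> RG h -> (g.1 == h.1) = (g.2 == h.2).
Proof.
move=> Rg Rh; apply/eqP/eqP => E; first by rewrite (pg_inj Rg Rh E).
apply: le_anti.
by rewrite (pg_le RR Rg Rh) (pg_le RR Rh Rg) E lexx.
Qed.

Lemma pi_neq0 a : Rk a -> (a.1 != 0) = (a.2 != 0).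
Proof. by move=> Ra; congr (~~ _); apply/eqP/eqP => /(pi_eq0 RR Ra). Qed.

Lemma match_eq0 w : match_ w -> w.1 = 0 <-> w.2 = 0.
Proof.
case=> [[-> ->] //|[a [g [_ _ /lead_neq0/eqP w1 /lead_neq0/eqP w2]]]].
by split.
Qed.

Lemma match0 : match_ 0. Proof. by left. Qed.

Lemma match_vge w g : match_ w -> RG g -> vge w.1 g.1 <-> vge w.2 g.2.
Proof.
case=> [[-> ->] _|[a [h [_ Rh w1 w2]]] Rg]; first by split=> _; apply: vge0.
by rewrite (lead_vge _ w1) (lead_vge _ w2) (pg_le RR Rg Rh).
Qed.

Lemma match_vgt w g : match_ w -> RG g -> vgt w.1 g.1 <-> vgt w.2 g.2.
Proof.
case=> [[-> ->] _|[a [h [_ Rh w1 w2]]] Rg]; first by split=> _; apply: vgt0.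
by rewrite (lead_vgt _ w1) (lead_vgt _ w2) pg_lt.
Qed.

Lemma match_lead w x y : match_ w -> lead w.1 x y -> exists x' y',
  [/\ Rk (x, x'), RG (y, y') & lead w.2 x' y'].
Proof.
case=> [[-> _] /lead_neq0/eqP //|[b [h [Rb Rh w1 w2]]] w1'].
by have [-> ->] := lead_inj w1' w1; exists b.2, h.2; rewrite -!surjective_pairing.
Qed.

(** The leading term of [w] is the quotient of those of [s * w] and [s]. This cancellation does the
    work of inverses, which the rings do not carry. *)
Lemma matchMI s w : match_ (s * w) -> match_ s -> s.1 != 0 -> match_ w.
Proof.
move=> msw ms s1; have s2 : s.2 <> 0 by move=> /(match_eq0 ms)/eqP; rewrite (negPf s1).
have [w1|w1] := eqVneq w.1 0.
  left; split=> //; have /(match_eq0 msw) /= : (s * w).1 = 0 by rewrite /= w1 mulr0.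
  by case/core_mulf_eq0.
have [b [h wb]] := lead_ex w1.
case: ms => [[/eqP]|[a [g [Ra Rg sa1 sa2]]]]; first by rewrite (negPf s1).
have [b' [h' [Rb Rh swb2]]] := match_lead msw (leadM sa1 wb).
right; exists ((a.1 * b, b') * kinv a), ((g.1 + h, h') - g); split.
- exact/(piM RR)/(piV RR).
- exact: (pgB RR).
- have a0 : a.1 != 0 by case: sa1.
  by rewrite /= mulrAC divff // mul1r addrAC subrr add0r.
have w2 : w.2 != 0.
  by apply: contra_neq w1 => w2; have := lead_neq0 swb2; rewrite /= w2 mulr0 eqxx.
have [b2 [h2 wb2]] := lead_ex w2.
have [/= -> ->] := lead_inj swb2 (leadM sa2 wb2).
have a0 : a.2 != 0 by case: sa2.
by rewrite /= mulrAC divff // mul1r addrAC subrr add0r.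
Qed.

End Match.
End Good.

(** * Closing a good subring under new monomials *)

Section LeadSum.
Variables (k : diffFieldType) (G : orderedAbGroupType) (c : {additive G -> k}).
Variable K : hcore c.

Lemma lead_sum (I : finType) (S : {set I}) (e : I -> K) (a : I -> k) (g : I -> G)
    (al : I -> k) (de : I -> G) (mu : G) :
  (forall i, i \in S -> lead (e i) (al i) (de i)) ->
  (forall i, i \in S -> mu <= de i + g i) ->
  \sum_(i in S | de i + g i == mu) al i * a i != 0 ->
  lead (\sum_(i in S) e i * mono K (a i) (g i))
    (\sum_(i in S | de i + g i == mu) al i * a i) mu.
Proof.
move=> le lemu s0.
have vS i : i \in S -> vge (e i * mono K (a i) (g i)) (de i + g i).
  by move=> iS; apply: vgeM; [case: (le i iS) | apply: vge_mono].
split=> //.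
  by apply: vge_sum => i iS; apply: vge_le (vS i iS); apply: lemu.
rewrite coef_sum [RHS]big_mkcondr /=; apply: eq_bigr => i iS.
case: eqP => [<-|/eqP ne].
  have [ei <- _] := le i iS.
  by rewrite (coefM ei (@vge_mono _ _ _ K (a i) (g i))).2 coef_mono eqxx.
by apply: (vS i iS); rewrite lt_neqAle eq_sym ne lemu.
Qed.

End LeadSum.

Section AdjoinMonomials.
Variables (k1 k2 : diffFieldType) (G1 G2 : orderedAbGroupType).
Variables (c1 : {additive G1 -> k1}) (c2 : {additive G2 -> k2}).
Variables (A : hcore c1) (B : hcore c2).
Local Notation W := (hring A * hring B)%type.
Variables (Rk0 Rk : k1 * k2 -> Prop) (RG0 RG : G1 * G2 -> Prop).
Hypotheses (RR0 : partial_iso c1 c2 Rk0 RG0) (RR : partial_iso c1 c2 Rk RG).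
Hypotheses (Rk0S : forall a, Rk0 a -> Rk a) (RG0S : forall g, RG0 g -> RG g).
Variable Phi : W -> Prop.
Hypothesis gPhi : good Rk0 RG0 Phi.

Let cPhi : ring_closed Phi. Proof. by case: gPhi. Qed.

(* If the leading coefficients of the dominant terms cancel, then one of these
   terms is eliminated in favour of the others, with coefficients in Phi. *)
Lemma match_mono_sum (I : finType) (S : {set I}) (e : I -> W) (a : I -> k1 * k2)
    (g : I -> G1 * G2) :
  (forall i, Phi (e i)) -> (forall i, Rk (a i)) -> (forall i, RG (g i)) ->
  lead_match Rk RG (\sum_(i in S) e i * pmono A B (a i) (g i)).
Proof.
move=> Pe Ra Rg; move: {2}(#|S|) (leqnn #|S|) => n.
elim: n S e Pe => [|n IHn] S e Pe Sn.
  by rewrite leqn0 cards_eq0 in Sn; rewrite (eqP Sn) big_set0; apply: match0.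
have drop j : j \in S -> (#|S :\ j| <= n)%N.
  by move=> jS; move: Sn; rewrite (cardsD1 j) jS.
have [[i iS i0]|nz] := pselect (exists2 i, i \in S & (e i).1 = 0 \/ (a i).1 = 0).
  rewrite (big_setD1 i) //=.
  have -> : e i * pmono A B (a i) (g i) = 0; last by rewrite add0r; apply/IHn/drop.
  case: i0 => [e0|a0].
    have /(match_eq0 (w := e i)) E : lead_match Rk0 RG0 (e i) by case: gPhi => _ _; apply.
    have -> : e i = 0 by apply: pair_eq => //; apply/E.
    by rewrite mul0r.
  have -> : a i = 0.
    by apply: pair_eq => //; apply/(pi_eq0 RR (Ra i)).
  by rewrite pmono0 mulr0.
have [->|/set0Pn[i0 i0S]] := eqVneq S finset.set0; first by rewrite big_set0; apply: match0.
have /choice[ld ldP] : forall i, exists p : (k1 * k2) * (G1 * G2), i \in S ->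
    [/\ Rk0 p.1, RG0 p.2, lead (e i).1 p.1.1 p.2.1 & lead (e i).2 p.1.2 p.2.2].
  move=> i; have [iS|] := boolP (i \in S); last by exists (0, 0).
  have : lead_match Rk0 RG0 (e i) by case: gPhi => _ _; apply.
  case=> [[e0 _]|[al [de ?]]]; last by exists (al, de).
  by case: nz; exists i => //; left.
pose al i := (ld i).1; pose de i := (ld i).2.
have i0S' : i0 \in enum S by rewrite mem_enum.
have [j jS jmin] := oag_min (fun i => (de i).1 + (g i).1) i0S'.
rewrite mem_enum in jS.
pose mu := de j + g j.
have Rmu i : i \in S -> RG (de i + g i).
  by move=> /ldP[_ /RG0S Rd _ _]; apply: pgD RR _ _ Rd (Rg i).
have le1 i : i \in S -> mu.1 <= (de i).1 + (g i).1 by rewrite -mem_enum; apply: jmin.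
have le2 i : i \in S -> mu.2 <= (de i).2 + (g i).2.
  by move=> iS; have := le1 i iS; rewrite (pg_le RR (Rmu _ jS) (Rmu _ iS)).
have eqJ i : i \in S -> ((de i).1 + (g i).1 == mu.1) = ((de i).2 + (g i).2 == mu.2).
  by move=> iS; rewrite (pg_eq RR (Rmu _ iS) (Rmu _ jS)).
pose J i := (i \in S) && ((de i).1 + (g i).1 == mu.1).
pose s := \sum_(i | J i) al i * a i.
have Rs : Rk s.
  apply: (pi_sum RR) => i /andP[iS _]; apply: (piM RR) => //.
  by apply: Rk0S; case: (ldP i iS).
have s1E : s.1 = \sum_(i in S | (de i).1 + (g i).1 == mu.1) (al i).1 * (a i).1.
  by rewrite /s raddf_sum.
have s2E : s.2 = \sum_(i in S | (de i).2 + (g i).2 == mu.2) (al i).2 * (a i).2.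
  rewrite /s raddf_sum; apply: eq_bigl => i; rewrite /J.
  by case: (boolP (i \in S)) => //= iS; apply: eqJ.
have [s0|s0] := eqVneq s.1 0; last first.
  right; exists s, mu; split=> //; first exact: Rmu.
    rewrite raddf_sum s1E; apply: lead_sum => //; last by rewrite -s1E.
    by move=> i /ldP[].
  rewrite raddf_sum s2E; apply: lead_sum => //; last by rewrite -s2E -(pi_neq0 RR Rs).
  by move=> i /ldP[].
have {s0 s1E s2E}s0 : s = 0 by apply: pair_eq => //; apply/(pi_eq0 RR Rs).
have Jj : J j by rewrite /J jS eqxx.
have alK i : i \in S -> al i * kinv (al i) = 1.
  move=> /ldP[_ _ [_ _ l1] [_ _ l2]]; apply: pair_eq; exact: divff.
pose r i := al i * kinv (al j).
have Rr i : i \in S -> Rk0 (r i).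
  move=> iS; apply: (piM RR0); first by case: (ldP i iS).
  by apply: (piV RR0); case: (ldP j jS).
have rE i : kinv (al j) * (al i * a i) = r i * a i.
  by rewrite /r mulrA [kinv _ * _]mulrC.
have aj : a j = - \sum_(i | J i && (i != j)) r i * a i.
  apply/eqP; rewrite -addr_eq0; apply/eqP.
  transitivity (kinv (al j) * s); last by rewrite s0 mulr0.
  rewrite /s (bigD1 j Jj) mulrDr mulrA [kinv _ * al j]mulrC alK // mul1r.
  congr (_ + _); rewrite big_distrr; apply: eq_bigr => i _.
  exact/esym/rE.
have gij i : J i -> g j = (de i - de j) + g i.
  move=> /andP[iS /eqP E].
  have {}E : de i + g i = de j + g j.
    by apply: (pg_inj RR (Rmu _ iS) (Rmu _ jS)).
  by rewrite addrAC E addrAC subrr add0r.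
(* The monomial with coefficient [r i] and exponent [de i - de j] lies in [Phi], as a quotient of
   leading terms of elements of [Phi]. Hence the new coefficients [e' i] stay in [Phi] while the
   term at [j] disappears. *)
pose e' i := if J i then e i - e j * pmono A B (r i) (de i - de j) else e i.
have Pe' i : Phi (e' i).
  rewrite /e'; case: ifP => // /andP[iS _]; apply: (closedB cPhi) => //.
  apply: (closedM cPhi) => //; case: gPhi => _ + _; apply; first exact: Rr.
  by apply: (pgB RR0); [case: (ldP i iS) | case: (ldP j jS)].
suff -> : \sum_(i in S) e i * pmono A B (a i) (g i) =
    \sum_(i in S :\ j) e' i * pmono A B (a i) (g i) by apply/IHn/drop.
rewrite (big_setD1 j) //= addrC; apply/eqP; rewrite -subr_eq0 addrAC -sumrB.
have -> : \sum_(i in S :\ j) (e i * pmono A B (a i) (g i) -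
    e' i * pmono A B (a i) (g i)) =
    \sum_(i | J i && (i != j)) e j * pmono A B (r i * a i) (g j).
  rewrite [LHS]big_mkcond [RHS]big_mkcond; apply: eq_bigr => i _.
  rewrite !inE /e'; case: (boolP (J i)) => [Ji|nJ]; last by rewrite /= subrr if_same.
    have /andP[iS _] := Ji; rewrite iS andbT /=.
    case: ifP => // _; rewrite mulrBl opprB addrC subrK.
    by rewrite -mulrA pmonoM -gij.
rewrite -big_distrr -mulrDr -pmono_sum -pmonoD [X in pmono A B X _](_ : _ = 0).
  by rewrite pmono0 mulr0.
by rewrite aj subrr.
Qed.

Definition mono_sums (w : W) := exists (I : finType) (e : I -> W)
    (a : I -> k1 * k2) (g : I -> G1 * G2),
  [/\ forall i, Phi (e i), forall i, Rk (a i), forall i, RG (g i) &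
  w = \sum_i e i * pmono A B (a i) (g i)].

Lemma mono_sums_min (T : W -> Prop) : ring_closed T -> (forall w, Phi w -> T w) ->
  (forall a g, Rk a -> RG g -> T (pmono A B a g)) -> forall w, mono_sums w -> T w.
Proof.
move=> cT PT mT w [I [e [a [g [Pe Ra Rg ->]]]]].
by apply: (closed_sum cT) => i _; apply: (closedM cT); [apply: PT | apply: mT].
Qed.

Lemma mono_sums_one e a g : Phi e -> Rk a -> RG g -> mono_sums (e * pmono A B a g).
Proof.
move=> Pe Ra Rg; exists unit, (fun=> e), (fun=> a), (fun=> g); split=> //.
by rewrite big_const cardT enumT unlock /= addr0.
Qed.

Lemma mono_sumsB x y : mono_sums x -> mono_sums y -> mono_sums (x - y).
Proof.
move=> [I [e [a [g [Pe Ra Rg ->]]]]] [I' [e' [a' [g' [Pe' Ra' Rg' ->]]]]].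
exists (I + I')%type, (fun i => match i with inl i => e i | inr i => - e' i end).
exists (fun i => match i with inl i => a i | inr i => a' i end).
exists (fun i => match i with inl i => g i | inr i => g' i end).
split=> [[i|i]|[i|i]|[i|i]|] //; first exact: closedN.
by rewrite big_sumType /= -sumrN; congr (_ + _); apply: eq_bigr => i _; rewrite mulNr.
Qed.

Lemma mono_sumsD x y : mono_sums x -> mono_sums y -> mono_sums (x + y).
Proof.
move=> sx sy; rewrite -(opprK y); apply: mono_sumsB => //.
rewrite -sub0r; apply: mono_sumsB => //.
rewrite -(mul0r (pmono A B 1 0)); apply: mono_sums_one.
- exact: closed0.
- exact: (pi1 RR).
- exact: (pg0 RR).
Qed.

(** A derivative of a monomial is a monomial of the same exponent, so finite sums already form a
    differential ring; [pgc] provides the twisting coefficient. *)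
Lemma good_mono_sums : good Rk RG mono_sums.
Proof.
have one : mono_sums 1.
  rewrite -(mul1r 1) -[X in _ * X]pmono1; apply: mono_sums_one.
  - exact: closed1.
  - exact: (pi1 RR).
  - exact: (pg0 RR).
split; last 1 first.
- move=> w [I [e [a [g [Pe Ra Rg ->]]]]].
  have := @match_mono_sum I [set: I] e a g Pe Ra Rg.
  by rewrite (eq_bigl xpredT) // => i; rewrite inE.
- split=> //; first exact: mono_sumsB.
  + move=> x y [I [e [a [g [Pe Ra Rg ->]]]]] [I' [e' [a' [g' [Pe' Ra' Rg' ->]]]]].
    exists (I * I')%type, (fun i => e i.1 * e' i.2), (fun i => a i.1 * a' i.2).
    exists (fun i => g i.1 + g' i.2); split.
    * by move=> i; apply: closedM.
    * by move=> i; apply: (piM RR).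
    * by move=> i; apply: (pgD RR).
    rewrite big_distrlr pair_big; apply: eq_bigr => i _.
    by rewrite -pmonoM mulrACA.
  + move=> x [I [e [a [g [Pe Ra Rg ->]]]]].
    have -> : pD (\sum_i e i * pmono A B (a i) (g i)) =
        \sum_i pD (e i * pmono A B (a i) (g i)).
      exact: (big_morph _ (@pDD _ _ _ _ _ _ A B) (@pD0 _ _ _ _ _ _ A B)).
    rewrite (eq_bigr (fun i => pD (e i) * pmono A B (a i) (g i) +
      e i * pmono A B (kder (a i) + kc c1 c2 (g i) * a i) (g i))); last first.
      by move=> i _; rewrite pDM pD_mono.
    rewrite big_split; apply: mono_sumsD.
      by exists I, (fun i => pD (e i)), a, g; split=> // i; apply: closed_D.
    exists I, e, (fun i => kder (a i) + kc c1 c2 (g i) * a i), g; split=> // i.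
    apply: (piD RR); first exact: (piDer RR).
    by apply: (piM RR) => //; apply: (pgc RR).
- move=> a g Ra Rg; rewrite -(mul1r (pmono A B a g)); apply: mono_sums_one => //.
  exact: closed1.
Qed.

Lemma mono_sums_sub w : Phi w -> mono_sums w.
Proof.
move=> Pw; rewrite -(mulr1 w) -[X in _ * X]pmono1; apply: mono_sums_one => //.
- exact: (pi1 RR).
- exact: (pg0 RR).
Qed.

End AdjoinMonomials.
(** * Stable polynomials *)

Section Stable.
Variables (k : diffFieldType) (G : orderedAbGroupType) (c : {additive G -> k}).
Variables (K : hcore c) (n : nat).
Implicit Types (p : {mpoly K[n]}) (g y : G) (h : 'I_n -> K).

Definition nonconst p := p - (p@_0)%:MP.

Lemma GT_nonconst g y p : GT g y (nonconst p) <->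
  forall m, m != 0%MM -> vgt p@_m (y - g *+ mdeg m).
Proof.
split=> [pg m m0|pg m].
  by have := pg m; rewrite mcoeffB mcoeffC (negPf m0) mulr0 subr0.
rewrite mcoeffB mcoeffC; have [->|m0] := eqVneq m 0%MM.
  by rewrite mulr1 subrr; apply: vgt0.
by rewrite mulr0 subr0; apply: pg.
Qed.

Lemma GT_nonconst_meval g y p h : GT g y (nonconst p) ->
  (forall i, vge (h i) g) -> vgt (p.@[h] - p@_0) y.
Proof. by move=> pg hg; have := GT_meval hg pg; rewrite mevalB mevalC. Qed.

Lemma GT_nonconst_shift g y p h : GT g y (nonconst p) ->
  (forall i, vge (h i) g) -> GT g y (nonconst (shift h p)).
Proof.
move=> pg hg; apply/GT_nonconst => m m0.
have sg := GT_shift hg pg; have := sg m; rewrite shiftB shiftC mcoeffB mcoeffC (negPf m0).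
by rewrite mulr0 subr0.
Qed.

Lemma GT_nonconst_raise g d y p : g <= d -> GT g y (nonconst p) -> GT d y (nonconst p).
Proof.
move=> gd pg m; apply: vgt_le (pg m).
by rewrite oag_leD2lE oag_leN2 oag_leMn.
Qed.

Lemma lead_meval_nonconst (a : k) g y p h : lead p@_0 a y -> GT g y (nonconst p) ->
  (forall i, vge (h i) g) -> lead p.@[h] a y.
Proof.
move=> pa pg hg; rewrite -(subrK p@_0 p.@[h]) addrC.
by apply: leadD => //; apply: GT_nonconst_meval pg hg.
Qed.

End Stable.

(** * Adjoining an element to a good subring *)

Section Adjoin.
Variables (k1 k2 : diffFieldType) (G1 G2 : orderedAbGroupType).
Variables (c1 : {additive G1 -> k1}) (c2 : {additive G2 -> k2}).
Variables (A : hcore c1) (B : hcore c2).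
Local Notation W := (hring A * hring B)%type.
Implicit Types (w z : W) (a : k1 * k2) (g : G1 * G2).

Definition p1 n (p : {mpoly W[n]}) : {mpoly A[n]} := map_mpoly (@fst A B) p.
Definition p2 n (p : {mpoly W[n]}) : {mpoly B[n]} := map_mpoly (@snd A B) p.
Definition pjet n z : 'I_n -> W := fun i => iter i (@pD _ _ _ _ _ _ A B) z.

Lemma pjet1 n z (i : 'I_n) : (pjet z i).1 = jet z.1 i.
Proof. by rewrite /pjet /jet; elim: (i : nat) => //= j ->. Qed.

Lemma pjet2 n z (i : 'I_n) : (pjet z i).2 = jet z.2 i.
Proof. by rewrite /pjet /jet; elim: (i : nat) => //= j ->. Qed.

Lemma meval_p1 n (p : {mpoly W[n]}) z : (p.@[pjet z]).1 = (p1 p).@[jet z.1].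
Proof.
rewrite -[LHS](meval_map_mpoly (@fst A B)); apply: meval_eq => i; exact: pjet1.
Qed.

Lemma meval_p2 n (p : {mpoly W[n]}) z : (p.@[pjet z]).2 = (p2 p).@[jet z.2].
Proof.
rewrite -[LHS](meval_map_mpoly (@snd A B)); apply: meval_eq => i; exact: pjet2.
Qed.

Lemma shift_ext (R : comNzRingType) n (h h' : 'I_n -> R) (p : {mpoly R[n]}) :
  h =1 h' -> shift h p = shift h' p.
Proof. by move=> /funext ->. Qed.

Lemma shift_p1 n (p : {mpoly W[n]}) z : p1 (shift (pjet z) p) = shift (jet z.1) (p1 p).
Proof. by rewrite /p1 map_mpoly_shift; apply: shift_ext => i; apply: pjet1. Qed.

Lemma shift_p2 n (p : {mpoly W[n]}) z : p2 (shift (pjet z) p) = shift (jet z.2) (p2 p).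
Proof. by rewrite /p2 map_mpoly_shift; apply: shift_ext => i; apply: pjet2. Qed.

Lemma shift_jetB (k : diffFieldType) (G : orderedAbGroupType) (c : {additive G -> k})
    (K : hcore c) n (p : {mpoly K[n]}) (u v : K) :
  shift (jet (v - u)) (shift (jet u) p) = shift (jet v) p.
Proof.
by rewrite shift_shift; apply: shift_ext => i; rewrite -jetD subrK.
Qed.

Lemma mcoeff_p1 n (p : {mpoly W[n]}) m : (p1 p)@_m = (p@_m).1.
Proof. exact: mcoeff_map_mpoly. Qed.

Lemma mcoeff_p2 n (p : {mpoly W[n]}) m : (p2 p)@_m = (p@_m).2.
Proof. exact: mcoeff_map_mpoly. Qed.

Lemma ring_closed_subring (T : W -> Prop) : ring_closed T -> subring T.
Proof. by case=> T1 TB TM _; split. Qed.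

Lemma closed_pjet (T : W -> Prop) n z (i : 'I_n) : ring_closed T -> T z -> T (pjet z i).
Proof. by move=> cT Tz; apply: closed_iterD. Qed.

Variables (Rk : k1 * k2 -> Prop) (RG : G1 * G2 -> Prop).
Hypothesis RR : partial_iso c1 c2 Rk RG.
Variable Phi : W -> Prop.
Hypothesis gPhi : good Rk RG Phi.
Local Notation match_ := (lead_match Rk RG).

Let cPhi : ring_closed Phi. Proof. by case: gPhi. Qed.
Let sPhi : subring Phi. Proof. exact: ring_closed_subring cPhi. Qed.
Let mPhi w : Phi w -> match_ w. Proof. by case: gPhi => _ _; apply. Qed.

Variable x : A.

Definition near w g := [/\ Phi w, RG g & vge (x - w.1) g.1].

Definition stable_at n g (p : {mpoly W[n]}) := exists al mu,
  lead (p1 p).@[jet x] al mu /\ GT g.1 mu (nonconst (shift (jet x) (p1 p))).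

(* [p] is stable if its leading term is constant on a ball that contains [x] and
   has its centre in Phi. *)
Definition stable n (p : {mpoly W[n]}) := exists w g, near w g /\ stable_at g p.

Lemma near_shift n w g (p : {mpoly W[n]}) : near w g ->
  p1 (shift (pjet w) p) = shift (jet (w.1 - x)) (shift (jet x) (p1 p)) /\
  forall i : 'I_n, vge (jet (w.1 - x) i) g.1.
Proof.
case=> _ _ xw; rewrite shift_p1 shift_jetB; split=> // i; apply: vge_jet.
by rewrite -opprB; apply: vgeN.
Qed.

(** Stability is expressed at [x], which has no partner in [B]. Translated to the centre [w] it
    concerns coefficients in [Phi], whose leading terms match, and so it carries over to the ball
    around [w.2]. *)
Lemma stable_match n w g (p : {mpoly W[n]}) z : over Phi p -> near w g ->
  stable_at g p -> vge (z.1 - x) g.1 -> vge (z.2 - w.2) g.2 ->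
  exists a mu, [/\ Rk a, RG mu, lead (p1 p).@[jet x] a.1 mu.1,
    lead (p.@[pjet z]).1 a.1 mu.1 & lead (p.@[pjet z]).2 a.2 mu.2].
Proof.
move=> op nw [al [mu [pl pg]]] z1 z2; have [Pw Rg _] := nw.
have [qE hg] := near_shift p nw.
set q := shift (pjet w) p in qE.
have oq : over Phi q.
  by apply: (over_shift sPhi) op => i; apply: closed_pjet.
have fl : lead (shift (jet x) (p1 p))@_0 al mu by rewrite mcoeff0_shift.
have ql : lead (p1 q)@_0 al mu.
  by rewrite qE mcoeff0_shift; apply: lead_meval_nonconst fl pg hg.
have qg : GT g.1 mu (nonconst (p1 q)) by rewrite qE; apply: GT_nonconst_shift.
have [al' [mu' [Ral Rmu ql2]]] : exists al' mu',
    [/\ Rk (al, al'), RG (mu, mu') & lead (q@_0).2 al' mu'].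
  by apply: match_lead (mPhi (oq 0%MM)) _; rewrite -mcoeff_p1.
have qg2 : GT g.2 mu' (nonconst (p2 q)).
  apply/GT_nonconst => m m0; have /GT_nonconst/(_ m m0) := qg.
  rewrite mcoeff_p1 mcoeff_p2.
  have Rm : RG ((mu, mu') - g *+ mdeg m) by apply: (pgB RR) => //; apply: (pgMn RR).
  by have := match_vgt RR (mPhi (oq m)) Rm; rewrite /= !raddfMn => -[].
exists (al, al'), (mu, mu'); split=> //=.
- rewrite meval_p1 -[z.1](subrK x) -meval_shift_jet.
  by apply: lead_meval_nonconst fl pg _ => i; apply: vge_jet.
- rewrite meval_p2 -[z.2](subrK w.2) -meval_shift_jet -shift_p2.
  apply: (@lead_meval_nonconst _ _ _ _ _ _ g.2); rewrite ?mcoeff_p2 //.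
  by move=> i; apply: vge_jet.
Qed.

(** The translate at [w] has its coefficients in [Phi], and every clause compares their valuations
    with exponents related by [RG]. Nonvanishing at [b] is read as failure of the strict bound. *)
Lemma hconf_transfer n w (p : {mpoly W[n]}) (b g : G1 * G2) : over Phi p ->
  Phi w -> RG b -> RG g -> hconf (shift (jet w.1) (p1 p)) b.1 g.1 ->
  hconf (shift (jet w.2) (p2 p)) b.2 g.2.
Proof.
move=> op Pw Rb Rg; rewrite -shift_p1 -shift_p2; set q := shift (pjet w) p.
have oq : over Phi q.
  by apply: (over_shift sPhi) op => i; apply: closed_pjet.
have mq m : match_ q@_m by apply: mPhi.
case=> q0 q1 [i qi] q2; split.
- have Rbg : RG (b + g) by apply: (pgD RR).
  by have := q0; rewrite mcoeff_p1 mcoeff_p2; have [+ _] := match_vge RR (mq 0%MM) Rbg.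
- by move=> j; have := q1 j; rewrite mcoeff_p1 mcoeff_p2 => /(match_vge RR (mq _) Rb).
- exists i; apply/eqP => E; move/eqP: qi; apply.
  have := q1 i; rewrite mcoeff_p1 => v1.
  have : vgt (q@_U_(i)).2 b.2.
    by apply/vgtE; split; [apply/(match_vge RR (mq _) Rb) | rewrite -mcoeff_p2].
  by move/(match_vgt RR (mq _) Rb) => /vgtE[].
- move=> m m1; have Rm : RG (b + g - g *+ mdeg m).
    by apply: (pgB RR); [apply: (pgD RR) | apply: (pgMn RR)].
  have := q2 m m1; rewrite mcoeff_p1 mcoeff_p2.
  by have := match_vgt RR (mq m) Rm; rewrite /= !raddfMn => -[].
Qed.

End Adjoin.
Lemma ex_min_nat (P : nat -> Prop) : (exists n, P n) ->
  exists n, P n /\ forall m, (m < n)%N -> ~ P m.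
Proof.
move=> [n Pn]; have ex : exists n, `[< P n >] by exists n; apply/asboolP.
exists (ex_minn ex); case: ex_minnP => m /asboolP Pm mmin; split=> // j jm Pj.
by have := mmin j (asboolT Pj); rewrite leqNgt jm.
Qed.

(** One reduction step by a divisor [i * b + j] with initial [i]: the two multiples of
    [i * q * a * b] cancel. *)
Lemma pseudo_division (R : comNzRingType) (i j q r a b : R) :
  i * (q * (a * b) + r) - q * a * (i * b + j) = i * r - q * a * j.
Proof.
rewrite !mulrDr opprD addrACA [i * (q * _)]mulrCA [i * (a * b)]mulrCA mulrA.
by rewrite subrr add0r.
Qed.

(** * The differential ring generated over Phi by one element *)

Section PolyValues.
Variables (k1 k2 : diffFieldType) (G1 G2 : orderedAbGroupType).
Variables (c1 : {additive G1 -> k1}) (c2 : {additive G2 -> k2}).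
Variables (A : hcore c1) (B : hcore c2).
Local Notation W := (hring A * hring B)%type.
Variable Phi : W -> Prop.
Hypothesis cPhi : ring_closed Phi.
Let sPhi : subring Phi. Proof. exact: ring_closed_subring cPhi. Qed.
Variable z : W.

Definition poly_values (w : W) :=
  exists n (p : {mpoly W[n]}), over Phi p /\ w = p.@[pjet z].

Lemma poly_widen n N (p : {mpoly W[n]}) : (n <= N)%N -> over Phi p ->
  exists q : {mpoly W[N]}, over Phi q /\ q.@[pjet z] = p.@[pjet z].
Proof.
move=> nN; apply: (@mpoly_ring_ind n _ Phi (fun p =>
  exists q : {mpoly W[N]}, over Phi q /\ q.@[pjet z] = p.@[pjet z])).
- exact: closed0.
- by move=> a Pa; exists a%:MP; split; [apply: overC | rewrite !mevalC].
- move=> i; exists 'X_(widen_ord nN i); split; first exact: overXm.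
  by rewrite !mevalXU.
- move=> f h [p' [op pE]] [q' [oq qE]]; exists (p' + q'); split; first exact: overD.
  by rewrite !mevalD pE qE.
- move=> f h [p' [op pE]] [q' [oq qE]]; exists (p' * q'); split; first exact: overM.
  by rewrite !mevalM pE qE.
- by exists 1; split; [apply: over1 | rewrite !meval1].
Qed.

Lemma poly_derive n (p : {mpoly W[n]}) : over Phi p ->
  exists q : {mpoly W[n.+1]}, over Phi q /\ q.@[pjet z] = pD p.@[pjet z].
Proof.
(* The induction also carries [p'], the polynomial [p] in [n.+1] variables, because the product rule
   mixes it with derivatives. *)
move=> op; suff [p' [q [_ [_ oq E]]]] : exists p' q : {mpoly W[n.+1]},
    over Phi p' /\ [/\ p'.@[pjet z] = p.@[pjet z], over Phi q &
    q.@[pjet z] = pD p.@[pjet z]] by exists q.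
apply: (@mpoly_ring_ind n _ Phi (fun p => exists p' q : {mpoly W[n.+1]},
    over Phi p' /\ [/\ p'.@[pjet z] = p.@[pjet z], over Phi q &
    q.@[pjet z] = pD p.@[pjet z]])) op.
- exact: closed0.
- move=> a Pa; exists a%:MP, (pD a)%:MP; split; first exact: overC.
  by split; rewrite ?mevalC //; apply: overC => //; apply: closed_D.
- move=> i; exists 'X_(widen_ord (leqnSn n) i), 'X_(lift ord0 i).
  split; first exact: overXm.
  by split; rewrite ?mevalXU //; apply: overXm.
- move=> p1 p2 [p1' [q1 [op1 [E1 oq1 F1]]]] [p2' [q2 [op2 [E2 oq2 F2]]]].
  exists (p1' + p2'), (q1 + q2); split; first exact: overD.
  by split; rewrite ?mevalD ?E1 ?E2 ?F1 ?F2 ?pDD //; apply: overD.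
- move=> p1 p2 [p1' [q1 [op1 [E1 oq1 F1]]]] [p2' [q2 [op2 [E2 oq2 F2]]]].
  exists (p1' * p2'), (q1 * p2' + p1' * q2); split; first exact: overM.
  split; rewrite ?mevalD ?mevalM ?E1 ?E2 ?F1 ?F2 ?pDM //.
  by apply: overD => //; apply: overM.
- exists 1, 0; split; first exact: over1.
  split; rewrite ?meval1 ?meval0 //; first exact: over0.
  have : pD (1 * 1 : W) = pD 1 * 1 + 1 * pD 1 := pDM 1 1.
  by rewrite !mulr1 mul1r -[LHS]addr0 => /addrI.
Qed.

Lemma poly_values_closed : ring_closed poly_values.
Proof.
split.
- by exists 0%N, 1; split; [apply: over1 | rewrite meval1].
- move=> _ _ [n [p [op ->]]] [n' [p' [op' ->]]]; exists (n + n')%N.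
  have [q [oq <-]] := poly_widen (leq_addr n' n) op.
  have [q' [oq' <-]] := poly_widen (leq_addl n n') op'.
  by exists (q - q'); split; [apply: overB | rewrite mevalB].
- move=> _ _ [n [p [op ->]]] [n' [p' [op' ->]]]; exists (n + n')%N.
  have [q [oq <-]] := poly_widen (leq_addr n' n) op.
  have [q' [oq' <-]] := poly_widen (leq_addl n n') op'.
  by exists (q * q'); split; [apply: overM | rewrite mevalM].
- move=> _ [n [p [op ->]]]; have [q [oq <-]] := poly_derive op.
  by exists n.+1, q.
Qed.

Lemma poly_values_sub w : Phi w -> poly_values w.
Proof. by move=> Pw; exists 0%N, w%:MP; split; [apply: overC | rewrite mevalC]. Qed.

Lemma poly_values_self : poly_values z.
Proof. by exists 1%N, 'X_ord0; split; [apply: overXm | rewrite mevalXU]. Qed.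

End PolyValues.

(** * Adjoining a new pair to a good subring *)

Section AdjoinTheorem.
Variables (k1 k2 : diffFieldType) (G1 G2 : orderedAbGroupType).
Variables (c1 : {additive G1 -> k1}) (c2 : {additive G2 -> k2}).
Variables (A : hcore c1) (B : hcore c2).
Local Notation W := (hring A * hring B)%type.
Variables (Rk : k1 * k2 -> Prop) (RG : G1 * G2 -> Prop).
Hypothesis RR : partial_iso c1 c2 Rk RG.
Variable Phi : W -> Prop.
Hypothesis gPhi : good Rk RG Phi.
Local Notation match_ := (lead_match Rk RG).
Let cPhi : ring_closed Phi. Proof. by case: gPhi. Qed.
Let sPhi : subring Phi. Proof. exact: ring_closed_subring cPhi. Qed.
Let mPhi w : Phi w -> match_ w. Proof. by case: gPhi => _ _; apply. Qed.

Hypotheses (csPhi : cset Phi) (csRG : cset RG).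
Hypotheses (hA : hensel A) (hB : hensel B).
Hypothesis satB : forall n (p : {mpoly B[n]}) (a : nat -> B) (g : nat -> G2),
  (forall J, exists y, p.@[jet y] = 0 /\ forall j, (j < J)%N -> vge (y - a j) (g j)) ->
  exists y, p.@[jet y] = 0 /\ forall j, vge (y - a j) (g j).

Variable E : A -> Prop.
Hypotheses (sE : subring E) (DE : forall u, E u -> E (hD u)).
Hypothesis PhiE : forall w, Phi w -> E w.1.
Hypothesis leadE : forall u a g, E u -> lead u a g ->
  (exists a', Rk (a, a')) /\ exists g', RG (g, g').
Hypothesis zeroE : forall n (f : {mpoly A[n]}) d d', over E f -> RG (d, d') ->
  (exists h, vge h d /\ f.@[jet h] = 0) ->
  exists h, [/\ E h, vge h d & f.@[jet h] = 0].

Variable x : A.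
Hypotheses (Ex : E x) (xPhi : forall w, Phi w -> w.1 <> x).

Local Notation near := (near RG Phi x).
Local Notation stable := (stable RG Phi x).

Lemma near_ex : exists w g, near w g.
Proof.
have x0 : x != 0.
  apply/eqP => x0; apply: (xPhi (closed0 cPhi)); by rewrite x0.
have [a [g xg]] := lead_ex x0; have [_ [g' Rg]] := leadE Ex xg.
exists 0, (g, g'); split=> //=; first exact: closed0.
by rewrite subr0; case: xg.
Qed.


Lemma near_refine w g w' g' : near w g -> near w' g' -> g.1 <= g'.1 ->
  vge (w'.1 - w.1) g.1.
Proof.
move=> [_ _ xw] [_ _ xw'] gg'; rewrite -(subrK x w'.1) -addrA; apply: vgeD => //.
by rewrite -opprB; apply/vgeN/(vge_le gg').
Qed.

(** If [w] in [Phi] had first component [x'], then adding to [w] the leading monomial of [x - x']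
    would give an element of [Phi] strictly closer to [x]. The resulting ball around [x] would
    exclude [x']. *)
Lemma near_new x' : E x' -> (forall w g, near w g -> vge (x' - x) g.1) ->
  forall w, Phi w -> w.1 <> x'.
Proof.
move=> Ex' xx' w Pw wx'.
have EB u v : E u -> E v -> E (u - v) by case: sE => _ + _; apply.
have d0 : x - x' != 0.
  by apply/eqP => /eqP; rewrite subr_eq0 => /eqP xx; apply: (xPhi Pw); rewrite wx'.
have [a [g dg]] := lead_ex d0.
have [[a' Ra] [g' Rg]] := leadE (EB _ _ Ex Ex') dg.
pose w' := w + pmono A B (a, a') (g, g').
have Pw' : Phi w' by apply: closedD => //; case: gPhi => _ + _; apply.
have dE : x - w'.1 = (x - x') - mono A a g by rewrite /= wx' opprD addrA.
have d'0 : x - w'.1 != 0.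
  by rewrite subr_eq0; apply/eqP => xw'; apply: (xPhi Pw').
have [a1 [g1 dg1]] := lead_ex d'0.
have [_ [g1' Rg1]] := leadE (EB _ _ Ex (PhiE Pw')) dg1.
have gg1 : g < g1.
  rewrite -(lead_vgt _ dg1) dE; apply/vgtE; case: dg => dg da a0; split.
    by apply: vgeB => //; apply: vge_mono.
  by rewrite coefB coef_mono eqxx da subrr.
have /xx'/= : near w' (g1, g1') by split=> //; case: dg1.
rewrite -opprB => /vgeN; rewrite opprK => /(lead_vge _ dg).
by rewrite oag_leNgt gg1.
Qed.

(** The balls containing [x] are nested, and so are their counterparts in [B]. A zero in the
    smallest of finitely many lies in all of them, and saturation treats the countably many balls
    together. *)
Lemma near_saturated n (p : {mpoly B[n]}) w0 g0 : near w0 g0 ->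
  (forall w g, near w g -> g0.1 <= g.1 ->
     exists y, p.@[jet y] = 0 /\ vge (y - w.2) g.2) ->
  exists y, p.@[jet y] = 0 /\ forall w g, near w g -> vge (y - w.2) g.2.
Proof.
move=> nw0 nP.
have [e [eS Se]] := @cset_enum _ [set x : W * (G1 * G2) | near x.1 x.2]
  (cset_sub (fun x (h : near x.1 x.2) => let: And3 a b _ := h in conj a b)
   (csetX csPhi csRG)).
pose ng j := if e j is Some x then x else (w0, g0).
have ngP j : near (ng j).1 (ng j).2.
  by rewrite /ng; case ej : (e j) => [x'|//]; apply: (eS _ _ ej).
have [J|y [py yP]] := @satB n p (fun j => (ng j).1.2) (fun j => (ng j).2.2); last first.
  by exists y; split=> // w g /(Se (w, g))[j ej]; have := yP j; rewrite /ng ej.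
(* Adding [(w0, g0)] pushes the smallest ball beyond the threshold [g0]. *)
pose s := (w0, g0) :: [seq ng j | j <- iota 0 J].
have sP q : q \in s -> near q.1 q.2.
  by rewrite inE => /predU1P[->//|/mapP[j _ ->]].
have [q qs qmax] : exists2 q, q \in s & forall r, r \in s -> r.2.1 <= q.2.1.
  have [q qs qm] := oag_min (fun q : W * (G1 * G2) => - q.2.1) (mem_head (w0, g0) _ : _ \in s).
  by exists q => // r /qm; rewrite oag_leN2.
have [y [py yq]] := nP _ _ (sP q qs) (qmax _ (mem_head _ _)).
exists y; split=> // j jJ.
have js : ng j \in s by rewrite inE map_f ?orbT // mem_iota.
have [Pj Rj _] := ngP j; have [Pq Rq _] := sP q qs.
have : vge (q.1 - (ng j).1).1 (ng j).2.1.
  exact: near_refine (ngP j) (sP q qs) (qmax _ js).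
move=> /(match_vge RR (mPhi (closedB cPhi Pq Pj)) Rj) qj.
rewrite -(subrK q.1.2 y) -addrA; apply: vgeD qj; apply: vge_le yq.
by rewrite -(pg_le RR Rj Rq); apply: qmax.
Qed.

(** The first component of [z] may differ from [x]. It only has to be new and in [E], which suffices
    to contradict maximality. *)
Definition adjoinable := exists z (T : W -> Prop),
  [/\ ring_closed T, forall w, Phi w -> T w, T z, forall w, T w -> match_ w &
   E z.1 /\ forall w, Phi w -> w.1 <> z.1].

Lemma stable_match_near n (p : {mpoly W[n]}) z : over Phi p ->
  (forall w g, near w g -> vge (z.1 - x) g.1 /\ vge (z.2 - w.2) g.2) ->
  stable p -> exists a mu, [/\ Rk a, RG mu, lead (p1 p).@[jet x] a.1 mu.1,
    lead (p.@[pjet z]).1 a.1 mu.1 & lead (p.@[pjet z]).2 a.2 mu.2].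
Proof.
move=> op zn [w [g [nw sp]]]; have [z1 z2] := zn w g nw.
exact: (stable_match RR gPhi op nw sp z1 z2).
Qed.

Lemma adjoin_stable : (forall n (p : {mpoly W[n]}), over Phi p -> p != 0 -> stable p) ->
  adjoinable.
Proof.
move=> st; have [w0 [g0 nw0]] := near_ex.
(* The zero polynomial imposes no equation; only the balls constrain [y]. *)
have [w g _ _|y [_ yP]] := @near_saturated 0 0 w0 g0 nw0.
  by exists w.2; rewrite meval0 subrr; split=> //; apply: vge0.
exists (x, y), (poly_values Phi (x, y)); split.
- exact: poly_values_closed.
- exact: poly_values_sub.
- exact: poly_values_self.
- move=> _ [n [p [op ->]]]; have [->|p0] := eqVneq p 0.
    by rewrite meval0; apply: match0.
  have [|a [mu [Ra Rmu _ l1 l2]]] := stable_match_near (z := (x, y)) op _ (st _ _ op p0).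
    by move=> w g nw /=; rewrite subrr; split; [apply: vge0 | apply: yP].
  by right; exists a, mu.
- by split.
Qed.


Lemma Phi_neq0 w : Phi w -> w != 0 -> w.1 != 0.
Proof.
move=> Pw; apply: contra_neq => w1; apply: pair_eq => //.
exact/(match_eq0 (mPhi Pw)).
Qed.

Lemma Phi_mulrn_neq0 w j : Phi w -> w != 0 -> w *+ j.+1 != 0.
Proof.
move=> Pw /(Phi_neq0 Pw) w1; have [a [g wa]] := lead_ex w1.
have := lead_neq0 (leadMn j wa); apply: contra_neq => E0.
by rewrite -(raddfMn (@fst A B)) E0.
Qed.

Lemma mderiv_neq0 n (p : {mpoly W[n]}) m (i : 'I_n) : over Phi p -> p@_m != 0 ->
  m i != 0%N -> p^`M(i) != 0.
Proof.
move=> op pm mi; apply/eqP => E0.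
have := Phi_mulrn_neq0 (m i).-1 (op m) pm; rewrite prednK ?lt0n //.
have : p^`M(i)@_(m - U_(i)) = 0 by rewrite E0 mcoeff0.
rewrite mcoeff_deriv submK ?lep1mP // mnmBE mnm1E eqxx subn1 prednK ?lt0n //.
by move=> -> /eqP.
Qed.

Lemma stable_const n w : Phi w -> w != 0 -> stable (w%:MP : {mpoly W[n]}).
Proof.
move=> Pw w0; have [w' [g nw]] := near_ex; exists w', g; split=> //.
have [a [mu wa]] := lead_ex (Phi_neq0 Pw w0).
exists a, mu; rewrite /p1 map_mpolyC mevalC shiftC; split=> //.
by move=> m; rewrite /nonconst mcoeffC eqxx mulr1 subrr mcoeff0; apply: vgt0.
Qed.

Lemma p1_mderiv n (p : {mpoly W[n]}) i : p1 p^`M(i) = (p1 p)^`M(i).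
Proof.
apply/mpolyP => m; rewrite mcoeff_p1 !mcoeff_deriv mcoeff_p1.
exact: (raddfMn (@fst A B)).
Qed.

(** * A minimal unstable polynomial and its zeros *)

Section Unstable.
Variable n : nat.

Definition vars_lt (l : nat) (m : 'X_{1..n}) := forall i : 'I_n, (l <= i)%N -> m i = 0%N.

(* Q is an unstable polynomial over Phi with as few variables as possible, then
   of least degree in its last variable o, then with stable partial derivatives. *)
Variables (o : 'I_n) (d : nat) (Q : {mpoly W[n]}).
Let l := o.+1.
Hypotheses (oQ : over Phi Q) (unQ : ~ stable Q).
Hypothesis Q_in : mon_in (fun m => vars_lt l m /\ (m o < d.+1)%N) Q.
Hypothesis st1 : forall p : {mpoly W[n]}, over Phi p -> p != 0 ->
  mon_in (vars_lt o) p -> stable p.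
Hypothesis st2 : forall p : {mpoly W[n]}, over Phi p -> p != 0 ->
  mon_in (fun m => vars_lt l m /\ (m o < d)%N) p -> stable p.
Hypothesis st3 : forall i, Q^`M(i) != 0 -> stable Q^`M(i).

(** If [o] occurred in no monomial, [Q] would have fewer variables and be stable by minimality;
    characteristic zero does the rest. *)
Lemma Q_neq0 : Q != 0 -> Q^`M(o) != 0.
Proof.
move=> Q0; have [m [Qm mo]] : exists m, Q@_m != 0 /\ m o != 0%N.
  apply: contrapT => no; apply: unQ; apply: st1 => // m Qm i oi.
  have [ml _] := Q_in Qm; move: oi; rewrite leq_eqVlt => /predU1P[oi|/ml //].
  apply: contrapT => /eqP mi; apply: no; exists m; split=> //.
  by rewrite (_ : o = i) //; apply: val_inj.
exact: mderiv_neq0 Qm mo.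
Qed.

Hypothesis Qnz : Q != 0.
Let S := Q^`M(o).
Let S0 : S != 0 := Q_neq0 Qnz.
Let f := shift (jet x) (p1 Q).

Lemma f_mderiv i : f^`M(i) = shift (jet x) (p1 Q^`M(i)).
Proof. by rewrite mderiv_shift p1_mderiv. Qed.

Lemma f_U i : f@_U_(i) = (p1 Q^`M(i)).@[jet x].
Proof.
by rewrite -mcoeff0_shift -f_mderiv mcoeff_deriv add0m mnm0E mulr1n.
Qed.

(** Here [b] is the least valuation at [x] of a nonzero partial derivative, and [g0] the largest
    radius on which these were found stable. Up to positive integers, the coefficients of degree at
    least 2 are nonconstant coefficients of partial derivatives, so stability bounds them. *)
Lemma unstable_conf : exists (b : G1 * G2) w0 g0, [/\ RG b, near w0 g0 &
  forall w g, near w g -> g0.1 <= g.1 -> hconf f b.1 g.1].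
Proof.
have /choice[D DP] : forall i, exists D : (W * (G1 * G2)) * (G1 * G2),
    Q^`M(i) != 0 -> [/\ near D.1.1 D.1.2, RG D.2, exists a, lead f@_U_(i) a D.2.1 &
    GT D.1.2.1 D.2.1 (nonconst f^`M(i))].
  move=> i; have [Qi|Qi] := eqVneq Q^`M(i) 0; first by exists ((0, 0), 0) => /eqP[].
  have [w [g [nw sw]]] := st3 Qi.
  have oi : over Phi Q^`M(i) by apply: over_mderiv.
  have [||a [mu [_ Rmu l1 _ _]]] := stable_match RR gPhi oi nw sw (z := (x, w.2)).
  - by rewrite subrr; apply: vge0.
  - by rewrite subrr; apply: vge0.
  exists ((w, g), mu) => _; split=> //; first by exists a.1; rewrite f_U.
  have [al [mu' [l1' g1]]] := sw.
  by have [_ ->] := lead_inj l1 l1'; rewrite f_mderiv.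
pose s := [seq i <- enum 'I_n | Q^`M(i) != 0].
have sI i : (i \in s) = (Q^`M(i) != 0) by rewrite mem_filter mem_enum andbT.
have os : o \in s by rewrite sI.
have [ib ibs ibmin] := oag_min (fun i => (D i).2.1) os.
have [ig igs igmax] := oag_min (fun i => - (D i).1.2.1) os.
have [nw0 _ _ _] := DP ig (etrans (esym (sI _)) igs).
have [_ Rb [ab lb] _] := DP ib (etrans (esym (sI _)) ibs).
exists (D ib).2, (D ig).1.1, (D ig).1.2; split=> // w g nw gg.
set b := (D ib).2 in Rb lb *.
have fU i : vge f@_U_(i) b.1.
  have [Qi|Qi] := eqVneq Q^`M(i) 0.
    by rewrite f_U Qi /p1 rmorph0 meval0; apply: vge0.
  have [_ _ [a la] _] := DP i Qi; apply/(lead_vge _ la).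
  by apply: ibmin; rewrite sI.
have fgt m : (1 < mdeg m)%N -> vgt f@_m (b.1 + g.1 - g.1 *+ mdeg m).
  move=> m1; have [i mi] : exists i, m i != 0%N.
    apply/existsP; apply: contraTT m1; rewrite negb_exists => /forallP mi.
    rewrite mdegE big1 // => i _; apply/eqP; have := mi i; by rewrite negbK.
  pose m' := (m - U_(i))%MM; have mE : m = (m' + U_(i))%MM by rewrite submK ?lep1mP.
  have mdE : mdeg m = (mdeg m').+1 by rewrite {1}mE mdegD mdeg1 addn1.
  have fm : f^`M(i)@_m' = f@_m *+ (m' i).+1 by rewrite mcoeff_deriv -mE.
  rewrite -(vgtMn _ _ (m' i)) -fm; have [Qi|Qi] := eqVneq Q^`M(i) 0.
    by rewrite f_mderiv Qi /p1 rmorph0 /shift mmap0 mcoeff0; apply: vgt0.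
  have [_ _ [a la] Gi] := DP i Qi.
  have gi : (D i).1.2.1 <= g.1.
    by apply: le_trans gg; rewrite -oag_leN2; apply: igmax; rewrite sI.
  have m'0 : m' != 0%MM by rewrite -mdeg_eq0; move: m1; rewrite mdE; case: (mdeg m').
  have /GT_nonconst/(_ m' m'0) := GT_nonconst_raise gi Gi.
  apply: vgt_le; rewrite mdE mulrS opprD addrA addrK oag_leD2rE.
  by apply: ibmin; rewrite sI.
split=> //; last by exists ib; case: lb => _ ->.
have [->|f0] := eqVneq f@_0 0; first exact: vge0.
have [al [mu la]] := lead_ex f0; apply/(lead_vge _ la).
(* A constant term of valuation below [b + g] would dominate all other terms on this ball and make
   [Q] stable. *)
rewrite oag_leNgt; apply/negP => lt_mu; apply: unQ; exists w, g; split=> //.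
exists al, mu; rewrite -mcoeff0_shift; split=> //.
apply/GT_nonconst => m m0; case: (mdeg_cases m) => [E0|[i ->]|m1].
- by rewrite E0 eqxx in m0.
- by rewrite mdeg1 mulr1n; apply: vge_lt (fU i); rewrite oag_ltBlD.
- by apply: vgt_le (fgt m m1); rewrite oag_leD2rE; apply: ltW.
Qed.

Lemma Ejet (u : A) (i : 'I_n) : E u -> E (jet u i).
Proof. by move=> Eu; rewrite /jet; elim: (i : nat) => //= j; apply: DE. Qed.

Lemma over_f : over E f.
Proof.
apply: (over_shift sE); first by move=> i; apply: Ejet.
by move=> m; rewrite mcoeff_p1; apply: PhiE.
Qed.

(** With [mu] the valuation of the value of [Q] at [x], no ball around [x] with centre in [Phi] has
    radius above [mu - b]. A zero in [A] within [mu - b] of [x] thus lies in all these balls. In [B]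
    there is no partner of [x] to start from, so zeros in single balls are combined by
    saturation. *)
Lemma unstable_zero : exists z : W, [/\ E z.1, Q.@[pjet z] = 0 &
  forall w g, near w g -> vge (z.1 - x) g.1 /\ vge (z.2 - w.2) g.2].
Proof.
have [b [w0 [g0 [Rb nw0 conf]]]] := unstable_conf.
have [x' [Ex' fx' nx']] : exists x', [/\ E x', (p1 Q).@[jet x'] = 0 &
    forall w g, near w g -> vge (x' - x) g.1].
  have [f0|f0] := eqVneq f@_0 0.
    exists x; split=> //; first by rewrite -mcoeff0_shift.
    by move=> w g _; rewrite subrr; apply: vge0.
  have [al [mu la]] := lead_ex f0.
  have [_ [mu' Rmu]] := leadE (over_f 0%MM) la.
  have le0 w g : near w g -> g0.1 <= g.1 -> g.1 <= mu - b.1.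
    move=> nw gg; have [f0b _ _ _] := conf w g nw gg.
    by rewrite oag_leBrD addrC; apply/(lead_vge _ la).
  have le1 w g : near w g -> g.1 <= mu - b.1.
    move=> nw; have [gg|/ltW gg] := oag_leP g0.1 g.1; first exact: le0 nw gg.
    by apply: le_trans gg _; apply: le0 nw0 (lexx _).
  have Rd : RG (mu - b.1, mu' - b.2) by exact: (pgB RR Rmu Rb).
  have confd : hconf f b.1 (mu - b.1).
    apply: hconf_raise (conf _ _ nw0 (lexx _)) (le1 _ _ nw0) _.
    by rewrite addrC subrK; case: la.
  have [h [Eh hd fh]] := zeroE over_f Rd (hA confd).
  exists (h + x); split.
  - exact: subringD.
  - by rewrite -meval_shift_jet.
  - by move=> w g nw; rewrite addrK; apply: vge_le hd; apply: le1 nw.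
have [w g nw gg|y [Qy ny]] := @near_saturated n (p2 Q) w0 g0 nw0.
  have [Pw Rg _] := nw; have [qE hg] := near_shift Q nw.
  have := hconf_shift (conf w g nw gg) hg; rewrite -qE shift_p1.
  move=> /(hconf_transfer RR gPhi oQ Pw Rb Rg) /hB[h [hg2 Qh]].
  by exists (h + w.2); rewrite -meval_shift_jet addrK.
exists (x', y); split=> //.
  by apply: pair_eq; rewrite ?meval_p1 ?meval_p2.
by move=> w g nw; split; [apply: nx' nw | apply: ny].
Qed.

(** * The differential ring generated by a zero of the minimal polynomial *)

Section WithZero.
Variable z : W.
Hypotheses (Qz : Q.@[pjet z] = 0)
  (zn : forall w g, near w g -> vge (z.1 - x) g.1 /\ vge (z.2 - w.2) g.2).

Lemma match_st (p : {mpoly W[n]}) : over Phi p -> stable p ->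
  match_ p.@[pjet z] /\ (p.@[pjet z]).1 != 0.
Proof.
move=> op /(stable_match_near op zn)[a [mu [Ra Rmu _ la1 la2]]].
by split; [right; exists a, mu | apply: lead_neq0 la1].
Qed.

Lemma vars_lt_zero m : vars_lt l m ->
  vars_lt l [multinom if i == o then 0 else m i | i < n]%N.
Proof. by move=> ml i li; rewrite mnmE; case: eqP => // _; apply: ml. Qed.

Lemma vars_ltD j (m1 m2 : 'X_{1..n}) : vars_lt j m1 -> vars_lt j m2 ->
  vars_lt j (m1 + m2)%MM.
Proof. by move=> ml1 ml2 i li; rewrite mnmDE ml1 ?ml2. Qed.

Lemma vars_ltU (i : 'I_n) : (i <= o)%N -> vars_lt l U_(i).
Proof.
move=> io j lj; rewrite mnm1E; case: eqP => // ij.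
by move: lj; rewrite -ij /l ltnNge io.
Qed.

(* Pseudo-division by Q in the variable o. *)
Lemma match_vars (e : nat) (p : {mpoly W[n]}) : over Phi p ->
  mon_in (fun m => vars_lt l m /\ (m o < e)%N) p -> match_ p.@[pjet z].
Proof.
elim: e p => [|e IHe] p op p_in.
  suff -> : p = 0 by rewrite meval0; apply: match0.
  apply/mpolyP => m; rewrite mcoeff0; apply: contrapT => /eqP /p_in[_].
  by rewrite ltn0.
have [de|ed] := leqP d e; last first.
  have [->|p0] := eqVneq p 0; first by rewrite meval0; apply: match0.
  apply: (match_st op _).1; apply: st2 => //; apply: mon_inS p_in => m [ml me].
  by split=> //; apply: leq_trans me ed.
have [q [r [oq or q_in r_in pE]]] := mon_split sPhi vars_lt_zero op p_in.
have [I [J [oI oJ I_in J_in QE]]] := mon_split sPhi vars_lt_zero oQ Q_in.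
have I0 : I != 0.
  apply/eqP => I0; apply: unQ; apply: st2 => //.
  by rewrite QE I0 mul0r add0r.
(* The initial [I] has fewer variables than [Q], hence is stable and does not vanish at [z]. It can
   be cancelled after the reduction. *)
have [|mI zI] := @match_st I oI _.
  apply: st1 => //; apply: mon_inS I_in => m [ml mo] i.
  rewrite leq_eqVlt => /predU1P[oi|/ml //].
  by rewrite (_ : i = o) //; apply: val_inj.
have XE : over Phi ('X_o ^+ (e - d) : {mpoly W[n]}) by rewrite mpolyXn; apply: overXm.
have redE : I * p - q * 'X_o ^+ (e - d) * Q = I * r - q * 'X_o ^+ (e - d) * J.
  by rewrite pE {1}QE -[in 'X_o ^+ e](subnK de) exprD pseudo_division.
have := IHe (I * p - q * 'X_o ^+ (e - d) * Q).
rewrite mevalB !mevalM Qz mulr0 subr0 => IH.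
apply: (matchMI RR (s := I.@[pjet z])) => //; apply: IH.
  by apply: overB => //; apply: overM => //; apply: overM.
rewrite redE.
apply: mon_inB.
  apply: mon_inM I_in r_in => m1 m2 [ml1 mo1] [ml2 mo2].
  by split; [apply: vars_ltD | rewrite mnmDE mo1].
apply: (@mon_inM _ _ (fun m => vars_lt l m /\ m o = (e - d)%N)) J_in => [m1 m2|].
  move=> [ml1 mo1] [ml2 mo2]; split; first exact: vars_ltD.
  by rewrite mnmDE mo1 -[X in (_ < X)%N](subnK de) ltn_add2l.
rewrite mpolyXn.
apply: (@mon_inM _ _ _ (fun m => m = (U_(o) *+ (e - d))%MM)) q_in _; last exact: mon_inX.
move=> m1 m2 [ml1 mo1] ->; split; last by rewrite mnmDE mo1 mulmnE mnm1E eqxx mul1n.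
apply: vars_ltD => // i li; rewrite mulmnE.
by rewrite (vars_ltU (leqnn o) li) mul0n.
Qed.

(** Only derivatives of [z] of order at most [o] enter, so this subring need not be closed under the
    derivation. *)
Definition A_values (w : W) := exists p : {mpoly W[n]},
  [/\ over Phi p, mon_in (vars_lt l) p & w = p.@[pjet z]].

Lemma A_match w : A_values w -> match_ w.
Proof.
move=> [p [op p_in ->]]; apply: (@match_vars (msize p)) => // m pm; split.
  exact: p_in.
apply: leq_ltn_trans (msize_mdeg_lt _); last by rewrite mcoeff_msupp; exact: pm.
by rewrite mdegE (bigD1 o) //= leq_addr.
Qed.

Lemma vars_lt0 j : vars_lt j 0%MM. Proof. by move=> i _; rewrite mnm0E. Qed.

Lemma A_one : A_values 1.
Proof.
exists 1; split; [exact: over1 | | by rewrite meval1].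
by rewrite -mpolyC1; apply: mon_inC; exact: vars_lt0.
Qed.

Lemma A_B v w : A_values v -> A_values w -> A_values (v - w).
Proof.
move=> [p [op p_in ->]] [q [oq q_in ->]]; exists (p - q).
by split; [apply: overB | apply: mon_inB | rewrite mevalB].
Qed.

Lemma A_M v w : A_values v -> A_values w -> A_values (v * w).
Proof.
move=> [p [op p_in ->]] [q [oq q_in ->]]; exists (p * q).
split; [exact: overM | | by rewrite mevalM].
by apply: mon_inM p_in q_in; apply: vars_ltD.
Qed.

Lemma A_X v j : A_values v -> A_values (v ^+ j).
Proof.
by move=> Av; elim: j => [|j IHj]; [exact: A_one | rewrite exprS; apply: A_M].
Qed.

Lemma A_0 : A_values 0.
Proof. by rewrite -(subrr 1); apply: A_B; apply: A_one. Qed.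

Lemma A_D v w : A_values v -> A_values w -> A_values (v + w).
Proof.
move=> Av Aw; rewrite -(opprK w) -[- w]sub0r; apply: A_B => //.
by apply: A_B => //; apply: A_0.
Qed.

Lemma A_Mn v j : A_values v -> A_values (v *+ j).
Proof.
move=> Av; elim: j => [|j IHj]; first by rewrite mulr0n; apply: A_0.
by rewrite mulrS; apply: A_D.
Qed.

Let s := S.@[pjet z].
Let t := pD (pjet z o).

Lemma oS : over Phi S. Proof. exact: over_mderiv. Qed.

Lemma S_in : mon_in (vars_lt l) S.
Proof.
apply: (mon_in_mderiv (Q := vars_lt l)); last by apply: mon_inS Q_in => m [].
by move=> m ml i li; have := ml i li; rewrite mnmDE => /eqP; rewrite addn_eq0 => /andP[/eqP].
Qed.

Lemma A_s : A_values s.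
Proof. by exists S; split; [exact: oS | exact: S_in |]. Qed.

(** The chain rule with its top term split off: only the entry [o] of the jet has its derivative [t]
    outside the allowed variables, so [t] enters linearly. *)
Lemma A_derive p : over Phi p -> mon_in (vars_lt l) p ->
  exists q, [/\ over Phi q, mon_in (vars_lt l) q &
    pD p.@[pjet z] = q.@[pjet z] + (p^`M(o)).@[pjet z] * t].
Proof.
move=> op p_in; pose T (p : {mpoly W[n]}) := exists q, [/\ over Phi p,
  mon_in (vars_lt l) p, over Phi q, mon_in (vars_lt l) q &
  pD p.@[pjet z] = q.@[pjet z] + (p^`M(o)).@[pjet z] * t].
suff [q [_ _ oq q_in E']] : T p by exists q.
have in1 : mon_in (vars_lt l) (1 : {mpoly W[n]}).
  by rewrite -mpolyC1; apply: mon_inC; exact: vars_lt0.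
have TC a : Phi a -> T a%:MP.
  move=> Pa; exists (pD a)%:MP; rewrite mderivC meval0 mul0r addr0 !mevalC.
  by split=> //; [apply: overC | apply: mon_inC; exact: vars_lt0 |
    apply: overC => //; apply: closed_D | apply: mon_inC; exact: vars_lt0].
apply: (@mpoly_ring_indV n _ Phi (fun i => (i <= o)%N)) => //.
- exact: closed0.
- move=> i io; have [io'|io'] := eqVneq i o.
    exists 0; rewrite io'; split; [exact: overXm | | exact: over0 | |].
      by apply: mon_inX; exact: vars_ltU.
      by move=> m; rewrite mcoeff0 eqxx.
    rewrite meval0 add0r mevalXU mderivX mnm1E eqxx scale1r.
    rewrite (_ : U_(o) - U_(o) = 0)%MM ?mpolyX0 ?meval1 ?mul1r //.
    by apply/mnmP => j; rewrite mnmBE mnm0E subnn.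
  have io1 : (i < o)%N by rewrite ltn_neqAle io andbT.
  have i1n : (i.+1 < n)%N by apply: leq_ltn_trans io1 (ltn_ord o).
  exists 'X_(Ordinal i1n); split; [exact: overXm | | exact: overXm | |].
    by apply: mon_inX; exact: vars_ltU.
    by apply: mon_inX; exact: vars_ltU.
  rewrite mderivX mnm1E (negPf io') scale0r meval0 mul0r addr0 !mevalXU.
  by [].
- move=> p1 p2 [q1 [op1 p1_in oq1 q1_in E1]] [q2 [op2 p2_in oq2 q2_in E2]].
  exists (q1 + q2); split; try exact: overD; try exact: mon_inD.
  by rewrite mderivD !mevalD pDD E1 E2 mulrDl addrACA.
- move=> p1 p2 [q1 [op1 p1_in oq1 q1_in E1]] [q2 [op2 p2_in oq2 q2_in E2]].
  have inM (g h : {mpoly W[n]}) : mon_in (vars_lt l) g -> mon_in (vars_lt l) h ->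
      mon_in (vars_lt l) (g * h) by apply: mon_inM; apply: vars_ltD.
  exists (q1 * p2 + p1 * q2); split.
  + exact: overM.
  + exact: inM.
  + by apply: overD => //; apply: overM.
  + by apply: mon_inD; apply: inM.
  rewrite mderivM !mevalD !mevalM pDM E1 E2 !mulrDl !mulrDr addrACA.
  by congr (_ + (_ + _)); rewrite ?mulrA // mulrAC.
- by rewrite -mpolyC1; apply: TC; apply: closed1.
- by move=> m pm i; rewrite leqNgt => /negP; rewrite negbK => oi; apply: (p_in m pm).
Qed.

(** Differentiating the equation [Q = 0] at [z] expresses the next derivative [t] as a fraction
    whose denominator is the value [s] of the separant. *)
Lemma A_st : A_values (s * t).
Proof.
have Ql : mon_in (vars_lt l) Q by apply: mon_inS Q_in => m [].
have [q [oq q_in]] := A_derive oQ Ql; rewrite Qz pD0 => E0.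
have -> : s * t = 0 - q.@[pjet z].
  by apply/eqP; rewrite -subr_eq0 sub0r opprK addrC -E0.
by apply: A_B; [apply: A_0 | exists q].
Qed.

Lemma A_sD v : A_values v -> A_values (s * pD v).
Proof.
move=> [p [op p_in ->]]; have [q [oq q_in ->]] := A_derive op p_in.
have -> : s * (q.@[pjet z] + (p^`M(o)).@[pjet z] * t) =
    s * q.@[pjet z] - (0 - (p^`M(o)).@[pjet z] * (s * t)).
  by rewrite sub0r opprK mulrDr; congr (_ + _); rewrite mulrCA.
apply: A_B; first by apply: A_M A_s _; exists q.
apply: A_B; first exact: A_0.
apply: A_M A_st; exists p^`M(o); split=> //; first exact: over_mderiv.
apply: (mon_in_mderiv (Q := vars_lt l)) => // m ml i li.
by have := ml i li; rewrite mnmDE => /eqP; rewrite addn_eq0 => /andP[/eqP].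
Qed.

(** A localisation at the separant, written without inverses. Unlike [A_values] it is closed under
    the derivation. *)
Definition T_values (w : W) := exists j, A_values (s ^+ j * w).

Lemma pD_exp (u : W) j : u * pD (u ^+ j) = (u ^+ j * pD u) *+ j.
Proof.
elim: j => [|j IHj].
  rewrite expr0 mulr0n; have : pD (1 * 1 : W) = pD 1 * 1 + 1 * pD 1 := pDM 1 1.
  by rewrite !mulr1 mul1r -[LHS]addr0 => /addrI <-; rewrite mulr0.
rewrite {1}exprS pDM mulrDr IHj [RHS]mulrS; congr (_ + _).
  by rewrite [pD u * _]mulrC mulrA -exprS.
by rewrite mulrnAr mulrA -exprS.
Qed.

Lemma T_closed : ring_closed T_values.
Proof.
split.
- by exists 0%N; rewrite expr0 mul1r; apply: A_one.
- move=> v w [i Av] [j Aw]; exists (i + j)%N; rewrite mulrBr; apply: A_B.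
    by rewrite exprD mulrAC mulrC; apply: A_M => //; apply: A_X; apply: A_s.
  by rewrite exprD -mulrA; apply: A_M => //; apply: A_X; apply: A_s.
- move=> v w [i Av] [j Aw]; exists (i + j)%N.
  by rewrite exprD mulrACA; apply: A_M.
(* The product rule for [s ^+ j * w], multiplied by [s] twice: one factor clears the derivative of
   that element, the other clears the derivative of [s]. *)
- move=> w [j Aw]; exists j.+2.
  have -> : s ^+ j.+2 * pD w =
      s * (s * pD (s ^+ j * w)) - ((s * pD s) * (s ^+ j * w)) *+ j.
    have -> : s * (s * pD (s ^+ j * w)) =
        ((s * pD s) * (s ^+ j * w)) *+ j + s ^+ j.+2 * pD w.
      rewrite pDM !mulrDr; congr (_ + _); last by rewrite !exprS !mulrA.
      rewrite [s * (pD _ * w)]mulrA pD_exp mulrnAl mulrnAr; congr (_ *+ _).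
      by rewrite !mulrA; congr (_ * _); rewrite mulrAC.
    by rewrite addrAC subrr add0r.
  apply: A_B; first by apply: A_M A_s _; apply: A_sD.
  by apply/A_Mn/A_M => //; apply: A_sD A_s.
Qed.

(** The separant is stable, hence nonzero at [z], and powers of it can be cancelled from a matched
    product. *)
Lemma T_match w : T_values w -> match_ w.
Proof.
move=> [j /A_match msw].
have [ms s0] := match_st oS (st3 S0).
have sX0 : (s ^+ j).1 != 0.
  have [a [g la]] := lead_ex s0; have := lead_neq0 (leadX j la).
  by rewrite -(rmorphXn (@fst A B)).
have mX : match_ (s ^+ j) by apply: A_match; apply: A_X A_s.
exact: (matchMI RR msw mX sX0).
Qed.

Lemma T_sub w : Phi w -> T_values w.
Proof.
move=> Pw; exists 0%N; rewrite expr0 mul1r; exists w%:MP.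
by split; [exact: overC | apply: mon_inC; exact: vars_lt0 | rewrite mevalC].
Qed.

Lemma T_self : T_values z.
Proof.
have n0 : (0 < n)%N by apply: leq_ltn_trans (ltn_ord o).
exists 0%N; rewrite expr0 mul1r; exists 'X_(Ordinal n0).
by split; [exact: overXm | by apply: mon_inX; exact: vars_ltU | rewrite mevalXU].
Qed.

End WithZero.

Lemma adjoin_minimal_unstable : adjoinable.
Proof.
have [z [Ez Qz zn]] := unstable_zero.
exists z, (T_values z); split.
- exact: T_closed.
- by move=> w; apply: T_sub.
- exact: T_self.
- by move=> w; apply: T_match.
- split=> //; apply: near_new => // w g nw; exact: (zn w g nw).1.
Qed.

End Unstable.

(** Three successive minima are taken among unstable polynomials: the number of variables, the
    degree in the last one, the total degree. The last makes the nonzero partial derivatives stable,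
    since differentiation lowers it and respects the other two bounds. *)
Lemma adjoin_ex : adjoinable.
Proof.
have [st|] := pselect (forall n (p : {mpoly W[n]}), over Phi p -> p != 0 -> stable p).
  exact: adjoin_stable.
move=> nst; have [n [p [op p0 unp]]] : exists n (p : {mpoly W[n]}),
    [/\ over Phi p, p != 0 & ~ stable p].
  apply: contrapT => ne; apply: nst => n p op p0; apply: contrapT => unp.
  by apply: ne; exists n, p.
pose U (R : 'X_{1..n} -> Prop) := exists p : {mpoly W[n]},
  [/\ over Phi p, p != 0, mon_in R p & ~ stable p].
have [l [Ul lmin]] : exists l, U (vars_lt l) /\ forall j, (j < l)%N -> ~ U (vars_lt j).
  apply: ex_min_nat; exists n, p; split=> // m _ i ni.
  by have := ltn_ord i; rewrite ltnNge ni.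
(* Nonzero constants are stable, so an unstable polynomial has a last variable [o]. *)
have l0 : (0 < l)%N.
  rewrite lt0n; apply/eqP => E0; have [q [oq q0 q_in unq]] := Ul; apply: unq.
  have qE : q = (q@_0)%:MP.
    apply/mpolyP => m; rewrite mcoeffC; have [->|m0] := eqVneq m 0%MM.
      by rewrite mulr1.
    rewrite mulr0; apply: contrapT => /eqP /q_in; rewrite E0 => mv.
    by case/eqP: m0; apply/mnmP => i; rewrite mnm0E mv.
  rewrite qE; apply: stable_const => //; apply: contra_neq q0 => q00.
  by rewrite qE q00 mpolyC0.
have ln : (l <= n)%N.
  rewrite leqNgt; apply/negP => /lmin; apply; exists p; split=> // m _ i ni.
  by have := ltn_ord i; rewrite ltnNge ni.
have on : (l.-1 < n)%N by rewrite prednK.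
pose o := Ordinal on; have lE : l = o.+1 by rewrite /= prednK.
rewrite lE in Ul lmin.
have mlt (q : {mpoly W[n]}) m : q@_m != 0 -> (mdeg m < msize q)%N.
  by move=> qm; apply: msize_mdeg_lt; rewrite mcoeff_msupp.
have mo (m : 'X_{1..n}) : (m o <= mdeg m)%N by rewrite mdegE (bigD1 o) //= leq_addr.
have [d [Ud dmin]] : exists d, U (fun m => vars_lt o.+1 m /\ (m o < d)%N) /\
    forall j, (j < d)%N -> ~ U (fun m => vars_lt o.+1 m /\ (m o < j)%N).
  apply: ex_min_nat; have [q [oq q0 q_in unq]] := Ul; exists (msize q), q.
  split=> // m qm; split; first exact: q_in.
  exact: leq_ltn_trans (mo m) (mlt q m qm).
have nz (q : {mpoly W[n]}) : q != 0 -> exists m, q@_m != 0.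
  by move=> q0; exists (mlead q); rewrite mleadc_eq0.
case: d Ud dmin => [[q [_ /nz[m qm] q_in _]] _|d Ud dmin].
  by have [_] := q_in m qm; rewrite ltn0.
have [s [Us smin]] : exists s,
    U (fun m => (vars_lt o.+1 m /\ (m o < d.+1)%N) /\ (mdeg m < s)%N) /\
    forall j, (j < s)%N ->
    ~ U (fun m => (vars_lt o.+1 m /\ (m o < d.+1)%N) /\ (mdeg m < j)%N).
  apply: ex_min_nat; have [q [oq q0 q_in unq]] := Ud; exists (msize q), q.
  by split=> // m qm; split; [apply: q_in | apply: mlt].
case: s Us smin => [[q [_ /nz[m qm] q_in _]] _|s [Q [oQ Q0 Q_in unQ]] smin].
  by have [_] := q_in m qm; rewrite ltn0.
apply: (@adjoin_minimal_unstable n o d Q) => //.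
- by apply: mon_inS Q_in => m [].
- move=> q oq q0 q_in; apply: contrapT => unq.
  by apply: (lmin o (ltnSn o)); exists q.
- move=> q oq q0 q_in; apply: contrapT => unq.
  by apply: (dmin d (ltnSn d)); exists q.
- move=> i Qi; apply: contrapT => unq; apply: (smin s (ltnSn s)); exists Q^`M(i).
  split=> //; first exact: over_mderiv.
  apply: mon_in_mderiv Q_in => m [[mv md] ms]; split; [split|].
  + move=> j lj; have := mv j lj; rewrite mnmDE => /eqP.
    by rewrite addn_eq0 => /andP[/eqP].
  + by apply: leq_ltn_trans md; rewrite mnmDE leq_addr.
  + by move: ms; rewrite mdegD mdeg1 addn1.
Qed.

End AdjoinTheorem.
(** * Back-and-forth *)

(** The closure consists of the values of finite trees, with leaves naming elements of [S] and nodes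
    naming operations; there are countably many trees. Operations act on lists so that all arities
    fit. *)
Lemma countable_closure (X : eqType) (x0 : X) (op : nat -> seq X -> X) (S : set X) :
  cset S -> exists E : set X, [/\ cset E, S `<=` E &
    forall m s, (forall x, x \in s -> E x) -> E (op m s)].
Proof.
move=> /cset_enum[e [_ Se]].
pose fix teval (t : GenTree.tree nat) : X := match t with
  | GenTree.Leaf n => odflt x0 (e n)
  | GenTree.Node m ts => op m (map teval ts)
  end.
exists (range teval); split.
- apply: cset_image; exact: (@cset_countType (GenTree.tree nat)).
- by move=> x /Se[n en]; exists (GenTree.Leaf n); rewrite //= en.
- move=> m s sE; suff [ts <-] : exists ts, map teval ts = s.
    by exists (GenTree.Node m ts).
  elim: s sE => [_|x s IHs sE]; first by exists [::].
  have [|ts <-] := IHs; first by move=> y ys; apply: sE; rewrite inE ys orbT.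
  by have [t _ <-] := sE x (mem_head _ _); exists (t :: ts).
Qed.

(** * Countable subrings closed under leading terms and zeros *)

Section Closure.
Variables (k : diffFieldType) (G : orderedAbGroupType) (c : {additive G -> k}).
Variable K : hcore c.

(** Coefficients [a] are represented by [mono K a 0] and exponents [g] by [mono K 1 g], so that the
    single set [E] also determines a subfield of [k] and a subgroup of [G]. *)
Record closed_under_leads (E : set K) : Prop := ClosedUnderLeads {
  cl_subring : subring E;
  cl_hD : forall u, E u -> E (hD u);
  cl_lead : forall u a g, E u -> lead u a g ->
    [/\ E (mono K a 0), E (mono K a^-1 0), E (mono K 1 g) & E (mono K 1 (- g))];
  cl_zero : forall n (f : {mpoly K[n]}) d, over E f -> E (mono K 1 d) ->
    (exists h, vge h d /\ f.@[jet h] = 0) ->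
    exists h, [/\ E h, vge h d & f.@[jet h] = 0]
}.

Lemma mono_inj (g h : G) : mono K 1 g = mono K 1 h -> g = h.
Proof.
move=> E; have l := @lead_mono _ _ _ K 1 g (oner_neq0 _).
have l' := @lead_mono _ _ _ K 1 h (oner_neq0 _).
by rewrite E in l; have [_ ->] := lead_inj l l'.
Qed.

Lemma mono_injl (a b : k) (g : G) : mono K a g = mono K b g -> a = b.
Proof. by move=> /(congr1 (fun u => coef u g)); rewrite !coef_mono eqxx. Qed.

Lemma closure_leads (S : set K) : cset S ->
  exists E : set K, [/\ cset E, S `<=` E & closed_under_leads E].
Proof.
move=> cS; have /choice[ld ldP] : forall u : K, exists ag : k * G,
    u != 0 -> lead u ag.1 ag.2.
  move=> u; have [->|/lead_ex[a [g ug]]] := eqVneq u 0; first by exists (0, 0).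
  by exists (a, g).
have /choice[zr zrP] : forall x : K * {n : nat & {mpoly K[n]}}, exists h : K,
    forall d, x.1 = mono K 1 d -> (exists h, vge h d /\ (projT2 x.2).@[jet h] = 0) ->
    vge h d /\ (projT2 x.2).@[jet h] = 0.
  move=> [v [n f]] /=; have [[d [-> [h hP]]]|nd] := pselect (exists d, v = mono K 1 d /\
      exists h, vge h d /\ f.@[jet h] = 0).
    by exists h => d' /mono_inj <-.
  by exists 0 => d vd ex; case: nd; exists d.
(* Codes on the left name the basic operations. A code on the right names a number of variables and
   a list of monomials; the head of [s] then encodes a radius and its tail the coefficients of the
   polynomial whose zero is chosen. *)
pose op m (s : seq K) : K := match unpickle m : option (nat + {n : nat & seq 'X_{1..n}}) with
  | Some (inl 0%N) => 1
  | Some (inl 1%N) => s`_0 - s`_1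
  | Some (inl 2%N) => s`_0 * s`_1
  | Some (inl 3%N) => hD s`_0
  | Some (inl 4%N) => mono K (ld s`_0).1 0
  | Some (inl 5%N) => mono K (ld s`_0).1^-1 0
  | Some (inl 6%N) => mono K 1 (ld s`_0).2
  | Some (inl _) => mono K 1 (- (ld s`_0).2)
  | Some (inr (existT n ms)) => zr (s`_0, existT _ n
      (\sum_(i < size ms) s`_i.+1 *: 'X_[nth 0%MM ms i]))
  | None => 0
  end.
have [E [cE SE Eop]] := countable_closure (0 : K) op cS.
have op1 j u : E u -> E (op (pickle (inl j : nat + {n : nat & seq 'X_{1..n}})) [:: u]).
  by move=> Eu; apply: Eop => y; rewrite inE => /eqP ->.
have op2 j u v : E u -> E v ->
    E (op (pickle (inl j : nat + {n : nat & seq 'X_{1..n}})) [:: u; v]).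
  by move=> Eu Ev; apply: Eop => y; rewrite !inE => /orP[] /eqP ->.
exists E; split=> //; split.
- split.
  + have := Eop (pickle (inl 0%N : nat + {n : nat & seq 'X_{1..n}})) [::].
    by rewrite /op pickleK; apply.
  + by move=> u v Eu Ev; have := op2 1%N u v Eu Ev; rewrite /op pickleK.
  + by move=> u v Eu Ev; have := op2 2%N u v Eu Ev; rewrite /op pickleK.
- by move=> u Eu; have := op1 3%N u Eu; rewrite /op pickleK.
- move=> u a g Eu ug; have [-> ->] := lead_inj ug (ldP u (lead_neq0 ug)).
  split.
  + by have := op1 4%N u Eu; rewrite /op pickleK.
  + by have := op1 5%N u Eu; rewrite /op pickleK.
  + by have := op1 6%N u Eu; rewrite /op pickleK.
  + by have := op1 7%N u Eu; rewrite /op pickleK.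
- move=> n f d fE Ed exh.
  pose s := mono K 1 d :: [seq f@_m | m <- msupp f].
  have := Eop (pickle (inr (existT _ n (msupp f : seq 'X_{1..n}))
    : nat + {n : nat & seq 'X_{1..n}})) s.
  rewrite /op pickleK; set p := \sum_(i < _) _.
  have -> : p = f.
    rewrite /p [RHS]mpolyE (big_nth 0%MM) big_mkord; apply: eq_bigr => i _.
    by rewrite /s /= (nth_map 0%MM).
  move=> Ez; exists (zr (mono K 1 d, existT _ n f)).
  have [v z] := zrP (mono K 1 d, existT _ n f) d erefl exh.
  by split=> //; apply: Ez => y; rewrite inE => /predU1P[->|/mapP[m _ ->]].
Qed.

End Closure.

(** * Initial position and extension of the domain *)

Section Forth.
Variables (k1 k2 : diffFieldType) (G1 G2 : orderedAbGroupType).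
Variables (c1 : {additive G1 -> k1}) (c2 : {additive G2 -> k2}).
Variables (A : hcore c1) (B : hcore c2).
Local Notation W := (hring A * hring B)%type.

Record bf_state (R : forall s, kgc_structure c1 s -> kgc_structure c2 s -> Prop)
    (Phi : W -> Prop) : Prop := BFState {
  bf_elem : elem_rel R;
  bf_cset : cset_rel R;
  bf_iso : partial_iso c1 c2 (relk R) (relG R);
  bf_good : good (relk R) (relG R) Phi;
  bf_csetPhi : cset Phi
}.

Lemma closed_dom (E : set A) : closed_under_leads E ->
  [/\ E (mono A 0 0), E (mono A 1 0), forall a b, E (mono A a 0) -> E (mono A b 0) ->
    E (mono A (a - b) 0) /\ E (mono A (a * b) 0),
    forall a, E (mono A a 0) -> E (mono A a^-1 0) /\ E (mono A (der a) 0) &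
    (forall g h, E (mono A 1 g) -> E (mono A 1 h) -> E (mono A 1 (g - h))) /\
    forall g, E (mono A 1 g) -> E (mono A (c1 g) 0)].
Proof.
move=> [sE DE lE _]; have [E1 EB EM] := sE.
have E0 : E (mono A 0 0) by rewrite mono0; apply: subring0 sE.
have neg g : E (mono A 1 g) -> E (mono A 1 (- g)).
  by move=> Eg; have [] := lE _ _ _ Eg (@lead_mono _ _ _ A 1 g (oner_neq0 _)).
have der1 : der (1 : k1) = 0.
  have := derM (1 : k1) 1; rewrite !mulr1 mul1r -[LHS]addr0 => /addrI <-.
  by [].
split=> //; first by rewrite mono1.
- move=> a b Ea Eb; have := EM _ _ Ea Eb.
  by rewrite monoM addr0 => ?; split=> //; rewrite monoB; apply: EB.
- move=> a Ea; split.
    have [->|a0] := eqVneq a 0; first by rewrite invr0.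
    by have [] := lE _ _ _ Ea (@lead_mono _ _ _ A a 0 a0).
  by have := DE _ Ea; rewrite hD_mono raddf0 mul0r addr0.
- split=> [g h Eg Eh|g Eg].
    by rewrite -[1]mulr1 -monoM; apply: EM => //; apply: neg.
  (* The value [c1 g] is the logarithmic derivative of the monomial of exponent [g]. *)
  have := EM _ _ (DE _ Eg) (neg _ Eg).
  by rewrite hD_mono monoM der1 add0r !mulr1 subrr.
Qed.

Hypotheses (hA : hensel A) (hB : hensel B).
Hypothesis satB : forall n (p : {mpoly B[n]}) (a : nat -> B) (g : nat -> G2),
  (forall J, exists y, p.@[jet y] = 0 /\ forall j, (j < J)%N -> vge (y - a j) (g j)) ->
  exists y, p.@[jet y] = 0 /\ forall j, vge (y - a j) (g j).
Variables (M0 : structure kgc_language)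
  (q : forall s, (nat -> M0 s) -> kgc_structure c2 s).
Hypothesis Nq : is_ultrapower q.

Definition dom_set (Dk : k1 -> Prop) (DG : G1 -> Prop) :
    set {s : sort kgc_language & kgc_structure c1 s} :=
  fun t => match t with
    | existT KField a => Dk a
    | existT KGroup g => DG g
    end.

Lemma cset_dom (Dk : k1 -> Prop) (DG : G1 -> Prop) : cset Dk -> cset DG ->
  cset (dom_set Dk DG).
Proof.
move=> cDk cDG; pose M := kgc_structure c1.
apply: cset_sub (csetU (cset_image (fun a : k1 => existT M KField a) cDk)
  (cset_image (fun g : G1 => existT M KGroup g) cDG)).
by move=> [[] y] /= Dy; [left | right]; exists y.
Qed.

(** The extended relation is cut back to exactly the prescribed domain, so that closure properties
    of [Dk] and [DG] become closure properties of the relation. *)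
Lemma extend_domain (R : forall s, kgc_structure c1 s -> kgc_structure c2 s -> Prop)
    (Dk : k1 -> Prop) (DG : G1 -> Prop) :
  elem_rel R -> cset_rel R -> cset Dk -> cset DG ->
  (forall a b, R KField a b -> Dk a) -> (forall g h, R KGroup g h -> DG g) ->
  exists R' : forall s, kgc_structure c1 s -> kgc_structure c2 s -> Prop,
    [/\ elem_rel R', cset_rel R', forall s x y, R s x y -> R' s x y,
    forall a, Dk a <-> exists b, R' KField a b & forall g, DG g <-> exists h, R' KGroup g h].
Proof.
move=> eR cR cDk cDG RDk RDG; have [cS cF cRs] := kgc_countable.
have [R1 [eR1 cR1 RR1 DR1]] := elem_extend cS cF cRs Nq eR cR (cset_dom cDk cDG).
exists (fun s x y => R1 s x y /\ dom_set Dk DG (existT _ s x)); split.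
- by move=> G p e e' ee'; apply: eR1 => s v; case: (ee' s v).
- by apply: cset_sub cR1 => x [].
- move=> s x y Rxy; split; first exact: RR1.
  by case: s x y Rxy => x y /=; [apply: RDk | apply: RDG].
- move=> a; split=> [Da|[b []] //].
  by have [b Rb] := DR1 KField a Da; exists b.
- move=> g; split=> [Dg|[h []] //].
  by have [h Rh] := DR1 KGroup g Dg; exists h.
Qed.

Lemma forth R Phi (x : A) : bf_state R Phi ->
  exists R' Phi' y, [/\ bf_state R' Phi', forall w, Phi w -> Phi' w & Phi' (x, y)].
Proof.
move=> [eR cR iR gR cPhi].
have [|E [cE SE EE]] := @closure_leads _ _ _ A (fst @` Phi `|` [set x]).
  by apply: csetU; [apply: cset_image | apply: cset1].
have Ex : E x by apply: SE; right.
have PhiE w : Phi w -> E w.1 by move=> Pw; apply: SE; left; exists w.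
have [sE DE lE zE] := EE.
have [Rcl Rmono _] := gR.
pose Dk a := E (mono A a 0); pose DG g := E (mono A 1 g).
have cDk : cset Dk.
  by apply: (cset_preim (h := fun a => mono A a 0)) cE => // a b _ _; apply: mono_injl.
have cDG : cset DG.
  by apply: (cset_preim (h := fun g => mono A 1 g)) cE => // a b _ _; apply: mono_inj.
have RDk a b : R KField a b -> Dk a.
  by move=> Rab; apply: (PhiE _ (Rmono (a, b) 0 Rab (pg0 iR))).
have RDG g h : R KGroup g h -> DG g.
  by move=> Rgh; apply: (PhiE _ (Rmono 1 (g, h) (pi1 iR) Rgh)).
have [R' [eR' cR' RR' DkR DGR]] := extend_domain eR cR cDk cDG RDk RDG.
have [D0 D1 DBM DVd [DGB Dc]] := closed_dom EE.
have iR' : partial_iso c1 c2 (relk R') (relG R').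
  apply: (@elem_partial_iso _ _ _ _ _ _ R' eR' Dk DG) => //.
  - by move=> a b Da Db; case: (DBM a b Da Db).
  - by move=> a b Da Db; case: (DBM a b Da Db).
  - by move=> a Da; case: (DVd a Da).
  - by move=> a Da; case: (DVd a Da).
have RkS a : relk R a -> relk R' a by apply: RR'.
have RGS g : relG R g -> relG R' g by apply: RR'.
pose Phi1 := mono_sums (relk R') (relG R') Phi.
have gPhi1 : good (relk R') (relG R') Phi1 := good_mono_sums iR iR' RkS RGS gR.
have monoE a g : relk R' a -> relG R' g -> E (pmono A B a g).1.
  move=> Ra Rg; have Da : Dk a.1 by apply/DkR; exists a.2.
  have Dg : DG g.1 by apply/DGR; exists g.2.
  have [_ _ EM] := sE; have := EM _ _ Da Dg.
  by rewrite monoM mulr1 add0r.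
have cE1 : ring_closed (fun w : W => E w.1).
  have [E1 EB EM] := sE; split=> //.
  - by move=> v w; apply: EB.
  - by move=> v w; apply: EM.
  - by move=> w; apply: DE.
have Phi1E w : Phi1 w -> E w.1.
  exact: (mono_sums_min cE1 PhiE monoE).
(* Stating [P] for the union with [Phi1] makes the empty chain harmless in Zorn's lemma. *)
pose P (X : set W) := good (relk R') (relG R') (Phi1 `|` X) /\
  forall w, (Phi1 `|` X) w -> E w.1.
have [F FP Ftot|X [[gX XE] Xmax]] := @Zorn_bigcup W P.
  have two v w : (Phi1 `|` \bigcup_(X in F) X) v -> (Phi1 `|` \bigcup_(X in F) X) w ->
      exists Y : set W, [/\ good (relk R') (relG R') Y, forall w, Y w -> E w.1,
        Y v, Y w & forall u, Y u -> (Phi1 `|` \bigcup_(X in F) X) u].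
    have Y1 X : F X -> forall u, (Phi1 `|` X) u -> (Phi1 `|` \bigcup_(X in F) X) u.
      by move=> FX u [P1u|Xu]; [left | right; exists X].
    case=> [P1v|[X FX Xv]] [P1w|[Y FY Yw]].
    - by exists Phi1; split=> // u; left.
    - by have [gY YE] := FP _ FY; exists (Phi1 `|` Y); split=> //;
        [left | right | apply: Y1].
    - by have [gX XE] := FP _ FX; exists (Phi1 `|` X); split=> //;
        [right | left | apply: Y1].
    have [XY|YX] := Ftot _ _ FX FY.
      by have [gY YE] := FP _ FY; exists (Phi1 `|` Y); split=> //;
        [right; apply: XY | right | apply: Y1].
    by have [gX XE] := FP _ FX; exists (Phi1 `|` X); split=> //;
      [right | right; apply: YX | apply: Y1].
  split; last by move=> w w_in; have [Y [_ YE Yw _ _]] := two w w w_in w_in; apply: YE.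
  split.
  - split.
    + by left; case: gPhi1 => -[].
    + move=> v w v_in w_in; have [Y [gY _ Yv Yw Ysub]] := two v w v_in w_in.
      by apply: Ysub; case: gY => cY _ _; apply: closedB.
    + move=> v w v_in w_in; have [Y [gY _ Yv Yw Ysub]] := two v w v_in w_in.
      by apply: Ysub; case: gY => cY _ _; apply: closedM.
    + move=> w w_in; have [Y [gY _ Yw _ Ysub]] := two w w w_in w_in.
      by apply: Ysub; case: gY => cY _ _; apply: closed_D.
  - by move=> a g Ra Rg; left; case: gPhi1 => _ + _; apply.
  - move=> w w_in; have [Y [gY _ Yw _ _]] := two w w w_in w_in.
    by case: gY => _ _; apply.
set Phi2 := Phi1 `|` X in gX XE.
(* A difference with vanishing first component vanishes by matching, so [Phi2] injects into the
   countable set [E]. *)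
have cPhi2 : cset Phi2.
  apply: (cset_preim (h := fst)) cE => // v w Pv Pw vw.
  have [cX _ mX] := gX; have := mX _ (closedB cX Pv Pw).
  move=> /(match_eq0 (w := v - w)) [+ _]; rewrite /= vw subrr => /(_ erefl)/eqP.
  by rewrite subr_eq0 => /eqP; apply: pair_eq.
have cRG : cset (relG R').
  apply: (cset_preim (h := fun g : G1 * G2 => existT
    (fun s => (kgc_structure c1 s * kgc_structure c2 s)%type) KGroup g)) cR' => // g h _ _.
  exact: (@existT_inj _ (fun s => (kgc_structure c1 s * kgc_structure c2 s)%type) KGroup).
suff [y Pxy] : exists y, Phi2 (x, y).
  exists R', Phi2, y; split=> // w Pw; left.
  exact: (mono_sums_sub iR' Pw).
apply: contrapT => nx.
have xPhi w : Phi2 w -> w.1 <> x.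
  by move=> Pw wx; apply: nx; exists w.2; rewrite -wx -surjective_pairing.
have leadE u a g : E u -> lead u a g ->
    (exists a', relk R' (a, a')) /\ exists g', relG R' (g, g').
  by move=> Eu ug; have [Ea _ Eg _] := lE _ _ _ Eu ug; split; [apply/DkR | apply/DGR].
have zeroE n (f : {mpoly A[n]}) d d' : over E f -> relG R' (d, d') ->
    (exists h, vge h d /\ f.@[jet h] = 0) ->
    exists h, [/\ E h, vge h d & f.@[jet h] = 0].
  by move=> fE Rd; apply: zE => //; apply/DGR; exists d'.
have [z [T [cT PT Tz mT [Ez zPhi]]]] :=
  adjoin_ex iR' gX cPhi2 cRG hA hB satB sE DE XE leadE zeroE Ex xPhi.
pose T' := [set w | T w /\ E w.1].
have P2T w : Phi2 w -> T' w by move=> Pw; split; [apply: PT | apply: XE].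
have T'E : Phi1 `|` T' = T'.
  by apply/seteqP; split=> w; [case=> // P1w; apply: P2T; left | right].
apply: (Xmax T').
  split; last by move=> /(_ z (conj Tz Ez)) Xz; apply: (zPhi z) => //; right.
  by move=> w Xw; apply: P2T; right.
rewrite /P T'E; split; last by move=> w [].
have [E1 EB EM] := sE; split.
- split.
  + by split=> //; apply: closed1.
  + by move=> v w [Tv Ev] [Tw Ew]; split; [apply: closedB | apply: EB].
  + by move=> v w [Tv Ev] [Tw Ew]; split; [apply: closedM | apply: EM].
  + by move=> w [Tw Ew]; split; [apply: closed_D | apply: DE].
- by move=> a g Ra Rg; apply: P2T; case: gX => _ + _; apply.
- by move=> w [Tw _]; apply: mT.
Qed.

(** Elementary equivalence says that the empty relation is elementary. It is extended to a countable
    differential field, so that the first ring can consist of its elements placed at exponent 0. *)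
Lemma bf_init : elementarily_equivalent (kgc_structure c1) (kgc_structure c2) ->
  exists R Phi, bf_state R Phi.
Proof.
move=> equiv.
pose R0 s (x : kgc_structure c1 s) (y : kgc_structure c2 s) := False.
have eR0 : elem_rel R0.
  move=> [|s G] p e e' ee'; last by have := ee' s (VZ s G).
  have -> : e = @env_nil _ (kgc_structure c1).
    by apply: env_ext => s v; have := var_nil False v.
  have -> : e' = @env_nil _ (kgc_structure c2).
    by apply: env_ext => s v; have := var_nil False v.
  exact: equiv.
have cR0 : cset_rel R0 by exists (fun=> 0%N) => x y [].
have [|E [cE _ EE]] := @closure_leads _ _ _ A set0; first by exists (fun=> 0%N) => x y [].
(* The group part starts trivial; the monomials required by [good] then all have exponent 0. *)
pose Dk a := E (mono A a 0); pose DG (g : G1) := g = 0.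
have cDk : cset Dk.
  by apply: (cset_preim (h := fun a => mono A a 0)) cE => // a b _ _; apply: mono_injl.
have cDG : cset DG := cset1 0.
have [||R [eR cR _ DkR DGR]] := extend_domain eR0 cR0 cDk cDG; try by [].
have [D0 D1 DBM DVd _] := closed_dom EE.
have iR : partial_iso c1 c2 (relk R) (relG R).
  apply: (@elem_partial_iso _ _ _ _ _ _ R eR Dk DG) => //.
  - by move=> a b Da Db; case: (DBM a b Da Db).
  - by move=> a b Da Db; case: (DBM a b Da Db).
  - by move=> a Da; case: (DVd a Da).
  - by move=> a Da; case: (DVd a Da).
  - by move=> g h -> ->; rewrite /DG subrr.
  - by move=> g ->; rewrite raddf0.
have RG0 g : relG R g -> g = 0.
  move=> Rg; have g1 : g.1 = 0 by apply/DGR; exists g.2.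
  exact: (pg_inj iR Rg (pg0 iR) g1).
pose Phi w := exists a, relk R a /\ w = pmono A B a 0.
exists R, Phi; split=> //.
- split.
  + split.
    * by exists 1; rewrite pmono1; split=> //; apply: (pi1 iR).
    * move=> _ _ [a [Ra ->]] [b [Rb ->]]; exists (a - b); split; first exact: (piB iR).
      by rewrite pmonoD pmonoN.
    * move=> _ _ [a [Ra ->]] [b [Rb ->]]; exists (a * b); split; first exact: (piM iR).
      by rewrite pmonoM addr0.
    * move=> _ [a [Ra ->]]; rewrite pD_mono; exists (kder a + kc c1 c2 0 * a).
      split=> //; apply: (piD iR); first exact: (piDer iR).
      by apply: (piM iR) => //; apply: (pgc iR); apply: (pg0 iR).
  + by move=> a g Ra /RG0 ->; exists a.
  + move=> _ [a [Ra ->]]; have [a0|a0] := eqVneq a.1 0.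
      by left; have := pi_eq0 iR Ra; rewrite /= a0 mono0 => -[/(_ erefl) -> _]; rewrite mono0.
    right; exists a, 0; split=> //; first exact: (pg0 iR).
      exact: lead_mono.
    by apply: lead_mono; rewrite -(pi_neq0 iR Ra).
- apply: cset_sub (cset_image (fun x : {s : sort kgc_language &
    (kgc_structure c1 s * kgc_structure c2 s)%type} =>
    (match x with existT KField a => pmono A B a 0 | _ => 0 end : W)) cR).
  by move=> _ [a [Ra ->]]; exists (existT _ KField a).
Qed.

End Forth.

Section Swap.
Variables (k1 k2 : diffFieldType) (G1 G2 : orderedAbGroupType).
Variables (c1 : {additive G1 -> k1}) (c2 : {additive G2 -> k2}).
Variables (A : hcore c1) (B : hcore c2).

Lemma bf_swap R (Phi : (hring A * hring B)%type -> Prop) : bf_state R Phi ->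
  bf_state (A := B) (B := A) (fun s y x => R s x y) (fun w => Phi (w.2, w.1)).
Proof.
move=> [eR cR iR [cP mP matchP] cPhi]; split.
- by move=> G p e e' ee'; rewrite eR //.
- apply: (cset_preim (h := fun x : {s : sort kgc_language &
    (kgc_structure c2 s * kgc_structure c1 s)%type} => existT
    (fun s => (kgc_structure c1 s * kgc_structure c2 s)%type) (projT1 x)
    ((projT2 x).2, (projT2 x).1))) cR => [x //|[s [a b]] [s' [a' b']] _ _ /= E].
  pose F (x : {s : sort kgc_language & (kgc_structure c1 s * kgc_structure c2 s)%type}) :=
    existT (fun s => (kgc_structure c2 s * kgc_structure c1 s)%type) (projT1 x)
    ((projT2 x).2, (projT2 x).1).
  exact: (congr1 F E).
- case: iR => r1 rB rM rV rD re0 g0 gB gle gc; split.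
  + exact: r1.
  + by move=> a b Ra Rb; apply: (rB (a.2, a.1) (b.2, b.1)).
  + by move=> a b Ra Rb; apply: (rM (a.2, a.1) (b.2, b.1)).
  + by move=> a Ra; apply: (rV (a.2, a.1)).
  + by move=> a Ra; apply: (rD (a.2, a.1)).
  + by move=> a Ra; have [? ?] := re0 (a.2, a.1) Ra.
  + exact: g0.
  + by move=> a b Ra Rb; apply: (gB (a.2, a.1) (b.2, b.1)).
  + by move=> g h Rg Rh; rewrite -(gle (g.2, g.1) (h.2, h.1)).
  + by move=> g Rg; apply: (gc (g.2, g.1)).
- case: cP => P1 PB PM PD; split.
  + split=> //.
    * by move=> v w Pv Pw; apply: (PB (v.2, v.1) (w.2, w.1)).
    * by move=> v w Pv Pw; apply: (PM (v.2, v.1) (w.2, w.1)).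
    * by move=> w Pw; apply: (PD (w.2, w.1)).
  + by move=> a g Ra Rg; apply: (mP (a.2, a.1) (g.2, g.1)).
  + move=> w /matchP[[w2 w1]|[a [g [Ra Rg l2 l1]]]]; first by left.
    by right; exists (a.2, a.1), (g.2, g.1); case: a g Ra Rg l1 l2 => a1 a2 [g1 g2].
- apply: (cset_preim (h := fun w => (w.2, w.1))) cPhi => // -[v1 v2] [w1 w2] _ _ /=.
  by case=> -> ->.
Qed.

End Swap.

(** * Elementary equivalence from the game *)

Section BackAndForth.
Variables (k1 k2 : diffFieldType) (G1 G2 : orderedAbGroupType).
Variables (c1 : {additive G1 -> k1}) (c2 : {additive G2 -> k2}).
Variables (A : hcore c1) (B : hcore c2).

Lemma bf_eval (Phi : (hring A * hring B)%type -> Prop) (G : seq (sort vdf_language))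
    s (t : term G s) (e : env (core_structure A) G) (e' : env (core_structure B) G) :
  ring_closed Phi -> (forall s v, Phi (e s v, e' s v)) -> Phi (eval e t, eval e' t).
Proof.
move=> cP ee'; elim: t => //= f a IH.
case: f a IH => a IH /=.
- exact: (closed0 cP).
- exact: (closed1 cP).
- exact: (closedN cP (IH ord0)).
- exact: (closedD cP (IH ord0) (IH ord_max)).
- exact: (closedM cP (IH ord0) (IH ord_max)).
- exact: (closed_D cP (IH ord0)).
Qed.

(** Leading terms decide the atomic formulas: an equation is the vanishing of a difference, and
    membership in the valuation ring is a comparison with exponent 0. The two moves handle the
    quantifier. *)
Lemma bf_holds :
  (forall R (Phi : (hring A * hring B)%type -> Prop) x, bf_state R Phi ->
    exists R' Phi' y, [/\ bf_state R' Phi', forall w, Phi w -> Phi' w & Phi' (x, y)]) ->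
  (forall R (Phi : (hring A * hring B)%type -> Prop) y, bf_state R Phi ->
    exists R' Phi' x, [/\ bf_state R' Phi', forall w, Phi w -> Phi' w & Phi' (x, y)]) ->
  forall (G : seq (sort vdf_language)) (p : formula G) R
    (Phi : (hring A * hring B)%type -> Prop)
    (e : env (core_structure A) G) (e' : env (core_structure B) G),
  bf_state R Phi -> (forall s v, Phi (e s v, e' s v)) -> holds p e <-> holds p e'.
Proof.
move=> fo ba G p; elim: G / p => /= [G s t u|G r a|G|G p IHp p' IHp'|G s p IHp] R Phi e e' st ee'.
- have [_ _ _ [cP _ mP] _] := st.
  have := mP _ (closedB cP (bf_eval t cP ee') (bf_eval u cP ee')).
  move=> /match_eq0 /= E; split=> /eqP; rewrite -subr_eq0 => /eqP /E /eqP;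
  by rewrite subr_eq0 => /eqP.
- have [_ _ iR [cP _ mP] _] := st.
  exact: (match_vge iR (mP _ (bf_eval (a ord0) cP ee')) (pg0 iR)).
- by [].
- by rewrite (IHp R Phi e e') // (IHp' R Phi e e').
- have env2 (R' : forall s, kgc_structure c1 s -> kgc_structure c2 s -> Prop)
      (Phi' : (hring A * hring B)%type -> Prop) (x : core_structure A s)
      (y : core_structure B s) : bf_state R' Phi' -> (forall w, Phi w -> Phi' w) ->
      Phi' (x, y) -> holds p (env_cons x e) <-> holds p (env_cons y e').
    move=> st' PP' P'xy; apply: (IHp R' Phi' _ _ st').
    move=> s' v; exact: (@var_inv _ s G (fun s' v => Phi' (env_cons x e v, env_cons y e' v))
      P'xy (fun s' v => PP' _ (ee' s' v)) s' v).
  split=> H z.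
    have [R' [Phi' [x [st' PP' P'x]]]] := ba R Phi z st.
    exact/(env2 R' Phi' x z).
  have [R' [Phi' [y [st' PP' P'y]]]] := fo R Phi z st.
  exact/(env2 R' Phi' z y).
Qed.

End BackAndForth.

Theorem theorem1 (k1 k2 : diffFieldType) (G1 G2 : orderedAbGroupType)
    (c1 : {additive G1 -> k1}) (c2 : {additive G2 -> k2}) :
  linearly_surjective k1 -> linearly_surjective k2 ->
  elementarily_equivalent (kgc_structure c1) (kgc_structure c2) ->
  elementarily_equivalent (hahn_structure c1) (hahn_structure c2).
Proof.
move=> ls1 ls2 equiv p.
pose A := ult_core (hahn_core c1); pose B := ult_core (hahn_core c2).
have hA : hensel A by apply/ult_hensel/spherical_hensel => //; apply: hahn_spherical.
have hB : hensel B by apply/ult_hensel/spherical_hensel => //; apply: hahn_spherical.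
rewrite (ultrapower_equiv (hahn_ultrapower c1)) (ultrapower_equiv (hahn_ultrapower c2)).
have equiv' : elementarily_equivalent (kgc_structure (umapc c1)) (kgc_structure (umapc c2)).
  move=> r; rewrite -(ultrapower_equiv (kgc_ultrapower c1)).
  by rewrite -(ultrapower_equiv (kgc_ultrapower c2)).
have [R [Phi st]] := bf_init A B (kgc_ultrapower c2) equiv'.
apply: (@bf_holds _ _ _ _ _ _ A B _ _ _ p R Phi) => //.
- move=> R' Phi' x; move=> st'.
  exact: (forth hA hB (@ult_core_saturated _ _ _ (hahn_core c2)) (kgc_ultrapower c2) x st').
- move=> R' Phi' y /bf_swap st'.
  have [R1 [Phi1 [x [st1 PP1 P1]]]] :=
    forth hB hA (@ult_core_saturated _ _ _ (hahn_core c1)) (kgc_ultrapower c1) y st'.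
  exists (fun s a b => R1 s b a), (fun w => Phi1 (w.2, w.1)), x; split.
  + exact: bf_swap st1.
  + by move=> [w1 w2] Pw; apply: (PP1 (w2, w1)).
  + exact: P1.
- by move=> s v; have := var_nil False v.
Qed.
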